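(* Let $r\in(0,1]$ and let $E_t$ be a smooth evolution ($C^1$ in time and $C^2$ in space) of a set $E\subset\mathbb{R}^2$ (so $E_0=E$) according to the flow $\partial_t x_t\cdot\nu_{E_t}(x_t)=-\kappa_r(E_t,x_t)$ for $x_t\in\partial E_t$. Suppose that $E$ is $r$-thin and convex. Then $E_t$ is $r$-thin and convex for every $t$ up to the extinction time.
   Context: Balls are open. For $E\subset\mathbb{R}^2$ with $C^2$ boundary and $x\in\partial E$, let $\nu_E(x)$ be the external unit normal, $\kappa(E,x)$ the curvature of $\partial E$ at $x$ (nonnegative for convex sets), and $B^{\mathrm{ext}}_{r,x}:=B_r(x+r\nu_E(x))$, $B^{\mathrm{int}}_{r,x}:=B_r(x-r\nu_E(x))$. The $r$-curvature is $\kappa_r(E,x):=\kappa_r^+(E,x)+\kappa_r^-(E,x)$, where $\kappa_r^+(E,x):=\frac{\kappa(E,x)}2+\frac1{2r}$ if $B^{\mathrm{ext}}_{r,x}\subseteq\mathbb{R}^2\setminus E$ and $\kappa_r^+(E,x):=0$ otherwise; $\kappa_r^-(E,x):=\frac{\kappa(E,x)}2-\frac1{2r}$ if $B^{\mathrm{int}}_{r,x}\subseteq E$ and $\kappa_r^-(E,x):=0$ otherwise. A set $E\subseteq\mathbb{R}^2$ is $r$-thin if, after a rigid motion, $E\subseteq\mathbb{R}\times(-\rho,\rho)$ for some $\rho\in(0,r)$. *)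

(* Defs.v *)
From HB Require Import structures.
From mathcomp Require Import all_boot all_order all_algebra.
From mathcomp Require Import all_classical all_reals all_analysis.

Set Implicit Arguments.
Unset Strict Implicit.
Unset Printing Implicit Defensive.

Import Order.TTheory GRing.Theory Num.Theory.
Import numFieldNormedType.Exports.

Local Open Scope ring_scope.
Local Open Scope classical_set_scope.

Notation plane R := 'rV[R]_2.

Section Euclidean.
Context {R : realType}.
Implicit Types (u v x : plane R) (E : set (plane R)).

Definition dot u v : R := \sum_(i < 2) u 0 i * v 0 i.

(* The library norm on 'rV[R]_2 is the sup norm; it induces the same topology,
   but balls and unit vectors have to be Euclidean. *)
Definition enorm u : R := Num.sqrt (dot u u).

Definition eball x (r : R) : set (plane R) := [set y | enorm (y - x) < r].

Definition perp u : plane R :=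
  \row_(i < 2) (if i == 0 then - u 0 1 else u 0 0).

Definition boundary E : set (plane R) := closure E `\` interior E.

Definition convex E : Prop := convex_set (E : set (convex_lmodType (plane R))).

Definition rigid_motion (M : plane R -> plane R) : Prop :=
  exists (A : 'M[R]_2) (b : plane R),
    A *m A^T = 1%:M /\ forall x, M x = x *m A + b.

Definition r_thin (r : R) E : Prop :=
  exists M : plane R -> plane R, rigid_motion M /\
  exists rho : R, 0 < rho < r /\ M @` E `<=` [set y | - rho < y 0 1 < rho].

End Euclidean.

Section Curvature.
Context {R : realType}.
Implicit Types (x nu : plane R) (E : set (plane R)).

Definition C2_near (f : R -> R) (s0 : R) : Prop :=
  \forall s \near s0, [/\ derivable f s 1, derivable f^`() s 1
                        & {for s, continuous f^`(2)}].

(* In the orthonormal frame (perp nu, nu) centred at x, and inside the square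
   of half-side d, E is the part lying below the graph of f. Both the strict
   and the large subgraph are accepted, so that open and closed sets are
   covered alike. *)
Definition local_subgraph E x nu (f : R -> R) (d : R) : Prop :=
  (forall s h, `|s| < d -> `|h| < d ->
     (E (x + s *: perp nu + h *: nu) <-> h < f s)) \/
  (forall s h, `|s| < d -> `|h| < d ->
     (E (x + s *: perp nu + h *: nu) <-> h <= f s)).

(* The boundary of E is, near x, the graph of the C^2 function f over its
   tangent line at x, and nu is the external unit normal at x. *)
Definition boundary_graph E x nu (f : R -> R) : Prop :=
  [/\ enorm nu = 1, C2_near f 0, f 0 = 0, f^`() 0 = 0
    & exists2 d, 0 < d & local_subgraph E x nu f d].

(* At a boundary point where E has C^2 boundary, the sets below are singletons;
   elsewhere the values are irrelevant. *)
Definition normal E x : plane R :=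
  xget 0 [set nu | exists f, boundary_graph E x nu f].

Definition curvature E x : R :=
  xget 0 [set k | exists nu f, boundary_graph E x nu f /\ k = - (f^`(2) 0)%classic].

Definition ball_ext (r : R) E x := eball (x + r *: normal E x) r.
Definition ball_int (r : R) E x := eball (x - r *: normal E x) r.

Definition kappa_plus (r : R) E x : R :=
  if `[< ball_ext r E x `<=` ~` E >]
  then curvature E x / 2 + (2 * r)^-1 else 0.

Definition kappa_minus (r : R) E x : R :=
  if `[< ball_int r E x `<=` E >]
  then curvature E x / 2 - (2 * r)^-1 else 0.

Definition kappa (r : R) E x : R := kappa_plus r E x + kappa_minus r E x.

End Curvature.

Section Evolution.
Context {R : realType}.
Implicit Types (T : \bar R) (E : R -> set (plane R)).

Definition lifespan T : set R := [set t | 0 <= t /\ (t%:E < T)%E].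

Definition C12_near (f : R -> R -> R) (t0 s0 : R) : Prop :=
  \forall p \near (t0, s0),
    [/\ derivable (f ^~ p.2) p.1 1,
        derivable (f p.1) p.2 1,
        derivable (f p.1)^`() p.2 1
      & [/\ {for p, continuous (fun q : R * R => (f ^~ q.2)^`() q.1)},
            {for p, continuous (fun q : R * R => (f q.1)^`() q.2)}
          & {for p, continuous (fun q : R * R => (f q.1)^`(2) q.2)}]].

(* Smoothness of (E t) for 0 <= t < T: near each of its points, the moving
   boundary is the graph over a tangent line of a function f t s that is C^1 in
   t and C^2 in s. At t0 = 0 the function f is defined for t < 0 as well, which
   amounts to C^1 regularity up to the initial time; only its values at times
   in the lifespan are related to E. *)
Definition smooth_boundary T E : Prop :=
  forall t0 x0, lifespan T t0 -> boundary (E t0) x0 ->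
  exists nu (f : R -> R -> R),
    [/\ enorm nu = 1, C12_near f t0 0, f t0 0 = 0, (f t0)^`() 0 = 0
      & exists2 d, 0 < d & forall t, lifespan T t -> `|t - t0| < d ->
          local_subgraph (E t) x0 nu (f t) d].

(* Away from the boundary, E t is locally constant in time: no new boundary
   component can nucleate. *)
Definition no_nucleation T E : Prop :=
  forall t0 x0, lifespan T t0 ->
    (interior (E t0) x0 ->
       \forall p \near (t0, x0), lifespan T p.1 -> E p.1 p.2) /\
    (interior (~` E t0) x0 ->
       \forall p \near (t0, x0), lifespan T p.1 -> ~ E p.1 p.2).

Definition smooth_evolution T E : Prop :=
  smooth_boundary T E /\ no_nucleation T E.

(* The law holds along every differentiable curve t |-> x t of boundary points;
   the normal component of its velocity does not depend on the curve. At
   t0 = 0 only the part of the curve with t >= 0 is constrained to the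
   boundary. *)
Definition curvature_flow (r : R) T E : Prop :=
  forall (t0 : R) (x : R -> plane R), lifespan T t0 ->
    derivable x t0 1 ->
    (\forall t \near t0, lifespan T t -> boundary (E t) (x t)) ->
    dot (x^`() t0)%classic (normal (E t0) (x t0)) = - kappa r (E t0) (x t0).

End Evolution.

(* Main.v *)
Require Import Defs.
From mathcomp Require Import all_boot all_order all_algebra.
From mathcomp Require Import all_classical all_reals all_analysis.
From mathcomp Require Import ring lra.

Set Implicit Arguments.
Unset Strict Implicit.
Unset Printing Implicit Defensive.

Import Order.TTheory GRing.Theory Num.Theory.
Import numFieldNormedType.Exports.
Local Open Scope ring_scope.
Local Open Scope classical_set_scope.

(** The evolution is compared with itself at a slightly later time.

    Thinness. A disc of radius [rho >= r] in the exterior of [E t] shrinks at a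
    rate at most [1 / rho]: where it touches the boundary, the curvature is at
    least [- 1 / rho], and the exterior [r]-ball, being contained in the disc, is
    free ([kappa_contact_ge], [flow_disc_barrier]). Letting [rho] go to infinity,
    every half-plane containing the initial set contains [E t]
    ([halfplane_preserved]). So [E t] stays in the initial strip, which contains no
    [r]-ball; thus [kappa] reduces to [kappa_plus], which is nonnegative
    ([kappa_minus_thin], [kappa_plus_ge0]), and the sets shrink.

    Convexity. Fix [eps > 0]. Since [E 0] is convex, large discs tangent to it from
    outside grow, and the convex hull of [E eps] is at a distance [g > 0] from the
    complement of [E 0] ([tangent_retreat], [gap_initial]). The distance from the
    convex hull of [E (t + eps)] to the complement of [E t] remains at least [g]
    ([gap_all]). Indeed, let [z] and [w] be closest points, [z] a barycentre of
    points [p_i] with weights [lam_i]. The [p_i] lie on a common supporting line, so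
    their exterior [r]-balls are free and they move inwards with velocity
    [k_i / 2 + 1 / (2 * r)], where [k_i] is the curvature. Moving all points
    tangentially by the same amount shows that the curvature [k] at [w] is at most
    the mean of the [k_i]; and [w] moves inwards with velocity 0 or
    [k / 2 + 1 / (2 * r)]. Hence the distance does not decrease. Letting [eps] tend
    to 0, convex combinations of points of [E t] lie in the closure of [E t]
    ([convex_combinations_in_closure]), and the regularity of the boundary gives
    convexity of [E t] itself ([convex_of_closure]).

    The set may be unbounded, so that closest points need not exist. What is
    minimised is the distance plus [eta] times the second moment of the [p_i], plus a
    small multiple of time. As the penalty is linear in the weights, a minimiser
    still has an analogue of the supporting line: the set lies outside a disc of
    radius close to [1 / (2 * eta)], with all the [p_i] on its circle ([cost_atom],
    [phase_off_disc]). The comparison of velocities then holds up to errors that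
    vanish with [eta] ([no_stationary]). The distance must not degenerate in the
    process, which is ensured on short time intervals of fixed length by discs
    inside the set ([inner_disc_persists]). *)

(** * Euclidean geometry of the plane *)

Section Plane.
Context {R : realType}.
Implicit Types (u v w x y p c : plane R) (a b e : R) (A : set (plane R)).

Lemma dotE u v : dot u v = u 0 0 * v 0 0 + u 0 1 * v 0 1.
Proof. by rewrite /dot big_ord_recl big_ord1; congr (_ + u _ _ * v _ _); apply: val_inj. Qed.

Lemma planeP u v : u 0 0 = v 0 0 -> u 0 1 = v 0 1 -> u = v.
Proof.
move=> h0 h1; apply/rowP => -[[|[|//]] h].
  by rewrite (_ : Ordinal h = 0) //; apply: val_inj.
by rewrite (_ : Ordinal h = 1) //; apply: val_inj.
Qed.

Lemma dotC u v : dot u v = dot v u.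
Proof. by rewrite !dotE; ring. Qed.
Lemma dotDl u v w : dot (u + v) w = dot u w + dot v w.
Proof. by rewrite !dotE !mxE; ring. Qed.
Lemma dotDr u v w : dot w (u + v) = dot w u + dot w v.
Proof. by rewrite !dotE !mxE; ring. Qed.
Lemma dotNl u v : dot (- u) v = - dot u v.
Proof. by rewrite !dotE !mxE; ring. Qed.
Lemma dotNr u v : dot u (- v) = - dot u v.
Proof. by rewrite !dotE !mxE; ring. Qed.
Lemma dotZl a u v : dot (a *: u) v = a * dot u v.
Proof. by rewrite !dotE !mxE; ring. Qed.
Lemma dotZr a u v : dot u (a *: v) = a * dot u v.
Proof. by rewrite !dotE !mxE; ring. Qed.
Lemma dotBl u v w : dot (u - v) w = dot u w - dot v w.
Proof. by rewrite dotDl dotNl. Qed.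
Lemma dotBr u v w : dot w (u - v) = dot w u - dot w v.
Proof. by rewrite dotDr dotNr. Qed.
Lemma dot0l u : dot 0 u = 0.
Proof. by rewrite !dotE !mxE; ring. Qed.
Lemma dot0r u : dot u 0 = 0.
Proof. by rewrite !dotE !mxE; ring. Qed.

Definition dot_linE := (dotDl, dotDr, dotNl, dotNr, dotZl, dotZr, dot0l, dot0r).

Lemma dot_suml (I : Type) (s : seq I) (P : pred I) (F : I -> plane R) v :
  dot (\sum_(i <- s | P i) F i) v = \sum_(i <- s | P i) dot (F i) v.
Proof. by apply: (big_morph (dot^~ v)) => [x y|]; rewrite ?dot_linE. Qed.

Lemma dot_ge0 u : 0 <= dot u u.
Proof. by rewrite dotE -!expr2 addr_ge0 ?sqr_ge0. Qed.

Lemma dot_eq0 u : (dot u u == 0) = (u == 0).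
Proof.
apply/eqP/eqP => [|->]; last by rewrite dot_linE.
rewrite dotE => h; apply: planeP; rewrite !mxE.
  have h2 : u 0 0 * u 0 0 = 0 by nra.
  by move/eqP: h2; rewrite mulf_eq0 orbb => /eqP.
have h2 : u 0 1 * u 0 1 = 0 by nra.
by move/eqP: h2; rewrite mulf_eq0 orbb => /eqP.
Qed.

Lemma enorm_ge0 u : 0 <= enorm u. Proof. exact: sqrtr_ge0. Qed.
Hint Resolve enorm_ge0 : core.

Lemma enorm2 u : enorm u ^+ 2 = dot u u.
Proof. by rewrite /enorm sqr_sqrtr // dot_ge0. Qed.

Lemma enorm2D u v : enorm (u + v) ^+ 2 = enorm u ^+ 2 + 2 * dot u v + enorm v ^+ 2.
Proof. by rewrite !enorm2 !dot_linE (dotC v u); ring. Qed.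

Lemma enorm2B u v : enorm (u - v) ^+ 2 = enorm u ^+ 2 - 2 * dot u v + enorm v ^+ 2.
Proof. by rewrite !enorm2 !dot_linE (dotC v u); ring. Qed.

Lemma enorm0 : enorm (0 : plane R) = 0.
Proof. by rewrite /enorm dot_linE sqrtr0. Qed.

Lemma enormN u : enorm (- u) = enorm u.
Proof. by rewrite /enorm !dot_linE opprK. Qed.

Lemma enormC u v : enorm (u - v) = enorm (v - u).
Proof. by rewrite -enormN opprB. Qed.

Lemma enormZ a u : enorm (a *: u) = `|a| * enorm u.
Proof. by rewrite /enorm !dot_linE mulrA -expr2 sqrtrM ?sqr_ge0 // sqrtr_sqr. Qed.

Lemma enorm_eq0 u : (enorm u == 0) = (u == 0).
Proof. by rewrite -dot_eq0 -enorm2 expf_eq0. Qed.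

Lemma enorm_gt0 u : (0 < enorm u) = (u != 0).
Proof. by rewrite lt0r enorm_eq0 enorm_ge0 andbT. Qed.

Lemma ler_dot u v : dot u v <= enorm u * enorm v.
Proof.
have h : dot u v ^+ 2 <= (enorm u * enorm v) ^+ 2.
  rewrite exprMn !enorm2 !dotE.
  suff : 0 <= (u 0 0 * v 0 1 - u 0 1 * v 0 0) ^+ 2 by nra.
  exact: sqr_ge0.
apply: le_trans (ler_norm _) _.
by rewrite -ler_sqr ?nnegrE ?mulr_ge0 // real_normK ?num_real.
Qed.

Lemma ler_enormD u v : enorm (u + v) <= enorm u + enorm v.
Proof.
rewrite -ler_sqr ?nnegrE ?addr_ge0 // enorm2D sqrrD.
have := ler_dot u v; lra.
Qed.

Lemma ler_enorm_dist x y p : enorm (x - y) <= enorm (x - p) + enorm (p - y).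
Proof. by rewrite -[x - y](subrKA p) ler_enormD. Qed.

Lemma perp0 u : perp u 0 0 = - u 0 1. Proof. by rewrite mxE. Qed.
Lemma perp1 u : perp u 0 1 = u 0 0. Proof. by rewrite mxE. Qed.
Definition perpE := (perp0, perp1).

Lemma perpD u v : perp (u + v) = perp u + perp v.
Proof. by apply: planeP; rewrite !(perpE, mxE) //; ring. Qed.
Lemma perpN u : perp (- u) = - perp u.
Proof. by apply: planeP; rewrite !(perpE, mxE). Qed.
Lemma perpZ a u : perp (a *: u) = a *: perp u.
Proof. by apply: planeP; rewrite !(perpE, mxE) //=; ring. Qed.
Lemma perp_0 : perp 0 = 0 :> plane R.
Proof. by apply: planeP; rewrite !(perpE, mxE) ?oppr0. Qed.
Lemma perp_sum (I : Type) (s : seq I) (P : pred I) (F : I -> plane R) :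
  perp (\sum_(i <- s | P i) F i) = \sum_(i <- s | P i) perp (F i).
Proof. by apply: (big_morph perp) => [x y|]; rewrite ?perpD ?perp_0. Qed.

Lemma dot_perp u v : dot (perp u) (perp v) = dot u v.
Proof. by rewrite !dotE !perpE; ring. Qed.
Lemma dot_perpl u : dot (perp u) u = 0.
Proof. by rewrite !dotE !perpE; ring. Qed.
Lemma dot_perpr u : dot u (perp u) = 0.
Proof. by rewrite dotC dot_perpl. Qed.
Lemma enorm_perp u : enorm (perp u) = enorm u.
Proof. by rewrite /enorm dot_perp. Qed.

Lemma unit_dot u : enorm u = 1 -> dot u u = 1.
Proof. by rewrite -enorm2 => ->; rewrite expr1n. Qed.

Lemma frame_decomp nu x : enorm nu = 1 ->
  x = dot x (perp nu) *: perp nu + dot x nu *: nu.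
Proof.
move=> /unit_dot; rewrite !dotE => h.
by apply: planeP; rewrite -[LHS]mulr1 -h !(mxE, perpE) /=; ring.
Qed.

Lemma frame_norm nu a b : enorm nu = 1 ->
  enorm (a *: perp nu + b *: nu) ^+ 2 = a ^+ 2 + b ^+ 2.
Proof.
move=> /unit_dot h; rewrite enorm2 !dot_linE dot_perp dot_perpl dot_perpr h; ring.
Qed.

Lemma unit_eq u v : enorm u = 1 -> enorm v = 1 -> dot u v = 1 -> u = v.
Proof.
move=> hu hv h; apply/eqP; rewrite -subr_eq0 -enorm_eq0 -sqrf_eq0 enorm2B hu hv h.
by apply/eqP; ring.
Qed.

Lemma coord_le_enorm u i : `|u 0 i| <= enorm u.
Proof.
rewrite -ler_sqr ?nnegrE // real_normK ?num_real // enorm2 dotE -!expr2.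
by case: i => -[|[|//]] h; [rewrite (_ : Ordinal h = 0)|rewrite (_ : Ordinal h = 1)];
  do ?[exact: val_inj]; rewrite ?lerDl ?lerDr sqr_ge0.
Qed.

Lemma enorm_le_coord u : enorm u <= `|u 0 0| + `|u 0 1|.
Proof.
rewrite -ler_sqr ?nnegrE ?addr_ge0 // enorm2 dotE sqrrD !real_normK ?num_real //.
have := mulr_ge0 (normr_ge0 (u 0 0)) (normr_ge0 (u 0 1)); rewrite -!expr2; lra.
Qed.

Lemma nbhs_enormP x A : nbhs x A <->
  exists2 e, 0 < e & forall y, enorm (y - x) < e -> A y.
Proof.
split=> [/nbhs_ballP[e /= e0 he]|[e e0 he]].
  exists e => // y hy; apply: he; split=> // i j; rewrite ord1 /ball /=.
  apply: le_lt_trans hy; rewrite -enormN opprB.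
  by have := coord_le_enorm (x - y) j; rewrite !mxE.
apply/nbhs_ballP; exists (e / 2) => /=; first by rewrite divr_gt0.
move=> y [_ hy]; apply: he; apply: le_lt_trans (enorm_le_coord _) _.
have h0 := hy 0 0; have h1 := hy 0 1; rewrite /ball /= in h0 h1.
rewrite !mxE ![`|y _ _ - _|]distrC; lra.
Qed.

Lemma closure_enormP x A : closure A x <->
  forall e, 0 < e -> exists2 y, A y & enorm (y - x) < e.
Proof.
split=> [hx e e0|h B /nbhs_enormP[e e0 he]].
  have [|y [Ay hy]] := hx [set y | enorm (y - x) < e].
    by apply/nbhs_enormP; exists e.
  by exists y.
by have [y Ay hy] := h e e0; exists y; split=> //; apply: he.
Qed.

Lemma boundaryE A : boundary A = closure A `&` closure (~` A).
Proof. by rewrite /boundary closure_setC setDE. Qed.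

Lemma nbhs_time_plane (t0 : R) x (P : R * plane R -> Prop) :
  (\forall p \near (t0, x), P p) ->
  exists2 e, 0 < e & forall t y, `|t - t0| < e -> enorm (y - x) < e -> P (t, y).
Proof.
move=> [[U V] /= [/nbhs_ballP[e1 /= e10 h1] /nbhs_enormP[e2 e20 h2]] h].
exists (Num.min e1 e2); first by rewrite lt_min e10.
move=> t y; rewrite !lt_min => /andP[ht _] /andP[_ hy].
by apply: (h (t, y)); split; [apply: h1; rewrite /ball/= distrC|apply: h2].
Qed.

Lemma convexP A : convex A <->
  forall x y a, A x -> A y -> 0 <= a -> a <= 1 -> A (a *: x + (1 - a) *: y).
Proof.
split=> [h x y a Ax Ay a0 a1|h x y l].
  have ha : (Itv.spec (@Itv.num_sem R) (Itv.Real `[0%Z, 1%Z]%R) a).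
    by rewrite /= /Itv.num_sem /= in_itv /= a0 a1 num_real.
  by have := h x y (Itv.Def ha); rewrite !inE => /(_ Ax Ay).
by rewrite !inE => Ax Ay; apply: (h x y l%:num).
Qed.
End Plane.

(** * Second-order expansion of a boundary graph *)

Section Graph.
Context {R : realType}.
Implicit Types (u v w x y p c nu : plane R) (a b e : R) (A E : set (plane R)).

Lemma derivable_approx (g : R -> R) a e : derivable g a 1 -> 0 < e ->
  exists2 d, 0 < d &
    forall h, `|h| < d -> `|g (a + h) - g a - h * (derive1 g) a| <= e * `|h|.
Proof.
move=> dg e0.
have : (fun h => h^-1 *: (g (h + a) - g a)) @ 0^' --> (derive1 g) a.
  have := dg; rewrite /derivable derive1E /derive => /cvg_ex[l hl].
  have := hl; rewrite -(cvg_lim (@norm_hausdorff _ _) hl).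
  by under eq_fun do rewrite scaler1.
move/cvgrPdist_le => /(_ _ e0) [d /= d0 hd]; exists d => // h hh.
have [->|h0] := eqVneq h 0; first by rewrite addr0 subrr mul0r subr0 normr0 mulr0.
have := hd h; rewrite /ball_/= sub0r normrN => /(_ hh h0).
rewrite (_ : h^-1 *: _ = h^-1 * (g (a + h) - g a)); last by rewrite [h + a]addrC.
move=> hq; rewrite -normrN.
have -> : - (g (a + h) - g a - h * (derive1 g) a) =
    h * ((derive1 g) a - h^-1 * (g (a + h) - g a)) by field.
by rewrite normrM mulrC ler_wpM2r.
Qed.

(** The mean value theorem for [f s - k / 2 * s ^+ 2], whose derivative is
    [o(s)]: only the derivative of [f'] at the single point 0 is used. *)
Lemma taylor2_approx (f : R -> R) e : C2_near f 0 -> f 0 = 0 -> (derive1 f) 0 = 0 ->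
  0 < e -> exists2 d, 0 < d &
    forall s, `|s| < d -> `|f s - (derive1n 2 f) 0 / 2 * s ^+ 2| <= e * s ^+ 2.
Proof.
move=> hC f0 f10 e0; have [_ d1 _] := nbhs_singleton hC.
have [d2 d20 h2] := derivable_approx d1 e0.
have [d3 /= d30 h3] := hC.
pose k : R := derive1 (derive1 f) 0; change (derive1n 2 f 0) with k.
exists (Num.min d2 d3); first by rewrite lt_min d20.
pose F (s : R) : R := f s - k / 2 * s ^+ 2.
have dF (s : R) : `|s| < d3 -> is_derive s (1 : R) F ((derive1 f) s - k * s).
  move=> hs; have [|ds _ _] := h3 s; first by rewrite /ball_ /= sub0r normrN.
  have df : is_derive s (1 : R) f ((derive1 f) s) by rewrite derive1E; exact: derivableP.
  have -> : F = f - (k / 2) \*: ((id : R -> R) ^+ 2) by [].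
  by apply: is_derive_eq; rewrite /= expr1 !scalerA /= scaler1 /GRing.scale /=; congr (_ - _); field.
have F0 : F 0 = 0 by rewrite /F f0 expr0n /= mulr0 subrr.
have bound (s : R) : `|s| < Num.min d2 d3 -> `|(derive1 f) s - k * s| <= e * `|s|.
  rewrite lt_min => /andP[hs _]; have := h2 s hs.
  by rewrite add0r f10 subr0 mulrC.
have cF (s : R) : `|s| < d3 -> {for s, continuous F}.
  move=> hs; apply/differentiable_continuous/derivable1_diffP.
  by apply: (@ex_derive _ _ _ _ _ _ _ (dF s hs)).
move=> s hs; rewrite -/(F s).
have [->|s0] := eqVneq s 0; first by rewrite F0 normr0 expr0n /= mulr0.
have [s1|s1] := ltP 0 s.
  have [x||c hc] := @MVT _ F (fun s => (derive1 f) s - k * s) _ _ s1.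
  - rewrite in_itv /= => /andP[x0 xs]; apply: dF.
    by rewrite gtr0_norm //; move: hs; rewrite lt_min gtr0_norm // => /andP[]; lra.
  - apply/continuous_in_subspaceT => x; rewrite inE /= in_itv /= => /andP[x0 xs].
    apply: cF; rewrite ger0_norm //.
    by move: hs; rewrite lt_min gtr0_norm // => /andP[]; lra.
  rewrite F0 !subr0 => ->; move: hc; rewrite in_itv /= => /andP[c0 cs].
  rewrite normrM (gtr0_norm s1) expr2 mulrA ler_wpM2r //; first by lra.
  rewrite (gtr0_norm s1) in hs.
  have := bound c; rewrite (gtr0_norm c0) => /(_ (lt_trans cs hs)) h.
  by apply: le_trans h _; rewrite ler_wpM2l // ltW.
have {s1}s1 : s < 0 by rewrite lt_neqAle s0.
have [x||c hc] := @MVT _ F (fun s => (derive1 f) s - k * s) _ _ s1.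
- rewrite in_itv /= => /andP[x0 xs]; apply: dF.
  by rewrite ltr0_norm //; move: hs; rewrite lt_min ltr0_norm // => /andP[]; lra.
- apply/continuous_in_subspaceT => x; rewrite inE /= in_itv /= => /andP[x0 xs].
  apply: cF; rewrite ler0_norm //.
  by move: hs; rewrite lt_min ltr0_norm // => /andP[]; lra.
rewrite F0 sub0r => hF; move: hc; rewrite in_itv /= => /andP[c0 cs].
rewrite -normrN hF sub0r normrM normrN -(real_normK (num_real s)) expr2 mulrA.
rewrite ler_wpM2r //; rewrite (ltr0_norm s1) in hs.
have := bound c; rewrite (ltr0_norm cs) => h.
apply: le_trans (h _) _; first by lra.
by rewrite (ltr0_norm s1) ler_wpM2l ?ltW //; lra.
Qed.

(** What the strict and the large subgraph have in common, so that open and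
    closed sets need not be told apart until the very end. *)
Lemma local_subgraph_side E x nu (f : R -> R) d s h :
  local_subgraph E x nu f d -> `|s| < d -> `|h| < d ->
  (h < f s -> E (x + s *: perp nu + h *: nu)) /\
  (f s < h -> ~ E (x + s *: perp nu + h *: nu)).
Proof.
move=> [] H hs hh; split=> h1.
- exact/H.
- by move/(H _ _ hs hh) => /(lt_trans h1); rewrite ltxx.
- by apply/H => //; exact: ltW.
- by move/(H _ _ hs hh) => /(lt_le_trans h1); rewrite ltxx.
Qed.

Lemma graph_boundary E x nu (f : R -> R) d s :
  enorm nu = 1 -> local_subgraph E x nu f d -> `|s| < d -> `|f s| < d ->
  boundary E (x + s *: perp nu + f s *: nu).
Proof.
move=> n1 H hs hf; rewrite boundaryE.
have key e : 0 < e -> exists2 h, 0 < h < e & `|f s - h| < d /\ `|f s + h| < d.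
  move=> e0; exists (Num.min e (d - `|f s|) / 2).
    rewrite divr_gt0 ?lt_min ?e0 ?subr_gt0 //=.
    by rewrite ltr_pdivrMr // gt_min; apply/orP; left; lra.
  have m0 : 0 < Num.min e (d - `|f s|) by rewrite lt_min e0 subr_gt0.
  have m1 : Num.min e (d - `|f s|) <= d - `|f s| by rewrite ge_min lexx orbT.
  split.
    by apply: le_lt_trans (ler_normB _ _) _; rewrite [X in _ + X]gtr0_norm; lra.
  by apply: le_lt_trans (ler_normD _ _) _; rewrite [X in _ + X]gtr0_norm; lra.
split; apply/closure_enormP => e /key [h /andP[h0 he] [h1 h2]].
  exists (x + s *: perp nu + (f s - h) *: nu).
    by apply: (local_subgraph_side H hs h1).1; lra.
  rewrite scalerBl opprD addrACA subrr add0r addrAC subrr add0r.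
  by rewrite enormN enormZ n1 mulr1 gtr0_norm.
exists (x + s *: perp nu + (f s + h) *: nu).
  by apply: (local_subgraph_side H hs h2).2; lra.
rewrite scalerDl opprD addrACA subrr add0r addrAC subrr add0r.
by rewrite enormZ n1 mulr1 gtr0_norm.
Qed.
End Graph.

(** * Normal and curvature at a regular boundary point *)

Section GraphNormal.
Context {R : realType}.
Implicit Types (u v w x y p c nu : plane R) (a b e : R) (A E : set (plane R)).

(** Since [f s = o(s)], a ray transversal to the tangent line stays on one side
    of the graph, together with balls of radius proportional to the distance
    travelled. The margin makes the statement stable under closures. *)
Lemma graph_cone E x nu f v :
  boundary_graph E x nu f -> dot v nu != 0 ->
  exists2 d, 0 < d & forall s, 0 < s < d -> forall y,
    enorm (y - (x + s *: v)) < s * (`|dot v nu| / 2) ->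
    (0 < dot v nu -> ~ E y) /\ (dot v nu < 0 -> E y).
Proof.
move=> [n1 hC f0 f10 [d0 d00 H]] b0.
set a := dot v (perp nu); set b := dot v nu in b0 *.
have nb : 0 < `|b| by rewrite normr_gt0.
have na : 0 <= `|a| by [].
pose e := `|b| / (4 * (`|a| + `|b|)).
have e0 : 0 < e by rewrite divr_gt0 // mulr_gt0 //; lra.
have [df _ _] := nbhs_singleton hC.
have [d1 d10 h1] := derivable_approx df e0.
pose m := Num.min d0 d1.
have m0 : 0 < m by rewrite lt_min d00.
have [md0 md1] : m <= d0 /\ m <= d1 by rewrite !ge_min !lexx orbT.
pose N := `|a| + `|b|; have N0 : 0 < N by rewrite /N; lra.
(* keeps the abscissa and the ordinate of y within m of the origin *)
exists (m / (2 * N)); first by rewrite divr_gt0 // mulr_gt0.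
move=> s /andP[s0]; rewrite ltr_pdivlMr ?mulr_gt0 // => sm y hy.
pose s' := dot (y - x) (perp nu); pose h := dot (y - x) nu.
have hs' : `|s' - s * a| < s * (`|b| / 2).
  apply: le_lt_trans hy; rewrite -dotZl -dotBl -addrA -opprD.
  have := ler_dot (y - (x + s *: v)) (perp nu).
  have := ler_dot (- (y - (x + s *: v))) (perp nu).
  by rewrite enormN enorm_perp n1 mulr1 dotNl => h2 h3; rewrite ler_norml; lra.
have hh : `|h - s * b| < s * (`|b| / 2).
  apply: le_lt_trans hy; rewrite -dotZl -dotBl -addrA -opprD.
  have := ler_dot (y - (x + s *: v)) nu.
  have := ler_dot (- (y - (x + s *: v))) nu.
  by rewrite enormN n1 mulr1 dotNl => h2 h3; rewrite ler_norml; lra.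
have ys : y = x + s' *: perp nu + h *: nu.
  by rewrite -addrA -frame_decomp // addrC subrK.
have sa : `|s * a| = s * `|a| by rewrite normrM gtr0_norm.
have sb : `|s * b| = s * `|b| by rewrite normrM gtr0_norm.
have bs' : `|s'| <= s * (`|a| + `|b| / 2).
  rewrite -[s'](subrK (s * a)); apply: le_trans (ler_normD _ _) _; lra.
have bh : `|h| <= s * (`|b| + `|b| / 2).
  rewrite -[h](subrK (s * b)); apply: le_trans (ler_normD _ _) _; lra.
have sN : s * `|a| + s * `|b| = s * N by rewrite -mulrDr.
have sab : 0 <= s * `|a| /\ 0 < s * `|b| by rewrite mulr_ge0 ?mulr_gt0 // ltW.
have hfs : `|f s'| <= s * `|b| / 4.
  have := h1 s'; rewrite add0r f0 f10 mulr0 !subr0 => /(_ _) hf.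
  apply: le_trans (hf _) _; first by lra.
  apply: le_trans (_ : e * (s * N) <= _); first by rewrite ler_wpM2l ?ltW //; lra.
  by rewrite /e /N le_eqVlt; apply/orP; left; apply/eqP; field; lra.
have sd : `|s'| < d0 by lra.
have hd : `|h| < d0 by lra.
have [c1 c2] := local_subgraph_side H sd hd; rewrite -ys in c1 c2.
move: hh hfs; rewrite ltr_norml ler_norml => /andP[k1 k2] /andP[k3 k4].
split=> hb.
  by apply: c2; rewrite (gtr0_norm hb) in k1 k2 k3 k4 sab; lra.
by apply: c1; rewrite (ltr0_norm hb) in k1 k2 k3 k4 sab; lra.
Qed.

Lemma graph_cone_out E x nu f v :
  boundary_graph E x nu f -> 0 < dot v nu ->
  exists2 d, 0 < d & forall s, 0 < s < d -> ~ closure E (x + s *: v).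
Proof.
move=> G b0; have [|d d0 h] := graph_cone G (v := v); first by rewrite gt_eqF.
exists d => // s sd /closure_enormP cl.
have [|y Ey hy] := cl (s * (`|dot v nu| / 2)).
  by case/andP: sd => s0 _; rewrite mulr_gt0 // divr_gt0 // normr_gt0 gt_eqF.
by have [/(_ b0)] := h s sd y hy.
Qed.

Lemma graph_cone_in E x nu f v :
  boundary_graph E x nu f -> dot v nu < 0 ->
  exists2 d, 0 < d & forall s, 0 < s < d -> ~ closure (~` E) (x + s *: v).
Proof.
move=> G b0; have [|d d0 h] := graph_cone G (v := v); first by rewrite lt_eqF.
exists d => // s sd /closure_enormP cl.
have [|y Ey hy] := cl (s * (`|dot v nu| / 2)).
  by case/andP: sd => s0 _; rewrite mulr_gt0 // divr_gt0 // normr_gt0 lt_eqF.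
by have [_ /(_ b0)] := h s sd y hy.
Qed.

Lemma closureCN E x : ~ closure (~` E) x -> E x.
Proof. by move=> h; apply: contrapT => nE; apply: h; apply: subset_closure. Qed.

(** Along the direction [nu - nu'] one leaves the set according to [nu] and
    enters it according to [nu']. *)
Lemma graph_normal_unique E x nu nu' f f' :
  boundary_graph E x nu f -> boundary_graph E x nu' f' -> nu = nu'.
Proof.
move=> G G'; have [n1 _ _ _ _] := G; have [n1' _ _ _ _] := G'.
apply: contrapT => ne.
have c1 : dot nu nu' < 1.
  rewrite lt_neqAle; apply/andP; split; first by apply/eqP => /(unit_eq n1 n1').
  by have := ler_dot nu nu'; rewrite n1 n1' mulr1.
have [|d d0 h] := graph_cone_out G (v := nu - nu').
  by rewrite dotDl dotNl (unit_dot n1) (dotC nu'); lra.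
have [|d' d0' h'] := graph_cone_in G' (v := nu - nu').
  by rewrite dotDl dotNl (unit_dot n1'); lra.
pose s := Num.min d d' / 2.
have m0 : 0 < Num.min d d' by rewrite lt_min d0.
have [m1 m2] : Num.min d d' <= d /\ Num.min d d' <= d' by rewrite !ge_min !lexx orbT.
apply: (h s); first by apply/andP; rewrite /s; split; lra.
apply: subset_closure; apply: closureCN; apply: h'.
by apply/andP; rewrite /s; split; lra.
Qed.

Lemma normal_graph E x nu f : boundary_graph E x nu f -> normal E x = nu.
Proof.
move=> G; have /= [f' G'] := @xgetI _ 0 [set nu | exists f, boundary_graph E x nu f] nu (ex_intro _ f G).
exact: graph_normal_unique G' G.
Qed.

(** The curvature may have been read off another graph, but by uniqueness of the
    normal that graph lies over the same tangent line. *)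
Lemma curvature_graph E x nu f : boundary_graph E x nu f ->
  exists2 g, boundary_graph E x nu g & curvature E x = - derive1n 2 g 0.
Proof.
move=> G.
have /= [nu' [g [G' hk]]] := @xgetI _ 0 [set k | exists nu f,
  boundary_graph E x nu f /\ k = - derive1n 2 f 0] _
  (ex_intro _ nu (ex_intro _ f (conj G erefl))).
by exists g => //; rewrite (graph_normal_unique G G').
Qed.

(** The points at which [normal] and [curvature] have a geometric meaning. *)
Definition is_regular E x := exists nu f, boundary_graph E x nu f.

Lemma regular_graph E x : is_regular E x ->
  exists2 f, boundary_graph E x (normal E x) f & curvature E x = - derive1n 2 f 0.
Proof. by move=> [nu [f G]]; rewrite (normal_graph G); exact: curvature_graph G. Qed.

Lemma normal_unit E x : is_regular E x -> enorm (normal E x) = 1.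
Proof. by move=> /regular_graph[f []]. Qed.

Lemma cone_out E x v : is_regular E x -> 0 < dot v (normal E x) ->
  exists2 d, 0 < d & forall s, 0 < s < d -> ~ closure E (x + s *: v).
Proof. by move=> /regular_graph[f G _]; exact: graph_cone_out G. Qed.

Lemma cone_in E x v : is_regular E x -> dot v (normal E x) < 0 ->
  exists2 d, 0 < d & forall s, 0 < s < d -> ~ closure (~` E) (x + s *: v).
Proof. by move=> /regular_graph[f G _]; exact: graph_cone_in G. Qed.

(** The boundary near [x], with its height divided by [s ^+ 2]: later
    second-order conditions are then polynomial in [s] and [q s], and follow by
    passing to the limit. *)
Lemma space_curve E x : is_regular E x ->
  exists2 q : R -> R, q s @[s --> 0^'+] --> - (curvature E x / 2) &
    \forall s \near 0^'+, boundary E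
       (x + s *: perp (normal E x) + (s ^+ 2 * q s) *: normal E x).
Proof.
move=> /regular_graph[f [n1 hC f0 f10 [d d0 H]] hk].
exists (fun s => f s / s ^+ 2).
  apply/cvgrPdist_le => e e0; have [d' d0' h] := taylor2_approx hC f0 f10 e0.
  near=> s; have s0 : 0 < s by near: s; exact: nbhs_right_gt.
  have s20 : 0 < s ^+ 2 by rewrite exprn_gt0.
  have := h s; rewrite gtr0_norm // => /(_ _) hs.
  have -> : - (curvature E x / 2) - f s / s ^+ 2 =
      - ((f s - derive1n 2 f 0 / 2 * s ^+ 2) / s ^+ 2).
    by rewrite hk; field; rewrite gt_eqF.
  rewrite normrN normrM (gtr0_norm (x := (s ^+ 2)^-1)) ?invr_gt0 //.
  rewrite ler_pdivrMr //; apply: hs.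
  by near: s; exact: nbhs_right_lt.
have [d' d0' h] := taylor2_approx hC f0 f10 ltr01.
pose k := derive1n 2 f 0 / 2; pose K := `|k| + 1.
have K1 : 0 < K by rewrite /K; have := normr_ge0 k; lra.
near=> s; have s0 : 0 < s by near: s; exact: nbhs_right_gt.
rewrite mulrC divfK ?gt_eqF ?exprn_gt0 //.
have sd : s < d by near: s; exact: nbhs_right_lt.
have sd' : s < d' by near: s; exact: nbhs_right_lt.
have s1 : s < 1 by near: s; exact: nbhs_right_lt.
have sK : s < d / K by near: s; apply: nbhs_right_lt; rewrite divr_gt0.
apply: (graph_boundary n1 H); first by rewrite gtr0_norm.
have := h s; rewrite gtr0_norm // => /(_ sd') hs.
have hK : `|f s| <= K * s ^+ 2.
  rewrite -[f s](subrK (k * s ^+ 2)) /K mulrDl addrC.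
  apply: le_trans (ler_normD _ _) _; rewrite normrM [`|s ^+ 2|]gtr0_norm ?exprn_gt0 //.
  by rewrite lerD2l.
apply: le_lt_trans hK _; move: sK; rewrite ltr_pdivlMr // mulrC => sK.
apply: lt_trans sK; rewrite ltr_pM2l // expr2 gtr_pMl //.
Unshelve. all: by end_near.
Qed.

End GraphNormal.

(** * Boundary points carried by the flow *)

Section Flow.
Context {R : realType}.
Variables (r : R) (T : \bar R) (E : R -> set (plane R)).
Hypotheses (smoothE : smooth_evolution T E) (flowE : curvature_flow r T E).
Implicit Types (v w x y p c nu : plane R) (a e t u : R) (A : set (plane R)).

Lemma lifespan_le t t' : 0 <= t' -> t' <= t -> lifespan T t -> lifespan T t'.
Proof. by move=> h0 h [_ ht]; split=> //; apply: le_lt_trans ht; rewrite lee_fin. Qed.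

Lemma evolution_graph t0 x : lifespan T t0 -> boundary (E t0) x ->
  exists (nu : plane R) (f : R -> R -> R), [/\ boundary_graph (E t0) x nu (f t0),
    f t0 0 = 0, derivable (f^~ 0) t0 1 &
    exists2 d, 0 < d & forall t, lifespan T t -> `|t - t0| < d ->
      local_subgraph (E t) x nu (f t) d].
Proof.
move=> ht bx; have [nu [f [n1 hC f0 f10 [d d0 H]]]] := smoothE.1 t0 x ht bx.
exists nu, f; split=> //; last 2 first.
- by have [h _ _ _] := nbhs_singleton hC; exact: h.
- by exists d.
split=> //.
- have [[U V] /= [U0 V0] UV] := hC.
  apply: filterS V0 => s Vs.
  have [|d1 d2 d3 [c1 c2 c3]] := UV (t0, s); first by split=> //=; exact: nbhs_singleton.
  split; [exact: d2|exact: d3|].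
  apply: (@continuous_comp _ _ _ (fun s : R => (t0, s)) (fun q : R * R => derive1n 2 (f q.1) q.2) s).
    move=> P [[A B] /= [hA hB] hAB]; rewrite nbhs_filterE.
    by apply: filterS hB => y By; apply: hAB; split => //=; exact: nbhs_singleton.
  exact: c3.
- by exists d => //; apply: H => //; rewrite subrr normr0.
Qed.

Lemma evolution_regular t0 x : lifespan T t0 -> boundary (E t0) x -> is_regular (E t0) x.
Proof. by move=> ht /(evolution_graph ht)[nu [f []]]; exists nu, (f t0). Qed.

Lemma derive_line (g : R -> R) x v t0 : derivable g t0 1 ->
  is_derive t0 (1 : R) (fun t => x + g t *: v) (derive1 g t0 *: v).
Proof.
move=> dg; suff h : (fun h : R => h^-1 *: ((x + g (h *: 1 + t0) *: v) - (x + g t0 *: v))) @ 0^'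
    --> derive1 g t0 *: v.
  by apply: DeriveDef; [apply/cvg_ex; exists (derive1 g t0 *: v)|exact: cvg_lim].
under eq_fun => h do rewrite opprD addrACA subrr add0r -scalerBl scalerA.
apply: cvgZr_tmp.
by rewrite derive1E; exact: dg.
Qed.

(** The flow law applied to the point of the moving graph above [x]. Time runs
    backwards, [u] being the time before [t0], because a first contact only
    gives information about the past; the sign makes the limit [kappa]. *)
Lemma time_curve t0 x : 0 < t0 -> lifespan T t0 -> boundary (E t0) x ->
  exists2 q : R -> R, q u @[u --> 0^'+] --> kappa r (E t0) x &
    \forall u \near 0^'+, boundary (E (t0 - u)) (x + (u * q u) *: normal (E t0) x).
Proof.
move=> t00 ht bx; have [nu [f [G f0 df [d d0 H]]]] := evolution_graph ht bx.
have [n1 _ _ _ _] := G.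
rewrite (normal_graph G); pose g : R -> R := f^~ 0; have g0 : g t0 = 0 by [].
have bd t : lifespan T t -> `|t - t0| < d -> `|g t| < d -> boundary (E t) (x + g t *: nu).
  move=> lt htd hg; have := graph_boundary n1 (H t lt htd) (s := 0).
  by rewrite normr0 scale0r addr0; exact.
have kE : derive1 g t0 = - kappa r (E t0) x.
  have := flowE (x := fun t => x + g t *: nu) ht.
  have [dl el] := derive_line x nu df.
  rewrite derive1E el dotZl g0 scale0r addr0 (normal_graph G) (unit_dot n1) mulr1.
  apply=> //.
  have [d' d0' h'] := derivable_approx (g := g) df ltr01.
  pose K := `|derive1 g t0| + 1.
  have K0 : 0 < K by rewrite /K; have := normr_ge0 (derive1 g t0); lra.
  near=> t => lt.
  have htd : `|t0 - t| < d by near: t; exact: cvgr_dist_lt.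
  have htd' : `|t0 - t| < d' by near: t; exact: cvgr_dist_lt.
  have htK : `|t0 - t| < d / K by near: t; apply: cvgr_dist_lt; rewrite ?divr_gt0.
  rewrite distrC in htd; rewrite distrC in htd'; rewrite distrC in htK.
  apply: (bd t lt htd).
  have := h' (t - t0); rewrite [t0 + _]addrC subrK g0 subr0 => /(_ htd').
  move: htK; rewrite ltr_pdivlMr // => htK hh.
  apply: le_lt_trans htK; rewrite -[g t](subrK ((t - t0) * derive1 g t0)).
  apply: le_trans (ler_normD _ _) _; rewrite normrM /K mulrDr mulr1 mul1r in hh *.
  by rewrite addrC lerD2l.
exists (fun u => g (t0 - u) / u).
  apply/cvgrPdist_le => e e0; have [d' d0' h'] := derivable_approx (g := g) df e0.
  near=> u; have u0 : 0 < u by near: u; exact: nbhs_right_gt.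
  have := h' (- u); rewrite normrN gtr0_norm // g0 subr0 => /(_ _) hu.
  have -> : kappa r (E t0) x - g (t0 - u) / u = - ((g (t0 - u) - - u * derive1 g t0) / u).
    by rewrite kE; field; rewrite gt_eqF.
  rewrite normrN normrM (gtr0_norm (x := u^-1)) ?invr_gt0 // ler_pdivrMr //.
  by apply: hu; near: u; exact: nbhs_right_lt.
have [d' d0' h'] := derivable_approx (g := g) df ltr01.
pose K := `|derive1 g t0| + 1.
have K0 : 0 < K by rewrite /K; have := normr_ge0 (derive1 g t0); lra.
near=> u; have u0 : 0 < u by near: u; exact: nbhs_right_gt.
rewrite mulrC divfK ?gt_eqF //.
have ut : u < t0 by near: u; exact: nbhs_right_lt.
have ud : u < d by near: u; exact: nbhs_right_lt.
have ud' : u < d' by near: u; exact: nbhs_right_lt.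
have uK : u < d / K by near: u; apply: nbhs_right_lt; rewrite divr_gt0.
apply: bd.
- by apply: lifespan_le ht; lra.
- by rewrite addrAC subrr add0r normrN gtr0_norm.
have := h' (- u); rewrite normrN gtr0_norm // g0 subr0 => /(_ ud').
move: uK; rewrite ltr_pdivlMr // => uK hh.
apply: le_lt_trans uK; rewrite -[g _](subrK (- u * derive1 g t0)).
apply: le_trans (ler_normD _ _) _; rewrite normrM normrN (gtr0_norm u0) /K mulrDr mulr1; rewrite mul1r in hh.
by rewrite addrC lerD2l.
Unshelve. all: by end_near.
Qed.

(** Interior and exterior barriers are the same argument applied to the closure
    of the set and to the closure of its complement; [b] selects which. *)
Definition phase (b : bool) t := closure (if b then E t else ~` E t).

Lemma boundary_phase b t x : boundary (E t) x -> phase b t x.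
Proof. by rewrite boundaryE => -[]; case: b. Qed.

Lemma phase_boundary t x : phase true t x -> phase false t x -> boundary (E t) x.
Proof. by rewrite boundaryE. Qed.

(** Absence of nucleation, as the openness in space-time of the complement of a
    phase. *)
Lemma no_phase b t0 x : lifespan T t0 -> ~ phase b t0 x ->
  exists2 e, 0 < e & forall t y, lifespan T t -> `|t - t0| < e -> enorm (y - x) < e ->
    ~ phase b t y.
Proof.
move=> ht nx.
have [e e0 h] : exists2 e, 0 < e & forall t y, `|t - t0| < e -> enorm (y - x) < e ->
    lifespan T t -> ~ (if b then E t else ~` E t) y.
  have [h1 h2] := smoothE.2 t0 x ht.
  have ix : interior (~` (if b then E t0 else ~` E t0)) x by rewrite interiorC.
  case: b nx ix => /= nx ix; first exact: nbhs_time_plane (h2 ix).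
  rewrite setCK in ix; have [e e0 h] := nbhs_time_plane (h1 ix).
  by exists e => // t y k1 k2 k3 k4; apply: k4; exact: h.
exists (e / 2); first by rewrite divr_gt0.
move=> t y lt ht' hy /closure_enormP/(_ (e / 2)) [|z Ez hz]; first by rewrite divr_gt0.
apply: (h t z) Ez => //; first by lra.
by apply: le_lt_trans (ler_enorm_dist _ _ y) _; lra.
Qed.

(** A phase cannot appear suddenly: its points are limits of its points at
    earlier times. This is what forces a first contact to be a tangency. *)
Lemma phase_left_continuous b t p e : 0 < t -> lifespan T t -> phase b t p -> 0 < e ->
  exists2 u, 0 < u < e /\ u <= t & exists2 p', phase b (t - u) p' & enorm (p' - p) < e.
Proof.
move=> t0 ht hp e0.
have [hn|hn] := pselect (phase (~~ b) t p).
  have bp : boundary (E t) p by move: hp hn; case: (b) => h1 h2; apply: phase_boundary.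
  have [q qk /= qb] := time_curve t0 ht bp.
  have n1 := normal_unit (evolution_regular ht bp).
  have : (fun u => u * q u) @ 0^'+ --> 0 * kappa r (E t) p.
    apply: cvgM qk; exact: cvg_at_right_filter.
  rewrite mul0r => /cvgr0Pnorm_lt /(_ _ e0) hu.
  near (0 : R)^'+ => u; exists u.
    split; first by apply/andP; split; near: u; [exact: nbhs_right_gt|exact: nbhs_right_lt].
    by apply: ltW; near: u; exact: nbhs_right_lt.
  exists (p + (u * q u) *: normal (E t) p).
    by apply: boundary_phase; near: u.
  rewrite addrAC subrr add0r enormZ n1 mulr1.
  by near: u.
have [e1 e10 h] := no_phase ht hn.
pose m := Num.min e (Num.min e1 t).
have m0 : 0 < m by rewrite !lt_min e0 e10.
have [[m1 m2] m3] : (m <= e /\ m <= e1) /\ m <= t by rewrite /m !ge_min !lexx !orbT.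
exists (m / 2); first by split; [apply/andP; split; lra|lra].
exists p; last by rewrite subrr enorm0.
have lt' : lifespan T (t - m / 2) by apply: lifespan_le ht; lra.
have := h (t - m / 2) p lt'; rewrite subrr enorm0 addrAC subrr add0r normrN gtr0_norm; last by lra.
move=> /(_ _ e10) hp'; have {}hp' := hp' ltac:(lra).
case: b hp hn h hp' => _ _ _ hp'; apply: subset_closure.
  exact: closureCN.
by move=> /subset_closure.
Unshelve. all: by end_near.
Qed.

Lemma closed_phase b t1 t2 : 0 <= t1 -> lifespan T t2 ->
  closed [set q : R * plane R | t1 <= q.1 <= t2 /\ phase b q.1 q.2].
Proof.
move=> t10 lt2 [t x] cl /=.
have ht : t1 <= t <= t2.
  rewrite !leNgt -negb_or; apply/negP => hor.
  pose e := if t < t1 then t1 - t else t - t2.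
  have e0 : 0 < e by rewrite /e; case: ltP hor => //=; lra.
  have [|[t' x'] /= [[h1 _] h2]] := cl [set q | `|q.1 - t| < e].
    exists ([set t' | `|t' - t| < e], setT) => /=.
      split; last exact: filterT.
      by apply/nbhs_ballP; exists e => // t' /=; rewrite /ball /= distrC.
    by move=> [? ?] [].
  move: h2 h1; rewrite /e ltr_norml; case: ltP hor => /=; lra.
split=> //; apply: contrapT => nx.
have lt : lifespan T t by apply: lifespan_le lt2; lra.
have [e e0 h] := no_phase lt nx.
have [|[t' x'] /= [[h1 h3] [h2 h4]]] := cl [set q | `|q.1 - t| < e /\ enorm (q.2 - x) < e].
  exists ([set t' | `|t' - t| < e], [set x' | enorm (x' - x) < e]) => //=.
  split; last by apply/nbhs_enormP; exists e.
  by apply/nbhs_ballP; exists e => // t' /=; rewrite /ball /= distrC.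
by apply: (h t' x') h3 => //; apply: lifespan_le lt2; lra.
Qed.
End Flow.

(** * Contact with a disc *)

Section Contact.
Context {R : realType}.
Implicit Types (u v w x y p c nu : plane R) (a b e r : R) (A E : set (plane R)).

Definition nearest A p c :=
  [/\ A p, p != c & exists2 d, 0 < d & forall y, A y -> enorm (y - p) < d ->
     enorm (p - c) <= enorm (y - c)].

(** Whether the external normal at a point of contact points towards the centre
    of the touching disc (disc outside the set) or away from it (disc inside). *)
Definition bsign (b : bool) : R := if b then 1 else -1.

(** The derivative of the squared distance to [c] in the direction [v]. *)
Lemma nearest_dir A p c v : nearest A p c -> 0 < dot v (c - p) ->
  exists2 d, 0 < d & forall s, 0 < s < d -> ~ A (p + s *: v).
Proof.
move=> [Ap pc [d d0 h]] hv; set k := dot v (c - p) in hv.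
pose D := Num.min (d / (enorm v + 1)) (2 * k / (enorm v ^+ 2 + 1)).
have nv := enorm_ge0 v; have nv2 := sqr_ge0 (enorm v).
exists D; first by rewrite lt_min !divr_gt0 //; lra.
move=> s /andP[s0]; rewrite lt_min !ltr_pdivlMr; [|lra|lra] => /andP[h1 h2] As.
have := h _ As; rewrite addrAC subrr add0r enormZ gtr0_norm // => /(_ _) hh.
have {}hh : enorm (p - c) <= enorm (p + s *: v - c) by apply: hh; lra.
move: hh; rewrite -ler_sqr ?nnegrE ?enorm_ge0 //.
rewrite (_ : p + s *: v - c = s *: v - (c - p)); last by rewrite opprB addrA [s *: v + p]addrC.
rewrite (enormC p) [X in _ <= X]enorm2B dotZl -/k enormZ exprMn gtr0_norm //.
rewrite expr2; nra.
Qed.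

(** A linear form that is nonpositive on an open half-plane is a nonnegative
    multiple of its external normal: test with [v = g / |g| - nu]. *)
Lemma unit_direction nu g : enorm nu = 1 -> g != 0 ->
  (forall v, dot v nu < 0 -> dot v g <= 0) -> nu = (enorm g)^-1 *: g.
Proof.
move=> n1 g0 h; have g1 : 0 < enorm g by rewrite enorm_gt0.
pose m := (enorm g)^-1 *: g.
have m1 : enorm m = 1 by rewrite enormZ gtr0_norm ?invr_gt0 // mulVf ?gt_eqF.
have gm : g = enorm g *: m by rewrite scalerA divff ?gt_eqF // scale1r.
rewrite -/m; clearbody m.
apply: unit_eq => //; apply/eqP; rewrite eq_le; apply/andP; split.
  by have := ler_dot nu m; rewrite n1 m1 mulr1.
rewrite leNgt; apply/negP => hlt.
have := h (m - nu); rewrite !dotBl (unit_dot n1) (dotC m) gm !dotZr (unit_dot m1) => /(_ _) hh.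
have {}hh : enorm g * 1 - enorm g * dot nu m <= 0 by apply: hh; lra.
nra.
Qed.

Lemma nearest_boundary (b : bool) E p c :
  nearest (closure (if b then E else ~` E)) p c -> boundary E p.
Proof.
move=> N; have [Ap pc _] := N.
have hk : 0 < dot (c - p) (c - p) by rewrite -enorm2 exprn_gt0 // enorm_gt0 subr_eq0 eq_sym.
have [d d0 h] := nearest_dir N hk.
have cl : closure (~` (if b then E else ~` E)) p.
  apply/closure_enormP => e e0; pose m := Num.min d (e / enorm (c - p)).
  have k0 : 0 < enorm (c - p) by rewrite enorm_gt0 subr_eq0 eq_sym.
  have m0 : 0 < m by rewrite lt_min d0 divr_gt0.
  have [m1 m2] : m <= d /\ m <= e / enorm (c - p) by rewrite !ge_min !lexx orbT.
  exists (p + (m / 2) *: (c - p)).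
    by move=> /subset_closure; apply: h; apply/andP; split; lra.
  rewrite addrAC subrr add0r enormZ gtr0_norm; last lra.
  by rewrite -ltr_pdivlMr //; lra.
by rewrite boundaryE; case: (b) Ap cl => //= h1; rewrite ?setCK => h2; split.
Qed.

(** No direction can both enter the phase and get closer to [c]. *)
Lemma nearest_normal (b : bool) E p c : is_regular E p ->
  nearest (closure (if b then E else ~` E)) p c ->
  normal E p = (bsign b / enorm (p - c)) *: (c - p).
Proof.
move=> rg N; have [Ap pc _] := N; have n1 := normal_unit rg.
rewrite (enormC p); have g0 : c - p != 0 by rewrite subr_eq0 eq_sym.
have key : bsign b *: normal E p = (enorm (c - p))^-1 *: (c - p).
  apply: unit_direction => //.
    by rewrite enormZ n1 mulr1 /bsign; case: (b); rewrite ?normrN normr1.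
  move=> v hv; rewrite leNgt; apply/negP => hg.
  have [d d0 h] := nearest_dir N hg.
  have [d' d0' h'] : exists2 d, 0 < d & forall s, 0 < s < d ->
      closure (if b then E else ~` E) (p + s *: v).
    case: (b) hv; rewrite /bsign dotZr => hv.
      have [|d' d0' h'] := cone_in rg (v := v); first by lra.
      by exists d' => // s /h' /closureCN; exact: subset_closure.
    have [|d' d0' h'] := cone_out rg (v := v); first by lra.
    by exists d' => // s /h' h1; apply: subset_closure => /subset_closure.
  pose m := Num.min d d'; have m0 : 0 < m by rewrite lt_min d0.
  have [m1 m2] : m <= d /\ m <= d' by rewrite !ge_min !lexx orbT.
  by apply: (h (m / 2)); [|apply: h']; apply/andP; split; lra.
rewrite -scalerA -key scalerA /bsign.
by case: (b); rewrite ?mulr1 ?mulrNN ?mulr1 scale1r.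
Qed.

(** Second-order contact: along the boundary the squared distance to [c] is
    [rho ^+ 2 + s ^+ 2 * (1 + bsign b * rho * curvature) + o(s ^+ 2)], and it has
    a minimum at [s = 0]. *)
Lemma nearest_curvature (b : bool) E p c : is_regular E p ->
  nearest (closure (if b then E else ~` E)) p c ->
  0 <= 1 + bsign b * enorm (p - c) * curvature E p.
Proof.
move=> rg N; have [Ap pc [d d0 h]] := N; have n1 := normal_unit rg.
set rho := enorm (p - c).
have rho0 : 0 < rho by rewrite enorm_gt0 subr_eq0.
have nrm : c - p = (bsign b * rho) *: normal E p.
  rewrite (nearest_normal rg N) scalerA -/rho.
  have -> : bsign b * rho * (bsign b / rho) = 1.
    by rewrite /bsign; case: (b); field; rewrite gt_eqF.
  by rewrite scale1r.
have [q ql qb] := space_curve rg.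
have lim : (fun s : R => 1 - 2 * (bsign b * rho) * q s + s ^+ 2 * q s ^+ 2) @ 0^'+ -->
   1 - 2 * (bsign b * rho) * - (curvature E p / 2) + 0 ^+ 2 * (- (curvature E p / 2)) ^+ 2.
  have s0 : (fun s : R => s) @ 0^'+ --> (0 : R) by exact: cvg_at_right_filter.
  apply: cvgD; last by apply: cvgM; rewrite ?expr2; apply: cvgM.
  by apply: cvgB; [exact: cvg_cst|apply: cvgM => //; exact: cvg_cst].
have := cvgr_to_ge lim (b := 0); rewrite expr0n /= mul0r addr0 => hh.
apply: le_trans (hh _ _) _; last by rewrite /bsign; case: (b); lra.
have sq0 : (fun s : R => s ^+ 2 * q s) @ 0^'+ --> (0 : R).
  have s0 : (fun s : R => s) @ 0^'+ --> (0 : R) by exact: cvg_at_right_filter.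
  rewrite [X in _ --> X](_ : _ = 0 * 0 * - (curvature E p / 2)); last by rewrite !mul0r.
  by apply: cvgM ql; apply: cvgM.
near=> s; have s0 : 0 < s by near: s; exact: nbhs_right_gt.
have bs : boundary E (p + s *: perp (normal E p) + (s ^+ 2 * q s) *: normal E p) by near: s.
have sm : s < d / 2 by near: s; apply: nbhs_right_lt; rewrite divr_gt0.
have fm : `|s ^+ 2 * q s| < d / 2.
  by near: s; apply: (cvgr0_norm_lt _ sq0); rewrite divr_gt0.
have As : closure (if b then E else ~` E) (p + s *: perp (normal E p) + (s ^+ 2 * q s) *: normal E p).
  by move: bs; rewrite boundaryE => -[]; case: (b).
rewrite -addrA in As.
have := h _ As; rewrite [p + _ - p]addrAC subrr add0r => /(_ _) hd.
have {}hd : enorm (p - c) <= enorm (p + (s *: perp (normal E p) + (s ^+ 2 * q s) *: normal E p) - c).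
  apply: hd; apply: le_lt_trans (ler_enormD _ _) _.
  by rewrite !enormZ enorm_perp n1 !mulr1 gtr0_norm //; lra.
move: hd; rewrite -ler_sqr ?nnegrE ?enorm_ge0 // -/rho.
set f := s ^+ 2 * q s.
have -> : p + (s *: perp (normal E p) + f *: normal E p) - c =
    s *: perp (normal E p) + (f - bsign b * rho) *: normal E p.
  by rewrite scalerBl -nrm opprB [p + _]addrC !addrA.
rewrite frame_norm // => hs.
have b2 : bsign b ^+ 2 = 1 by rewrite /bsign; case: (b); rewrite ?sqrrN expr1n.
have {}hs : 0 <= s ^+ 2 * (1 - 2 * (bsign b * rho) * q s + s ^+ 2 * q s ^+ 2).
  have e1 : (f - bsign b * rho) ^+ 2 = f ^+ 2 - 2 * (bsign b * rho) * f + rho ^+ 2.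
    have rb2 : (bsign b * rho) ^+ 2 = rho ^+ 2 by rewrite exprMn b2 mul1r.
    by rewrite sqrrB rb2; ring.
  have -> : s ^+ 2 * (1 - 2 * (bsign b * rho) * q s + s ^+ 2 * q s ^+ 2) =
    s ^+ 2 + (f ^+ 2 - 2 * (bsign b * rho) * f) by rewrite /f; ring.
  rewrite e1 in hs; lra.
by move: hs; rewrite pmulr_rge0 // exprn_gt0.
Unshelve. all: by end_near.
Qed.

Lemma ball_ext_nearest r E p : 0 < r -> is_regular E p -> closure E p ->
  ball_ext r E p `<=` ~` E -> nearest (closure E) p (p + r *: normal E p).
Proof.
move=> r0 rg cp hb; have n1 := normal_unit rg.
have hr : enorm (p - (p + r *: normal E p)) = r.
  by rewrite opprD addrA subrr add0r enormN enormZ n1 mulr1 gtr0_norm.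
split=> //; first by rewrite -subr_eq0 -enorm_eq0 hr gt_eqF.
exists 1 => // y /closure_enormP cy _; rewrite hr leNgt; apply/negP => hlt.
have [|z Ez hz] := cy (r - enorm (y - (p + r *: normal E p))); first by rewrite subr_gt0.
apply: (hb z) Ez; rewrite /ball_ext /eball /=.
apply: le_lt_trans (ler_enorm_dist _ _ y) _; lra.
Qed.

(** A free exterior [r]-ball is itself a touching disc, so that the curvature is
    at least [- 1 / r]. *)
Lemma kappa_plus_ge0 r E p : 0 < r -> is_regular E p -> closure E p ->
  0 <= kappa_plus r E p.
Proof.
move=> r0 rg cp; rewrite /kappa_plus; case: asboolP => // hb.
have := nearest_curvature (b := true) rg (ball_ext_nearest r0 rg cp hb).
rewrite opprD addrA subrr add0r enormN enormZ normal_unit // mulr1 gtr0_norm // mul1r => h.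
have -> : curvature E p / 2 + (2 * r)^-1 = (1 + r * curvature E p) / (2 * r).
  by field; rewrite gt_eqF.
by rewrite divr_ge0 //; lra.
Qed.

(** The exterior [r]-ball is contained in the touching disc. Points farther than
    [2 * r] from [p] cannot meet that ball, so nothing is asked of them. *)
Lemma kappa_plus_contact r E p c : 0 < r -> is_regular E p -> closure E p ->
  r <= enorm (p - c) ->
  (forall y, closure E y -> enorm (y - p) < 2 * r -> enorm (p - c) <= enorm (y - c)) ->
  nearest (closure E) p c /\ kappa_plus r E p = curvature E p / 2 + (2 * r)^-1.
Proof.
move=> r0 rg cp rc hc; have n1 := normal_unit rg.
have N : nearest (closure E) p c.
  split=> //; first by rewrite -subr_eq0 -enorm_eq0 gt_eqF //; lra.
  by exists (2 * r) => //; rewrite mulr_gt0.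
split=> //; rewrite /kappa_plus; case: asboolP => // -[] y; rewrite /ball_ext /eball /= => hy Ey.
have k0 : 0 < enorm (p - c) by lra.
have nn := nearest_normal (b := true) rg N; rewrite /bsign in nn.
have cp' : c - p = enorm (p - c) *: normal E p.
  by rewrite nn scalerA mulrCA divff ?gt_eqF // mulr1 scale1r.
have := hc y (subset_closure Ey) => /(_ _) h.
have {}h : enorm (p - c) <= enorm (y - c).
  apply: h; apply: le_lt_trans (ler_enorm_dist _ _ (p + r *: normal E p)) _.
  by rewrite addrAC subrr add0r enormZ n1 mulr1 gtr0_norm //; lra.
have := ler_enorm_dist y c (p + r *: normal E p).
have -> : p + r *: normal E p - c = (r - enorm (p - c)) *: normal E p.
  by rewrite scalerBl -cp' opprB addrA [r *: _ + _]addrC.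
by rewrite enormZ n1 mulr1 ler0_norm; lra.
Qed.
End Contact.

(** * Disc barriers *)

Section Compactness.
Context {R : realType}.
Implicit Types (x y p c : plane R).

Lemma enorm_continuous : continuous (@enorm R).
Proof.
move=> x; apply/(@cvgrPdist_lt _ _ _ (nbhs x)) => e e0; apply/nbhs_enormP; exists e => // y hy.
have h1 := ler_enormD (x - y) y; have h2 := ler_enormD (y - x) x.
rewrite !subrK (enormC x) in h1 h2.
by rewrite /= ltr_norml; apply/andP; split; lra.
Qed.

Lemma compact_box (M : R) : compact [set x : plane R | forall i, `[- M, M]%classic (x 0 i)].
Proof. by apply: (@rV_compact R 2 (fun=> `[- M, M]%classic)) => i; exact: segment_compact. Qed.

Lemma enorm_box (M : R) x : enorm x <= M -> forall i, `[- M, M]%classic (x 0 i).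
Proof.
move=> h i; rewrite /= in_itv /= -ler_norml.
exact: le_trans (coord_le_enorm x i) h.
Qed.

End Compactness.

Section Barrier.
Context {R : realType}.
Implicit Types (x y p c : plane R) (t u sg : R) (F : R -> set (plane R)).

(** Take the first time at which the disc meets [F]. By left continuity the
    contact takes place on the circle and the disc is otherwise free. Followed
    backwards in time, where the radius varies at the rate [- sg], the point of
    contact has a smaller radial velocity [L] and enters an earlier disc. *)
Lemma disc_barrier F (t1 t2 R0 sg : R) c :
  closed [set q : R * plane R | t1 <= q.1 <= t2 /\ F q.1 q.2] ->
  (forall t p e, t1 < t -> t <= t2 -> F t p -> 0 < e ->
     exists2 u, 0 < u < e /\ t1 <= t - u & exists2 p', F (t - u) p' & enorm (p' - p) < e) ->
  (forall t, t1 <= t <= t2 -> 0 < R0 + sg * (t - t1)) ->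
  (forall p, F t1 p -> R0 < enorm (p - c)) ->
  (forall t p, t1 < t -> t <= t2 -> F t p -> enorm (p - c) = R0 + sg * (t - t1) ->
     (forall p', F t p' -> enorm (p - c) <= enorm (p' - c)) ->
     exists L (q : R -> R), [/\ L < - sg, q u @[u --> 0^'+] --> L &
       \forall u \near 0^'+, F (t - u) (p + (u * q u) *: ((enorm (p - c))^-1 *: (p - c)))]) ->
  forall t p, t1 <= t -> t <= t2 -> F t p -> R0 + sg * (t - t1) < enorm (p - c).
Proof.
move=> cF lc rpos h1 hc t p t1t tt2 Fp; rewrite ltNge; apply/negP => hp.
pose K := [set q : R * plane R | (t1 <= q.1 <= t2 /\ F q.1 q.2) /\
   enorm (q.2 - c) <= R0 + sg * (q.1 - t1)].
pose M := enorm c + (`|R0| + `|sg| * (t2 - t1)).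
have cK : compact K.
  pose B := `[t1, t2]%classic `*` [set x : plane R | forall i, `[- M, M]%classic (x 0 i)].
  apply: (@subclosed_compact _ K B).
  - have -> : K = [set q : R * plane R | t1 <= q.1 <= t2 /\ F q.1 q.2] `&`
      (fun q : R * plane R => enorm (q.2 - c) - (R0 + sg * (q.1 - t1))) @^-1` [set x | x <= 0].
      by apply/seteqP; split => q [Kq] /=; rewrite ?subr_le0 => ?; split; rewrite //= ?subr_le0.
    apply: closedI => //.
    apply: preimage_closed; last exact: closed_le.
    move=> q _; apply: cvgB.
      apply: (@continuous_comp _ _ _ (fun q : R * plane R => q.2 - c) (@enorm R)); last exact: enorm_continuous.
      by apply: cvgB; [exact: cvg_snd|exact: cvg_cst].
    apply: cvgD; first exact: cvg_cst.
    apply: cvgM; first exact: cvg_cst.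
    by apply: cvgB; [exact: cvg_fst|exact: cvg_cst].
  - by apply: compact_setX; [exact: segment_compact|exact: compact_box].
  move=> [s y] /= [[/andP[s1 s2] _] hy]; split; first by rewrite /= in_itv /= s1 s2.
  apply: enorm_box; have := ler_enormD (y - c) c; rewrite subrK => hyc.
  apply: le_trans hyc _; rewrite addrC lerD2l; apply: le_trans hy _.
  apply: lerD; first exact: ler_norm.
  apply: le_trans (ler_wpM2r _ (ler_norm sg)) _; first by rewrite subr_ge0.
  by rewrite ler_wpM2l // lerD2r.
have [[t0 p0] + tmin] : exists2 q, q \in K & forall q', q' \in K -> q.1 <= q'.1.
  apply: compact_EVT_min => //; first by exists (t, p); split=> //; split=> //=; rewrite t1t tt2.
  by apply: continuous_subspaceT => q; exact: cvg_fst.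
rewrite inE => -[[/= /andP[t10 t02] F0] k0].
have {tmin}tmin s y : t1 <= s -> s < t0 -> F s y -> R0 + sg * (s - t1) < enorm (y - c).
  move=> s1 s0 Fs; rewrite ltNge; apply/negP => hy.
  have := tmin (s, y); rewrite inE /= => /(_ _) h.
  suff ht : t0 <= s by lra.
  by apply: h; split=> //; split=> //=; apply/andP; split; lra.
have lt10 : t1 < t0.
  rewrite lt_neqAle t10 andbT; apply/eqP => e; subst t1.
  by have := h1 p0 F0; move: k0; rewrite subrr mulr0 addr0 => k1 k2; lra.
have low p' : F t0 p' -> R0 + sg * (t0 - t1) <= enorm (p' - c).
  move=> F'; rewrite leNgt; apply/negP => hlt.
  pose D := R0 + sg * (t0 - t1) - enorm (p' - c).
  have D0 : 0 < D by rewrite subr_gt0.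
  have sg0 := normr_ge0 sg.
  have sg1 : 0 < 1 + `|sg| by lra.
  pose m := D / (1 + `|sg|); have m0 : 0 < m by rewrite divr_gt0.
  have mD : D = m + `|sg| * m by rewrite /m; field; rewrite gt_eqF.
  have [u [/andP[u0 um] u1] [y Fy hy]] := lc t0 p' m lt10 t02 F' m0.
  have ut0 : t0 - u < t0 by lra.
  have h := tmin _ _ u1 ut0 Fy.
  have hd := ler_enorm_dist y c p'.
  have su : sg * u <= `|sg| * m.
    by apply: le_trans (_ : `|sg| * u <= _); rewrite ?ler_wpM2r ?ler_wpM2l ?ler_norm // ltW.
  have e1 : sg * (t0 - u - t1) = sg * (t0 - t1) - sg * u by ring.
  rewrite e1 in h; clearbody m; rewrite /D in mD; lra.
have eq0 : enorm (p0 - c) = R0 + sg * (t0 - t1).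
  by apply/eqP; rewrite eq_le k0 low.
have [|L [q [Ls qL hq]]] := hc t0 p0 lt10 t02 F0 eq0.
  by move=> p' F'; rewrite eq0; exact: low.
have rho0 : 0 < enorm (p0 - c) by rewrite eq0; apply: rpos; rewrite t10.
suff hL : - sg <= L by lra.
apply: (cvgr_to_ge qL).
have uq0 : (fun u => u * q u) @ 0^'+ --> (0 : R).
  rewrite [X in _ --> X](_ : _ = 0 * L); last by rewrite mul0r.
  by apply: cvgM qL; exact: cvg_at_right_filter.
near=> u; have u0 : 0 < u by near: u; exact: nbhs_right_gt.
have ut : u < t0 - t1 by near: u; apply: nbhs_right_lt; rewrite subr_gt0.
have uq : `|u * q u| < enorm (p0 - c) by near: u; apply: (cvgr0_norm_lt _ uq0).
have Fu : F (t0 - u) (p0 + (u * q u) *: ((enorm (p0 - c))^-1 *: (p0 - c))) by near: u.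
have [ut1 ut2] : t1 <= t0 - u /\ t0 - u < t0 by split; lra.
have := tmin _ _ ut1 ut2 Fu.
have -> : p0 + (u * q u) *: ((enorm (p0 - c))^-1 *: (p0 - c)) - c =
   (1 + u * q u / enorm (p0 - c)) *: (p0 - c).
  by rewrite scalerA scalerDl scale1r addrAC.
rewrite enormZ -[X in _ < _ * X]gtr0_norm // -normrM mulrDl mul1r divfK ?gt_eqF //.
move: uq; rewrite ltr_norml => /andP[uq1 uq2].
rewrite gtr0_norm; last by lra.
rewrite {1}eq0 => hh.
have {}hh : u * - sg < u * q u by lra.
by rewrite ltW //; move: hh; rewrite ltr_pM2l.
Unshelve. all: by end_near.
Qed.
End Barrier.

(** * Thin sets stay thin *)

Section FlowBarriers.
Context {R : realType}.
Variables (r : R) (T : \bar R) (E : R -> set (plane R)).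
Hypotheses (r0 : 0 < r) (smoothE : smooth_evolution T E) (flowE : curvature_flow r T E).
Implicit Types (v w x y p c nu : plane R) (a e t u : R).

(** For the flow, the radial velocity of a point of contact is
    [bsign b * kappa]: a disc avoiding the phase [b] survives if its radius has
    a growth rate smaller than that. *)
Lemma flow_disc_barrier (b : bool) (t1 t2 R0 sg : R) c :
  0 <= t1 -> lifespan T t2 ->
  (forall t, t1 <= t <= t2 -> 0 < R0 + sg * (t - t1)) ->
  (forall p, phase E b t1 p -> R0 < enorm (p - c)) ->
  (forall t p, t1 < t -> t <= t2 -> lifespan T t -> boundary (E t) p ->
     is_regular (E t) p -> enorm (p - c) = R0 + sg * (t - t1) ->
     (forall p', phase E b t p' -> enorm (p - c) <= enorm (p' - c)) ->
     nearest (phase E b t) p c -> sg < bsign b * kappa r (E t) p) ->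
  forall t p, t1 <= t -> t <= t2 -> phase E b t p -> R0 + sg * (t - t1) < enorm (p - c).
Proof.
move=> t10 lt2 rpos h1 hc.
have life t : t1 <= t -> t <= t2 -> lifespan T t.
  by move=> ht1 ht2; apply: lifespan_le lt2 => //; lra.
apply: disc_barrier => //; first exact: (closed_phase smoothE).
  move=> t p e t1t tt2 ph e0.
  have tt1 : 0 < t - t1 by lra.
  have m0 : 0 < Num.min e (t - t1) by rewrite lt_min e0.
  have [||u [/andP[u0 um] _] [p' ph' hp']] := phase_left_continuous smoothE flowE _ (life t _ tt2) ph m0.
  - lra.
  - lra.
  move: um hp'; rewrite !lt_min => /andP[ue ut] /andP[pe _].
  exists u; first by rewrite u0 ue; split=> //; lra.
  by exists p'.
move=> t p t1t tt2 ph hrho hmin; have lt := life t (ltW t1t) tt2.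
have rho0 : 0 < enorm (p - c) by rewrite hrho; apply: rpos; rewrite (ltW t1t).
have N : nearest (closure (if b then E t else ~` E t)) p c.
  split=> //; first by rewrite -subr_eq0 -enorm_eq0 gt_eqF.
  by exists 1 => // y hy _; exact: hmin.
have bp := nearest_boundary N.
have rg := evolution_regular smoothE lt bp.
have hk := hc t p t1t tt2 lt bp rg hrho hmin N.
have t0 : 0 < t by lra.
have [q qk qb] := time_curve smoothE flowE t0 lt bp.
exists (- (bsign b * kappa r (E t) p)), (fun u => - (bsign b * q u)); split.
- by rewrite ltrN2.
- by apply: cvgN; apply: cvgM => //; exact: cvg_cst.
apply: filterS qb => u; rewrite (nearest_normal rg N) => bu.
apply: boundary_phase.
rewrite (_ : (u * - (bsign b * q u)) *: _ = (u * q u) *: ((bsign b / enorm (p - c)) *: (c - p))) //.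
by rewrite -[c - p]opprB !(scalerN, scalerA) -scaleNr; congr (_ *: _); ring.
Qed.

(** With [k] the curvature, at least [- 1 / rho], the value of [kappa] is [k] if
    the interior ball is free as well, and [k / 2 + 1 / (2 * r)] otherwise. *)
Lemma kappa_contact_ge (t rho : R) p c : is_regular (E t) p -> closure (E t) p ->
  enorm (p - c) = rho -> r <= rho ->
  (forall p', closure (E t) p' -> rho <= enorm (p' - c)) ->
  - rho^-1 <= kappa r (E t) p.
Proof.
move=> rg cp hrho rrho hmin; have rho0 : 0 < rho := lt_le_trans r0 rrho.
have rpos := r0.
have [||N hk] := kappa_plus_contact (c := c) r0 rg cp; first by rewrite hrho.
  by move=> y cy _; rewrite hrho; exact: hmin.
have := nearest_curvature (b := true) rg N; rewrite /bsign hrho mul1r => hc.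
have ir : rho^-1 <= r^-1 by rewrite lef_pV2.
have hc' : - rho^-1 <= curvature (E t) p.
  by rewrite -(ler_pM2l rho0) mulrN divff ?gt_eqF //; lra.
have ir0 : 0 < rho^-1 by rewrite invr_gt0.
rewrite /kappa hk /kappa_minus invfM; case: asboolP => _; lra.
Qed.

(** The complementary half-plane is a union of discs of arbitrarily large radius
    [R0]; such discs shrink at a rate less than [2 / R0], hence by a negligible
    amount. *)
Lemma halfplane_preserved v a : enorm v = 1 -> (forall x, E 0 x -> dot x v <= a) ->
  forall t x, lifespan T t -> closure (E t) x -> dot x v <= a.
Proof.
move=> v1 h0 t y lt cy; rewrite leNgt; apply/negP => hlt.
have [t0 _] := lt; have rpos := r0.
pose d := dot y v - a; have d0 : 0 < d by rewrite subr_gt0.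
have td : 0 <= t / d by rewrite divr_ge0 // ltW.
(* so large that at time t less than half of R0 and less than d / 2 is lost *)
pose R0 := 2 * r + 4 * (t / d) + 4 * t + d + 1.
have R1 : 1 <= R0 by rewrite /R0; lra.
have R00 : 0 < R0 by lra.
have iR : R0 * R0^-1 = 1 by rewrite divff // gt_eqF.
have iR0 : 0 < R0^-1 by rewrite invr_gt0.
have tR : 2 * t * R0^-1 < R0 / 2.
  rewrite ltr_pdivrMr //; apply: lt_le_trans (_ : R0 / 2 <= _).
    by rewrite /R0; lra.
  by rewrite ler_peMr // divr_ge0 // ltW.
have tdR : 2 * t * R0^-1 < d / 2.
  rewrite ltr_pdivrMr // mulrAC ltr_pdivlMr //.
  have -> : 2 * t * 2 = d * (4 * (t / d)) by field; rewrite gt_eqF.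
  by rewrite ltr_pM2l // /R0; lra.
pose c := y + (R0 - d / 2) *: v.
have sE s : 0 <= s -> s <= t -> 2 * s * R0^-1 <= 2 * t * R0^-1.
  by move=> s0 st; rewrite ler_pM2r // ler_pM2l.
have yc : enorm (y - c) = R0 - d / 2.
  rewrite /c opprD addrA subrr add0r enormN enormZ v1 mulr1 gtr0_norm //.
  by rewrite /R0; lra.
have far p : (forall x, E 0 x -> dot x v <= a) -> closure (E 0) p -> R0 < enorm (p - c).
  move=> _ /closure_enormP cp; have [|x Ex hx] := cp (d / 4); first lra.
  have := ler_dot (c - x) v; rewrite v1 mulr1 /c dotBl dotDl dotZl (unit_dot v1).
  have := h0 x Ex; have := ler_enorm_dist c x p; rewrite (enormC c p) (enormC p x).
  rewrite /d in hx *; rewrite -/c; lra.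
have H : R0 + - (2 * R0^-1) * (t - 0) < enorm (y - c).
  apply: (@flow_disc_barrier true 0 t) => //.
  - by move=> s /andP[s0 st]; rewrite subr0 mulNr; have := sE s s0 st; lra.
  - by move=> p; exact: far.
  move=> s p s0 st ls bp rg hp hmin N.
  rewrite /bsign mul1r; have := sE s (ltW s0) st; move: hp; rewrite subr0 mulNr => hp hs.
  have cp : closure (E s) p by move: bp; rewrite boundaryE => -[].
  have rp : R0 / 2 < enorm (p - c) by lra.
  have pp : 0 < enorm (p - c) by lra.
  apply: lt_le_trans (kappa_contact_ge rg cp erefl _ hmin); last by rewrite /R0 in rp; lra.
  rewrite ltrN2 -[2]invrK -invfM ltf_pV2 ?posrE //; first by rewrite mulrC.
  by rewrite mulr_gt0 // invr_gt0.
by move: H; rewrite subr0 mulNr yc; lra.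
Qed.

(** A ball of radius [r] has width [2 * r] in the direction [v]. *)
Lemma kappa_minus_thin v a1 a2 t x : enorm v = 1 -> a2 - a1 < 2 * r ->
  (forall x, E t x -> a1 <= dot x v <= a2) -> kappa_minus r (E t) x = 0.
Proof.
have rpos := r0; move=> v1 h hE; rewrite /kappa_minus; case: asboolP => // hb; exfalso.
pose s := Num.max 0 (((a2 - a1) / 2 + r) / 2).
have sr : s < r by rewrite gt_max r0 /=; lra.
have s0 : 0 <= s by rewrite le_max lexx.
have hs : ((a2 - a1) / 2 + r) / 2 <= s by rewrite le_max lexx orbT.
set c := x - r *: normal (E t) x.
have c1 : E t (c + s *: v).
  by apply: hb; rewrite /ball_int /eball /= addrAC subrr add0r enormZ v1 mulr1 ger0_norm.
have c2 : E t (c - s *: v).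
  by apply: hb; rewrite /ball_int /eball /= addrAC subrr add0r enormN enormZ v1 mulr1 ger0_norm.
have := hE _ c1; have := hE _ c2; rewrite dotBl dotDl dotZl (unit_dot v1); lra.
Qed.

End FlowBarriers.

(** * Supporting lines, monotonicity and the initial gap *)

Section ConvexTangent.
Context {R : realType}.
Implicit Types (v w x y p c nu : plane R) (a s t : R) (A : set (plane R)).

Lemma not_closure A x : ~ closure A x ->
  exists2 e, 0 < e & forall y, closure A y -> e <= enorm (y - x).
Proof.
move=> nx; apply: contrapT => h; apply: nx; apply/closure_enormP => e e0.
apply: contrapT => h2; apply: h; exists e => // y /closure_enormP cy.
rewrite leNgt; apply/negP => hy; have [|z Az hz] := cy (e - enorm (y - x)).
  by rewrite subr_gt0.
apply: h2; exists z => //; apply: le_lt_trans (ler_enorm_dist _ _ y) _; lra.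
Qed.

(** The segment from [x] to [y] is connected and covered by two closed sets. *)
Lemma boundary_crossing A x y : closure A x -> closure (~` A) y ->
  exists2 s, 0 <= s <= 1 & boundary A (x + s *: (y - x)).
Proof.
move=> cx cy; pose l s := x + s *: (y - x).
have lc : continuous l.
  by move=> s; apply: cvgD; [exact: cvg_cst|apply: cvgZr_tmp; exact: cvg_id].
apply: contrapT => h.
pose U := l @^-1` closure A; pose V := l @^-1` closure (~` A).
have cU : closed U by apply: preimage_closed => [s _|]; [exact: lc|exact: closed_closure].
have cV : closed V by apply: preimage_closed => [s _|]; [exact: lc|exact: closed_closure].
have UV s : U s \/ V s.
  have [As|As] := pselect (A (l s)); [left|right]; exact: subset_closure.
have dis s : `[0, 1]%classic s -> U s -> V s -> False.
  rewrite /= in_itv /= => s01 Us Vs; apply: h; exists s => //.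
  by rewrite boundaryE.
have e : `[0, 1]%classic `&` U = `[0, 1]%classic.
apply: (@segment_connected R 0 1).
- exists 0; split; first by rewrite /= in_itv /= lexx ler01.
  by rewrite /U /l /= scale0r addr0.
- exists (~` V); first exact: closed_openC.
  apply/seteqP; split => s [s01 hs]; split => //.
    by move=> Vs; exact: dis hs Vs.
  by have [] := UV s.
- by exists U.
have h1 : `[0, 1]%classic (1 : R) by rewrite /= in_itv /= lexx ler01.
have : (`[0, 1]%classic `&` U) 1 by rewrite e.
move=> [_ U1]; apply: (dis 1 h1 U1).
by rewrite /V /l /= scale1r addrC subrK.
Qed.

(** If [y] were above the tangent line, joining it to a point of [A] slightly
    below [x], at a depth comparable with the fraction [s] of the segment, would
    give points of the closure in a direction that leaves [A]. The assumption is
    weaker than convexity because the lemma is also applied before convexity is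
    known. *)
Lemma supporting_halfplane A x y : is_regular A x ->
  (forall p q s, A p -> A q -> 0 <= s <= 1 -> closure A (s *: p + (1 - s) *: q)) ->
  A y -> dot (y - x) (normal A x) <= 0.
Proof.
move=> rg hA Ay; rewrite leNgt; apply/negP; set nu := normal A x.
set a := dot (y - x) nu => a0; have n1 : dot nu nu = 1 by exact/unit_dot/normal_unit.
(* direction of the combinations below, when the depth k below x is tuned to s *)
pose w := (y - x) - (a / 2) *: nu.
have [|d d0 h] := cone_out rg (v := w).
  by rewrite /w dotBl -/a dotZl n1 mulr1; lra.
have [|d' d0' h'] := cone_in rg (v := - nu); first by rewrite dotNl n1; lra.
pose m := Num.min (1 / 2) (Num.min d (d' / a)).
have m0 : 0 < m by rewrite !lt_min d0 (divr_gt0 d0' a0) !andbT; lra.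
have [[m1 m2] m3] : (m <= 1 / 2 /\ m <= d) /\ m <= d' / a by rewrite /m !ge_min !lexx !orbT.
pose s := m / 2; have s01 : 0 < s < 1 / 2 by rewrite /s; apply/andP; split; lra.
have sa : s * a < d'.
  by move: m3; rewrite ler_pdivlMr // /s; have := mulr_gt0 m0 a0; lra.
pose k := s * a / (2 * (1 - s)).
have k0 : 0 < k by rewrite divr_gt0 // mulr_gt0 //; lra.
have kd : k < d'.
  rewrite /k ltr_pdivrMr; last lra.
  apply: lt_le_trans sa _; rewrite ler_peMr //; lra.
have Ak : A (x + k *: - nu) by apply: closureCN; apply: h'; rewrite k0.
apply: (h s); first by rewrite /s; apply/andP; split; lra.
have -> : x + s *: w = s *: y + (1 - s) *: (x + k *: - nu).
  have -> : (1 - s) *: (x + k *: - nu) = (1 - s) *: x - (s * a / 2) *: nu.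
    rewrite scalerDr scalerN scalerN scalerA; congr (_ - _ *: _).
    by rewrite /k; field; lra.
  by rewrite /w; apply: planeP; rewrite !mxE; ring.
by apply: hA => //; apply/andP; split; lra.
Qed.

(** Three points are enough in the plane, see [caratheodory]. *)
Lemma convex_comb3 A (lam : 'I_3 -> R) (p : 'I_3 -> plane R) : convex A ->
  (forall i, 0 <= lam i) -> \sum_i lam i = 1 -> (forall i, A (p i)) ->
  A (\sum_i lam i *: p i).
Proof.
move=> /convexP cvA l0; rewrite !big_ord_recl !big_ord0 !addr0.
set a := lam _; set b := lam _; set c := lam _ => l1 Ap.
have a0 : 0 <= a := l0 _. have b0 : 0 <= b := l0 _. have c0 : 0 <= c := l0 _.
have [bc|bc] := eqVneq (b + c) 0.
  have [-> -> ->] : [/\ a = 1, b = 0 & c = 0] by split; lra.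
  by rewrite !scale0r !addr0 scale1r.
have bc0 : 0 < b + c by rewrite lt_neqAle eq_sym bc addr_ge0.
pose k := b / (b + c).
have eb : b = (1 - a) * k by rewrite /k (_ : 1 - a = b + c); [field|lra].
have ec : c = (1 - a) * (1 - k) by rewrite /k (_ : 1 - a = b + c); [field|lra].
have k0 : 0 <= k by rewrite divr_ge0 // ltW.
have k1 : k <= 1 by rewrite ler_pdivrMr // mul1r; lra.
clearbody k; rewrite eb ec -!scalerA -scalerDr; apply: (cvA) => //; last by lra.
exact: cvA.
Qed.

End ConvexTangent.

Section ThinFlow.
Context {R : realType}.
Variables (r : R) (T : \bar R) (E : R -> set (plane R)).
Hypotheses (r_gt0 : 0 < r) (smoothE : smooth_evolution T E) (flowE : curvature_flow r T E).
Hypothesis km0 : forall t x, lifespan T t -> kappa_minus r (E t) x = 0.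
Implicit Types (v w x y z p c nu : plane R) (a t e g : R).

Lemma kappaE t x : lifespan T t -> kappa r (E t) x = kappa_plus r (E t) x.
Proof. by move=> lt; rewrite /kappa km0 // addr0. Qed.

(** As [kappa] is nonnegative, discs in the exterior do not shrink. *)
Lemma closure_decreasing t1 t2 x : 0 <= t1 -> t1 <= t2 -> lifespan T t2 ->
  closure (E t2) x -> closure (E t1) x.
Proof.
move=> t10 t12 lt2 cx; apply: contrapT => /not_closure[e e0 he].
pose R0 := e / 2; pose K := R0 / (t2 - t1 + 1).
have D0 : 0 < t2 - t1 + 1 by lra.
have K0 : 0 < K by rewrite !divr_gt0.
have KD : K * (t2 - t1) + K = R0 by rewrite /K; field; lra.
have pos t : t1 <= t <= t2 -> 0 < R0 + - K * (t - t1).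
  move=> /andP[_ ht].
  have h : K * (t - t1) <= K * (t2 - t1) by rewrite ler_pM2l // lerD2r.
  by rewrite mulNr; lra.
have := @flow_disc_barrier _ r T E smoothE flowE true t1 t2 R0 (- K) x t10 lt2 pos.
have h1 p : phase E true t1 p -> R0 < enorm (p - x) by move=> /he; rewrite /R0; lra.
move/(_ h1) => H.
have := H _ t2 x t12 (lexx _) cx; rewrite subrr enorm0.
have := pos t2; rewrite t12 lexx => /(_ isT) h2 h3.
suff : R0 + - K * (t2 - t1) < 0 by lra.
apply: h3 => t p ht1 ht2 lt bp rg _ _ _; rewrite /bsign mul1r kappaE //.
have cp : closure (E t) p by move: bp; rewrite boundaryE => -[].
by have := kappa_plus_ge0 r_gt0 rg cp; lra.
Qed.

(** Discs of large radius tangent at [x] avoid the convex set [E 0]. Where such a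
    disc meets the boundary, [kappa] is at least [1 / (4 * r)], so the disc grows
    at the rate [1 / (8 * r)]; let the radius go to infinity. The barrier needs a
    strict initial inequality, which costs half of the gain. *)
Lemma tangent_retreat e x p : 0 < e -> lifespan T e -> convex (E 0) ->
  boundary (E 0) x -> closure (E e) p ->
  dot (p - x) (normal (E 0) x) <= - (e / (16 * r)).
Proof.
move=> e0 le cE bx cp.
have l0 : lifespan T 0 by apply: lifespan_le le => //; exact: ltW.
have rg := evolution_regular smoothE l0 bx.
have n1 := normal_unit rg; set nu := normal (E 0) x in n1 *.
have sup y : closure (E 0) y -> dot (y - x) nu <= 0.
  move=> /closure_enormP cy; apply/ler_addgt0Pl => a a0; have [z Ez hz] := cy a a0.
  have := supporting_halfplane rg (y := z) => /(_ _ Ez) h.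
  have {}h : dot (z - x) nu <= 0.
    apply: h => p' q' s p1 q1 /andP[s0 s1]; apply: subset_closure.
    by move/convexP: cE; apply.
  have := ler_dot (y - z) nu; rewrite n1 mulr1 (enormC y); move: h; rewrite !dotBl; lra.
set d := e / (16 * r); have d0 : 0 < d by rewrite divr_gt0 // mulr_gt0.
rewrite leNgt; apply/negP => hlt; set a := dot (p - x) nu in hlt.
have ad : 0 < a + d by lra.
pose R1 := 2 * r + d + (enorm (p - x) ^+ 2 / (a + d)).
have q0 : 0 <= enorm (p - x) ^+ 2 / (a + d) by rewrite divr_ge0 ?sqr_ge0 // ltW.
have rp := r_gt0; have R10 : 2 * r + d <= R1 by rewrite /R1; lra.
have dist y : enorm (y - (x + R1 *: nu)) ^+ 2 = enorm (y - x) ^+ 2 - 2 * R1 * dot (y - x) nu + R1 ^+ 2.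
  rewrite opprD addrA [LHS]enorm2B dotZr enormZ n1 mulr1 real_normK ?num_real //; ring.
have ir0 : 0 < (8 * r)^-1 by rewrite invr_gt0 mulr_gt0.
have := @flow_disc_barrier _ r T E smoothE flowE true 0 e (R1 - d) (8 * r)^-1 (x + R1 *: nu) (lexx _) le.
have h1 t : 0 <= t <= e -> 0 < R1 - d + (8 * r)^-1 * (t - 0).
  by move=> /andP[t0 _]; rewrite subr0; have := mulr_ge0 (ltW ir0) t0; lra.
have h2 y : phase E true 0 y -> R1 - d < enorm (y - (x + R1 *: nu)).
  move=> /sup hy; apply: lt_le_trans (_ : R1 <= _); first by lra.
  rewrite -ler_sqr ?nnegrE ?enorm_ge0 ?dist //; last lra.
  have : 0 <= R1 * - dot (y - x) nu by rewrite mulr_ge0 //; lra.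
  have := sqr_ge0 (enorm (y - x)); lra.
have h3 t y : 0 < t -> t <= e -> lifespan T t -> boundary (E t) y ->
     is_regular (E t) y -> enorm (y - (x + R1 *: nu)) = R1 - d + (8 * r)^-1 * (t - 0) ->
     (forall p', phase E true t p' -> enorm (y - (x + R1 *: nu)) <= enorm (p' - (x + R1 *: nu))) ->
     nearest (phase E true t) y (x + R1 *: nu) -> (8 * r)^-1 < bsign true * kappa r (E t) y.
  move=> t0 te lt by' rgy hy hmin N; rewrite /bsign mul1r kappaE //.
  have cy : closure (E t) y by move: by'; rewrite boundaryE => -[].
  set c := x + R1 *: nu in hy hmin N *.
  have hrho : 2 * r <= enorm (y - c).
    by rewrite hy subr0; have := mulr_ge0 (ltW ir0) (ltW t0); lra.
  have [||N' ->] := kappa_plus_contact (c := c) r_gt0 rgy cy; first lra.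
    by move=> p' cp' _; exact: hmin.
  have := nearest_curvature (b := true) rgy N'; rewrite /bsign mul1r => hc.
  have hc' : - (2 * r)^-1 <= curvature (E t) y.
    rewrite leNgt; apply/negP => hk.
    have : enorm (y - c) * curvature (E t) y < -1.
      apply: le_lt_trans (_ : 2 * r * curvature (E t) y < -1); last first.
        by rewrite mulrC -ltr_pdivlMr ?mulr_gt0 // mulN1r.
      rewrite ler_nM2r //; apply: lt_trans hk _.
      by rewrite oppr_lt0 invr_gt0 mulr_gt0.
    lra.
  have -> : (8 * r)^-1 = (2 * r)^-1 / 4 by field; lra.
  have : 0 < (2 * r)^-1 by rewrite invr_gt0 mulr_gt0.
  lra.
move=> /(_ h1 h2 h3 e p (ltW e0) (lexx _) cp) hp.
have {}hp : R1 + d < enorm (p - (x + R1 *: nu)).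
  have ed : (8 * r)^-1 * (e - 0) = 2 * d by rewrite /d; field; lra.
  by move: hp; rewrite ed; lra.
have : (R1 + d) ^+ 2 < enorm (p - (x + R1 *: nu)) ^+ 2.
  by rewrite ltr_sqr ?nnegrE ?enorm_ge0 //; lra.
rewrite dist -/a => hh.
have hR : enorm (p - x) ^+ 2 <= R1 * (a + d).
  by rewrite -ler_pdivrMr // /R1; lra.
have := sqr_ge0 d; rewrite sqrrD in hh; have := sqr_ge0 (enorm (p - x)); nra.
Qed.

(** Otherwise the segment from [p] to [x] would cross the boundary of [E 0] at a
    point too close to [p]. *)
Lemma initial_gap e x p : 0 < e -> lifespan T e -> convex (E 0) ->
  closure (E e) p -> enorm (x - p) < e / (16 * r) -> E 0 x.
Proof.
move=> e0 le cE cp hx; apply: contrapT => nx.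
have cp0 : closure (E 0) p by apply: closure_decreasing cp => //; exact: ltW.
have [s /andP[s0 s1] bs] := boundary_crossing cp0 (subset_closure nx).
have l0 : lifespan T 0 by apply: lifespan_le le => //; exact: ltW.
have n1 := normal_unit (evolution_regular smoothE l0 bs).
have := tangent_retreat e0 le cE bs cp.
set nu := normal _ _ in n1 *.
have := ler_dot (s *: (x - p)) nu; rewrite enormZ n1 mulr1 ger0_norm //.
rewrite opprD addrA subrr add0r dotNl => h1 h2.
have := ler_piMl (enorm_ge0 (x - p)) s1; lra.
Qed.

(** A disc inside the set shrinks at most at the rate [1 / g + 1 / r] as long as
    its radius is at least [g / 2]: its curvature bounds that of the set. *)
Lemma inner_disc_persists g t1 t z : 0 < g -> 0 <= t1 -> t1 <= t -> lifespan T t ->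
  (g^-1 + r^-1) * (t - t1) <= g / 4 ->
  (forall w, closure (~` E t1) w -> g <= enorm (w - z)) ->
  forall w, closure (~` E t) w -> g / 2 <= enorm (w - z).
Proof.
move=> g0 t10 t1t lt hK h1 w cw.
set K := g^-1 + r^-1 in hK; have ig : 0 < g^-1 by rewrite invr_gt0.
have ir : 0 < r^-1 by rewrite invr_gt0.
have K0 : 0 < K by rewrite /K; lra.
have hs s : t1 <= s -> s <= t -> K * (s - t1) <= g / 4.
  by move=> _ st; apply: le_trans hK; rewrite ler_pM2l // lerD2r.
suff h : 3 / 4 * g + - K * (t - t1) < enorm (w - z) by rewrite mulNr in h; lra.
apply: (@flow_disc_barrier _ r T E smoothE flowE false t1 t) => //.
- by move=> s /andP[s1 s2]; rewrite mulNr; have := hs s s1 s2; lra.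
- by move=> p /h1; lra.
move=> s p s1 s2 ls bp rg hp hmin N; rewrite /bsign mulN1r ltrN2 kappaE //.
have hrho : g / 2 <= enorm (p - z) by rewrite hp mulNr; have := hs s (ltW s1) s2; lra.
have := nearest_curvature (b := false) rg N; rewrite /bsign mulN1r => hc.
rewrite /kappa_plus; case: asboolP => // _.
have hc' : curvature (E s) p <= 2 * g^-1.
  rewrite leNgt; apply/negP => hk.
  have k0 : 0 < curvature (E s) p by lra.
  have : 1 < enorm (p - z) * curvature (E s) p.
    apply: lt_le_trans (_ : g / 2 * curvature (E s) p <= _); last by rewrite ler_pM2r.
    have := hk; rewrite -(ltr_pM2l (x := g / 2)); last lra.
    by have -> : g / 2 * (2 * g^-1) = 1 by field; rewrite gt_eqF.
  by rewrite mulNr in hc; lra.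
by rewrite invfM /K; lra.
Qed.

End ThinFlow.

(** * Convex combinations of three points *)

Section Caratheodory.
Context {R : realType}.
Implicit Types (x w : plane R).

Definition weights n (lam : 'I_n -> R) := (forall i, 0 <= lam i) /\ \sum_i lam i = 1.
Definition bary n (lam : 'I_n -> R) (P : 'I_n -> plane R) := \sum_i lam i *: P i.
Definition moment n (lam : 'I_n -> R) (P : 'I_n -> plane R) :=
  \sum_i lam i * dot (P i) (P i).

(** Four points of the plane are affinely dependent; the sign of the relation is
    chosen so that moving along it does not increase the second moment. *)
Lemma affine_dependence (P : 'I_4 -> plane R) :
  exists al : 'I_4 -> R, [/\ exists i, al i < 0, \sum_i al i = 0,
    bary al P = 0 & moment al P <= 0].
Proof.
pose A : 'M[R]_(4, 3) := \matrix_(i, j)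
  (if (j == 0 :> nat)%N then 1 else if (j == 1 :> nat)%N then P i 0 0 else P i 0 1).
have kA : kermx A != 0.
  by rewrite kermx_eq0 /row_free neq_ltn ltnS rank_leq_col.
have /rowV0Pn[v /sub_kermxP vA v0] := kA.
have col (j : 'I_3) : \sum_i v 0 i * A i j = 0.
  by have /rowP/(_ j) := vA; rewrite !mxE.
have main (al : 'I_4 -> R) : (exists i, al i != 0) -> (forall j : 'I_3, \sum_i al i * A i j = 0) ->
    moment al P <= 0 -> exists al : 'I_4 -> R, [/\ exists i, al i < 0, \sum_i al i = 0,
    bary al P = 0 & moment al P <= 0].
  move=> [i0 ai0] h hm; exists al.
  have s0 : \sum_i al i = 0.
    by rewrite -[RHS](h ord0); apply: eq_bigr => i _; rewrite !mxE /= mulr1.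
  split=> //.
    apply: contrapT => /forallNP hn.
    have ge i : 0 <= al i by rewrite leNgt; apply/negP.
    have /eqP := s0; rewrite psumr_eq0 // => /allP/(_ i0 (mem_index_enum _)) /=.
    by rewrite (negPf ai0).
  apply: planeP; rewrite /bary summxE mxE.
    by rewrite -[RHS](h (lift ord0 ord0)); apply: eq_bigr => i _; rewrite !mxE /=.
  by rewrite -[RHS](h (lift ord0 (lift ord0 ord0))); apply: eq_bigr => i _; rewrite !mxE /=.
have [i vi] : exists i, v 0 i != 0.
  by apply/existsP; apply: contraNT v0; rewrite negb_exists => /forallP h;
    apply/eqP/rowP => i; rewrite mxE; apply/eqP; have := h i; rewrite negbK.
have [hm|hm] := leP (moment (v 0) P) 0.
  by apply: (main (v 0)) => //; exists i.
apply: (main (fun i => - v 0 i)).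
- by exists i; rewrite oppr_eq0.
- by move=> j; under eq_bigr do rewrite mulNr; rewrite sumrN col oppr0.
by rewrite /moment; under eq_bigr do rewrite mulNr; rewrite sumrN oppr_le0 ltW.
Qed.

(** Move the weights along an affine relation until one of them vanishes. Keeping
    the second moment under control is what allows a penalty to be carried
    along. *)
Lemma caratheodory (lam : 'I_4 -> R) (P : 'I_4 -> plane R) : weights lam ->
  exists (j : 'I_4) (lam' : 'I_3 -> R), [/\ weights lam',
    bary lam' (fun i => P (lift j i)) = bary lam P &
    moment lam' (fun i => P (lift j i)) <= moment lam P].
Proof.
move=> [l0 l1]; have [al [[i0 ai0] a1 aP am]] := affine_dependence P.
have [j aj jmin] : exists2 j, al j < 0 & forall i, al i < 0 -> lam j / - al j <= lam i / - al i.
  by case: (@arg_minP _ R _ i0 (fun i => al i < 0) (fun i => lam i / - al i) ai0) => j; exists j.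
pose s := lam j / - al j.
have s0 : 0 <= s by rewrite divr_ge0 // oppr_ge0 ltW.
pose mu i := lam i + s * al i.
have mu0 i : 0 <= mu i.
  rewrite /mu; have [ai|ai] := ltP (al i) 0; last by apply: addr_ge0; [exact: l0|exact: mulr_ge0].
  have := jmin i ai; rewrite -/s ler_pdivlMr ?oppr_gt0 //; lra.
have muj : mu j = 0 by rewrite /mu /s; field; rewrite lt_eqF.
have sumE (V : lmodType R) (F : 'I_4 -> V) :
    \sum_(i < 3) mu (lift j i) *: F (lift j i) = \sum_i lam i *: F i + s *: \sum_i al i *: F i.
  rewrite scaler_sumr -big_split /= (bigD1_ord j) //= -/(mu _).
  rewrite -[LHS]add0r; congr (_ + _).
    by rewrite scalerA -scalerDl -/(mu j) muj scale0r.
  apply: eq_bigr => i _; by rewrite /mu scalerDl scalerA.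
exists j, (fun i => mu (lift j i)); split.
- split=> //; have := sumE R^o (fun=> 1).
  rewrite (_ : \sum_(i < 3) _ = \sum_(i < 3) mu (lift j i)); last first.
    by apply: eq_bigr => i _; exact: mulr1.
  rewrite (_ : \sum_i lam i *: _ = \sum_i lam i); last by apply: eq_bigr => i _; exact: mulr1.
  rewrite (_ : \sum_i al i *: _ = \sum_i al i); last by apply: eq_bigr => i _; exact: mulr1.
  by rewrite a1 scaler0 addr0 l1.
- by rewrite /bary sumE [X in s *: X]aP scaler0 addr0.
have := sumE R^o (fun i => dot (P i) (P i)); rewrite /moment /= => h.
rewrite -[leLHS]/(\sum_(i < 3) mu (lift j i) *: (dot (P (lift j i)) (P (lift j i)) : R^o)) h.
by rewrite gerDl; apply: mulr_ge0_le0.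
Qed.

Lemma weights_pos n (lam : 'I_n -> R) : weights lam -> exists i, 0 < lam i.
Proof.
move=> [l0 l1]; apply: contrapT => /forallNP h.
have : \sum_i lam i = 0.
  by apply: big1 => i _; apply/eqP; rewrite eq_le l0 andbT leNgt; apply/negP.
by rewrite l1 => /eqP; rewrite oner_eq0.
Qed.

End Caratheodory.

(** * Existence of a minimal configuration *)

Section Minimiser.
Context {R : realType}.
Implicit Types (x w : plane R).

Lemma cvg_sum (V : normedModType R) (S : Type) (F : set_system S) (FF : Filter F) n
    (f : 'I_n -> S -> V) (l : 'I_n -> V) :
  (forall i, f i x @[x --> F] --> l i) -> \sum_i f i x @[x --> F] --> \sum_i l i.
Proof. by move=> h; apply: (cvg_big add_continuous). Qed.

(** Rows with entries in an arbitrary topological space, used for triples of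
    points of the plane. *)
Lemma coord_continuousT (S : topologicalType) n (i : 'I_n) :
  continuous (fun v : 'rV[S]_n => v ord0 i).
Proof.
move=> v B hB; exists (fun _ k => if k == i then B else setT).
  by move=> a k; case: eqP => [->|_]; [rewrite ord1|exact: filterT].
by move=> u /= /(_ ord0 i); rewrite eqxx.
Qed.

Lemma pair_continuous (S U V : topologicalType) (f : S -> U) (g : S -> V) :
  continuous f -> continuous g -> continuous (fun q => (f q, g q)).
Proof.
move=> cf cg q P [[A B] /= [hA hB] hAB].
have hf : nbhs q (f @^-1` A) := cf q A hA.
have hg : nbhs q (g @^-1` B) := cg q B hB.
by apply: filterS (filterI hf hg) => y [Ay By]; apply: hAB.
Qed.

(** A barycentre of three points of [F t] together with a point of [G t]. The
    bounds [M] and [M'] make the set of configurations compact; they turn out not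
    to be reached by the minimisers of interest. *)
Definition config (F G : R -> set (plane R)) (t1 t2 M M' t : R)
    (lam : 'I_3 -> R) (P : 'I_3 -> plane R) w :=
  [/\ t1 <= t <= t2, weights lam, forall i, F t (P i) /\ enorm (P i) <= M &
      G t w /\ enorm w <= M'].

(** The distance from the barycentre to [w], penalised at infinity by a term that
    is linear in the weights, and in time by [gam]. *)
Definition energy (eta gam t : R) (lam : 'I_3 -> R) (P : 'I_3 -> plane R) w :=
  enorm (w - bary lam P) + eta * moment lam P + gam * t.

Lemma minimiser_exists (F G : R -> set (plane R)) (t1 t2 M M' eta gam : R) t' lam' P' w' :
  closed [set q : R * plane R | t1 <= q.1 <= t2 /\ F q.1 q.2] ->
  closed [set q : R * plane R | t1 <= q.1 <= t2 /\ G q.1 q.2] ->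
  config F G t1 t2 M M' t' lam' P' w' ->
  exists t lam P w, config F G t1 t2 M M' t lam P w /\
    forall t' lam' P' w', config F G t1 t2 M M' t' lam' P' w' ->
      energy eta gam t lam P w <= energy eta gam t' lam' P' w'.
Proof.
move=> cF cG c'.
pose X := (R * plane R * ('rV[R]_3 * 'rV[plane R]_3))%type.
pose tt (q : X) := q.1.1; pose ww (q : X) := q.1.2.
pose ll (q : X) (i : 'I_3) := q.2.1 ord0 i; pose pp (q : X) (i : 'I_3) := q.2.2 ord0 i.
have c1 : continuous (fun q : X => q.1) by move=> q; exact: cvg_fst.
have c2 : continuous (fun q : X => q.2) by move=> q; exact: cvg_snd.
have ctt : continuous tt by move=> q; apply: (@continuous_comp _ _ _ (fun q : X => q.1) fst q (c1 q)); exact: cvg_fst.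
have cww : continuous ww by move=> q; apply: (@continuous_comp _ _ _ (fun q : X => q.1) snd q (c1 q)); exact: cvg_snd.
have cll i : continuous (ll^~ i).
  by move=> q; apply: (@continuous_comp _ _ _ (fun q : X => q.2.1) (fun v : 'rV[R]_3 => v ord0 i));
    [apply: (@continuous_comp _ _ _ (fun q : X => q.2) fst q (c2 q)); exact: cvg_fst|exact: coord_continuousT].
have cpp i : continuous (pp^~ i).
  by move=> q; apply: (@continuous_comp _ _ _ (fun q : X => q.2.2) (fun v : 'rV[plane R]_3 => v ord0 i));
    [apply: (@continuous_comp _ _ _ (fun q : X => q.2) snd q (c2 q)); exact: cvg_snd|exact: coord_continuousT].
have cdot (f : X -> plane R) : continuous f -> continuous (fun q => dot (f q) (f q)).
  move=> cf; have -> : (fun q => dot (f q) (f q)) = (fun q => enorm (f q) * enorm (f q)).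
    by apply/funext => q; rewrite -enorm2 expr2.
  have h : continuous (fun q => enorm (f q)).
    by move=> q'; apply: (@continuous_comp _ _ _ f (@enorm R)); [exact: cf|exact: enorm_continuous].
  by move=> q; apply: cvgM; exact: h.
pose K := [set q : X | config F G t1 t2 M M' (tt q) (ll q) (pp q) (ww q)].
have ccl (f : X -> R) : continuous f -> closed [set q | f q <= 0].
  move=> cf; have -> : [set q | f q <= 0] = f @^-1` [set x | x <= 0] by [].
  by apply: preimage_closed => [q _|]; [exact: cf|exact: closed_le].
have cnorm (f : X -> plane R) (m : R) : continuous f -> closed [set q | enorm (f q) <= m].
  move=> cf; have -> : [set q | enorm (f q) <= m] = [set q | enorm (f q) - m <= 0].
    by apply/seteqP; split => q /=; rewrite subr_le0.
  apply: ccl => q; apply: cvgB; last exact: cvg_cst.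
  by apply: (@continuous_comp _ _ _ f (@enorm R)); [exact: cf|exact: enorm_continuous].
have cst (H : R -> set (plane R)) (f : X -> plane R) :
    closed [set q : R * plane R | t1 <= q.1 <= t2 /\ H q.1 q.2] -> continuous f ->
    closed [set q : X | t1 <= tt q <= t2 /\ H (tt q) (f q)].
  move=> cH cf.
  have -> : [set q : X | t1 <= tt q <= t2 /\ H (tt q) (f q)] =
    (fun q => (tt q, f q)) @^-1` [set q : R * plane R | t1 <= q.1 <= t2 /\ H q.1 q.2] by [].
  apply: preimage_closed => // q _; exact: pair_continuous.
have KE : K = \bigcap_(i in [set: 'I_3]) ([set q | - ll q i <= 0] `&`
      [set q | t1 <= tt q <= t2 /\ F (tt q) (pp q i)] `&` [set q | enorm (pp q i) <= M]) `&`
    [set q | \sum_i ll q i - 1 <= 0] `&` [set q | 1 - \sum_i ll q i <= 0] `&`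
    [set q | t1 <= tt q <= t2 /\ G (tt q) (ww q)] `&` [set q | enorm (ww q) <= M'].
  apply/seteqP; split => q /=.
    move=> [ht [l0 l1] hp [hw1 hw2]]; rewrite l1 subrr; split=> //; split=> //; split=> //; split=> //.
    by move=> i _; have [h1 h2] := hp i; split=> //; split=> //=; rewrite oppr_le0.
  move=> [[[[hi s1] s2] [ht hw]] hw2]; split=> //.
    split; last by apply/eqP; rewrite eq_le; apply/andP; split; lra.
    by move=> i; have [[/= h _] _] := hi i I; rewrite oppr_le0 in h.
  by move=> i; have [[_ [_ h]] h2] := hi i I.
have csum : continuous (fun q => \sum_i ll q i).
  by move=> q; apply: cvg_sum => i; exact: cll.
have cK : compact K.
  pose B := (`[t1, t2]%classic `*` [set x : plane R | forall i, `[- M', M']%classic (x 0 i)]) `*`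
    ([set l : 'rV[R]_3 | forall i, `[0, 1]%classic (l ord0 i)] `*`
     [set p : 'rV[plane R]_3 | forall i, [set x : plane R | forall i, `[- M, M]%classic (x 0 i)] (p ord0 i)]).
  apply: (@subclosed_compact _ K B).
  - rewrite KE; apply: closedI; [apply: closedI; [apply: closedI; [apply: closedI|]|]|].
    + apply: closed_bigI => i _; apply: closedI; last exact: cnorm.
      by apply: closedI; [apply: ccl => q; apply: cvgN; exact: cll|exact: (cst F (pp^~ i))].
    + by apply: ccl => q; apply: cvgB; [exact: csum|exact: cvg_cst].
    + by apply: ccl => q; apply: cvgB; [exact: cvg_cst|exact: csum].
    + exact: (cst G ww).
    + exact: cnorm.
  - apply: compact_setX; apply: compact_setX.
    + exact: segment_compact.
    + exact: compact_box.
    + by apply: (@rV_compact R 3 (fun=> `[0, 1]%classic)) => i; exact: segment_compact.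
    + by apply: (@rV_compact (plane R) 3 (fun=> _)) => i; exact: compact_box.
  move=> q [ht [l0 l1] hp [_ hw]]; split; split => /=.
  - by rewrite /= in_itv.
  - exact: enorm_box.
  - move=> i; rewrite /= in_itv /= -/(ll q i) l0 /= -l1 (bigD1 i) //= lerDl.
    by apply: sumr_ge0 => k _; exact: l0.
  - by move=> i k; apply: enorm_box; exact: (hp i).2.
have [q + qmin] : exists2 q, q \in K & forall q', q' \in K ->
    energy eta gam (tt q) (ll q) (pp q) (ww q) <= energy eta gam (tt q') (ll q') (pp q') (ww q').
  pose en q := energy eta gam (tt q) (ll q) (pp q) (ww q).
  apply: (@compact_EVT_min X R en K) => //.
    exists ((t', w'), (\row_i lam' i, \row_i P' i)); rewrite /K /= /tt /ww /=.
    have -> : ll (t', w', (\row_i lam' i, \row_i P' i)) = lam' by apply/funext => i; rewrite /ll /= mxE.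
    by have -> : pp (t', w', (\row_i lam' i, \row_i P' i)) = P' by apply/funext => i; rewrite /pp /= mxE.
  apply: continuous_subspaceT => q; apply: cvgD.
    apply: cvgD.
      apply: (@continuous_comp _ _ _ (fun q => ww q - bary (ll q) (pp q)) (@enorm R)); last exact: enorm_continuous.
      apply: cvgB; first exact: cww.
      by apply: cvg_sum => i; apply: cvgZ; [exact: cll|exact: cpp].
    apply: cvgM; first exact: cvg_cst.
    apply: cvg_sum => i; apply: cvgM; first exact: cll.
    exact: (cdot _ (cpp i)).
  by apply: cvgM; [exact: cvg_cst|exact: ctt].
rewrite inE => Kq; exists (tt q), (ll q), (pp q), (ww q); split=> //.
move=> s la Q y cs.
have := qmin ((s, y), (\row_i la i, \row_i Q i)); rewrite inE /K /= /tt /ww /=.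
have -> : ll (s, y, (\row_i la i, \row_i Q i)) = la by apply/funext => i; rewrite /ll /= mxE.
have -> : pp (s, y, (\row_i la i, \row_i Q i)) = Q by apply/funext => i; rewrite /pp /= mxE.
exact.
Qed.

End Minimiser.

(** * Geometry of a minimal configuration *)

Section Stationary.
Context {R : realType}.
Variables (A B : set (plane R)) (r M M' eta d om : R).
Variables (lam : 'I_3 -> R) (P : 'I_3 -> plane R) (w n : plane R).
Implicit Types (x : plane R).

Let z := bary lam P.
Let S := moment lam P.

(** The distance [x] in the energy is replaced by [x ^+ 2 / (2 * d) + d / 2],
    which dominates it and agrees with it at [x = d]. A minimal configuration at
    distance [d] therefore minimises this polynomial as well, and its variations
    can be computed exactly. *)
Definition quad_energy (lam' : 'I_3 -> R) (P' : 'I_3 -> plane R) w' : R :=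
  enorm (w' - bary lam' P') ^+ 2 / (2 * d) + eta * moment lam' P'.

Hypotheses (r0 : 0 < r) (eta0 : 0 < eta) (d0 : 0 < d).
Hypotheses (dir_unit : enorm n = 1) (dirE : w - z = d *: n).
Hypothesis lamw : weights lam.
Hypothesis atoms_pos : forall i, exists2 j, 0 < lam j & P i = P j.
Hypothesis PA : forall i, closure A (P i).
Hypothesis PM : forall i, enorm (P i) <= M.
Hypothesis wB : closure (~` B) w.
Hypothesis min : forall lam' P' w', weights lam' ->
  (forall i, closure A (P' i) /\ enorm (P' i) <= M) ->
  closure (~` B) w' -> enorm w' <= M' ->
  d / 2 + eta * S <= quad_energy lam' P' w'.
Hypothesis wM : enorm w < M'.

Let gbar := eta * S - dot n z.
Hypothesis om0 : 1 / 2 <= om.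
Hypothesis om2 : om <= 2.
Hypothesis omE : om ^+ 2 = 1 + 4 * eta * gbar.
Hypothesis etar : eta * (4 * r) <= 1.
Hypothesis MM : 2 <= eta * M.

Lemma gap_vector_norm : enorm (w - z) = d.
Proof. by rewrite dirE enormZ dir_unit mulr1 gtr0_norm. Qed.

(** The exact expansion: its linear part shows that the atom [P i] feels the force
    [n - (2 * eta) *: P i], which will be normal to the boundary. *)
Lemma quad_energy_move (D : 'I_3 -> plane R) dw :
  quad_energy lam (fun i => P i + D i) (w + dw) =
  d / 2 + eta * S + (dot n dw - \sum_i lam i * dot (n - (2 * eta) *: P i) (D i)) +
  enorm (dw - bary lam D) ^+ 2 / (2 * d) + eta * moment lam D.
Proof.
have bE : bary lam (fun i => P i + D i) = z + bary lam D.
  by rewrite /bary -big_split /=; apply: eq_bigr => i _; rewrite scalerDr.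
have mE : moment lam (fun i => P i + D i) = S + 2 * \sum_i lam i * dot (P i) (D i) + moment lam D.
  rewrite /moment mulr_sumr -!big_split /=; apply: eq_bigr => i _.
  by rewrite !dot_linE (dotC (D i)); ring.
have lE : \sum_i lam i * dot (n - (2 * eta) *: P i) (D i) =
    dot n (bary lam D) - 2 * eta * \sum_i lam i * dot (P i) (D i).
  rewrite (dotC n) /bary dot_suml mulr_sumr -sumrB; apply: eq_bigr => i _.
  by rewrite dotBl !dotZl (dotC (D i)); ring.
rewrite /quad_energy bE mE lE.
have -> : w + dw - (z + bary lam D) = d *: n + (dw - bary lam D).
  by rewrite -dirE; apply: planeP; rewrite !mxE; ring.
rewrite (enorm2D (d *: n)) enormZ gtr0_norm // dir_unit dotZl dotBr; field; rewrite gt_eqF //.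
Qed.

Lemma small_quadratic (a b : R) :
  (forall s, 0 < s <= 1 -> 0 <= s * a + s ^+ 2 * b) -> 0 <= a.
Proof.
move=> h; rewrite leNgt; apply/negP => a0.
pose s := Num.min 1 (- a / (2 * (`|b| + 1))).
have b0 := normr_ge0 b.
have s0 : 0 < s by rewrite lt_min ltr01 divr_gt0 ?oppr_gt0 //; lra.
have s1 : s <= 1 by rewrite ge_min lexx.
have sb : s * (2 * (`|b| + 1)) <= - a.
  by rewrite -ler_pdivlMr; [rewrite ge_min lexx orbT|lra].
have := h s; rewrite s0 s1 => /(_ isT).
rewrite expr2 -mulrA -mulrDr pmulr_rge0 // => h1.
have : s * b <= s * `|b| by rewrite ler_pM2l // ler_norm.
lra.
Qed.

(** Give a small weight [s] to the point [x]. The barycentre then has four atoms,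
    one of which is removed without increasing the penalty; the derivative at
    [s = 0] is the asserted inequality. Here the penalty has to be linear in the
    weights. *)
Lemma cost_lower_bound x : closure A x -> enorm x <= M ->
  gbar <= eta * dot x x - dot n x.
Proof.
move=> Ax Mx; rewrite -subr_ge0.
apply: (@small_quadratic _ (enorm (x - z) ^+ 2 / (2 * d))) => s /andP[s0 s1].
pose lam4 (i : 'I_4) := if unlift ord0 i is Some k then (1 - s) * lam k else s.
pose P4 (i : 'I_4) := if unlift ord0 i is Some k then P k else x.
have w4 : weights lam4.
  split=> [i|].
    rewrite /lam4; case: unlift => [k|]; last exact: ltW.
    by rewrite mulr_ge0 ?lamw.1 // subr_ge0.
  rewrite big_ord_recl /lam4 unlift_none.
  under eq_bigr do rewrite liftK.
  by rewrite -mulr_sumr lamw.2; ring.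
have [j [lam' [w' b' m']]] := caratheodory P4 w4.
have b4 : bary lam4 P4 = z + s *: (x - z).
  rewrite /bary big_ord_recl /lam4 /P4 unlift_none.
  under eq_bigr do rewrite liftK -scalerA.
  rewrite -scaler_sumr -/(bary lam P) -/z.
  by apply: planeP; rewrite !mxE; ring.
have m4 : moment lam4 P4 = (1 - s) * S + s * dot x x.
  rewrite /moment big_ord_recl /lam4 /P4 unlift_none.
  under eq_bigr do rewrite liftK -mulrA.
  by rewrite -mulr_sumr -/(moment lam P) -/S addrC.
have h4 i : closure A (P4 i) /\ enorm (P4 i) <= M.
  by rewrite /P4; case: unlift => [k|]; split.
have := min w' (fun i => h4 (lift j i)) wB (ltW wM).
rewrite /quad_energy b' b4 opprD addrA enorm2B gap_vector_norm dotZr dirE dotZl enormZ dotBr.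
rewrite exprMn gtr0_norm // => h1.
have h2 : eta * moment lam' (fun i => P4 (lift j i)) <= eta * ((1 - s) * S + s * dot x x).
  by rewrite ler_pM2l // -m4.
have e1 : (d ^+ 2 - 2 * (s * (d * (dot n x - dot n z))) + s ^+ 2 * enorm (x - z) ^+ 2) / (2 * d) =
  d / 2 - s * (dot n x - dot n z) + s ^+ 2 * (enorm (x - z) ^+ 2 / (2 * d)).
  by field; rewrite gt_eqF.
rewrite e1 in h1; rewrite /gbar; lra.
Qed.

Lemma cost_mean : \sum_i lam i * (eta * dot (P i) (P i) - dot n (P i)) = gbar.
Proof.
under eq_bigr do rewrite mulrBr.
rewrite sumrB /gbar /S /moment mulr_sumr (dotC n) /z /bary dot_suml.
by congr (_ - _); apply: eq_bigr => i _; rewrite ?dotZl ?(dotC n) //; ring.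
Qed.

(** The costs of the atoms are at least [gbar] and have mean [gbar]. *)
Lemma cost_atom i : eta * dot (P i) (P i) - dot n (P i) = gbar.
Proof.
have [j lj ->] := atoms_pos i.
have : \sum_i lam i * (eta * dot (P i) (P i) - dot n (P i) - gbar) = 0.
  under eq_bigr do rewrite mulrBr.
  by rewrite sumrB cost_mean -mulr_suml lamw.2 mul1r subrr.
move/eqP; rewrite psumr_eq0; last first.
  by move=> k _; rewrite mulr_ge0 ?lamw.1 // subr_ge0 cost_lower_bound.
move/allP/(_ j (mem_index_enum _)); rewrite /= mulf_eq0 gt_eqF //=.
by rewrite subr_eq0 => /eqP.
Qed.

(** The level set of the cost through the atoms is a circle about this point. The
    set lies outside, so that the disc, of radius close to [1 / (2 * eta)],
    replaces the supporting half-plane of the unpenalised problem. *)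
Definition disc_centre : plane R := (2 * eta)^-1 *: n.
Let c := disc_centre.
Let rho := om / (2 * eta).

Lemma dist_centre x : enorm (x - c) ^+ 2 = (eta * dot x x - dot n x) / eta + (2 * eta)^-2.
Proof.
rewrite enorm2B enormZ dir_unit mulr1 gtr0_norm ?invr_gt0 ?mulr_gt0 //.
by rewrite dotZr enorm2 (dotC x n) -exprVn; field; rewrite gt_eqF.
Qed.

Lemma rho2 : rho ^+ 2 = gbar / eta + (2 * eta)^-2.
Proof. by rewrite /rho expr_div_n omE -exprVn; field; rewrite gt_eqF. Qed.

Lemma rho_gt0 : 0 < rho.
Proof. by have h := om0; rewrite divr_gt0 ?mulr_gt0 //; lra. Qed.

Lemma rho_ge : r <= rho.
Proof.
have h1 := om0; have h2 := etar; rewrite /rho ler_pdivlMr ?mulr_gt0 //; lra.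
Qed.

Lemma atom_on_circle i : enorm (P i - c) = rho.
Proof.
apply/eqP; rewrite -(eqrXn2 (n := 2)) ?enorm_ge0 ?(ltW rho_gt0) //.
by rewrite dist_centre cost_atom rho2.
Qed.

Lemma phase_off_disc x : closure A x -> enorm x <= M -> rho <= enorm (x - c).
Proof.
move=> Ax Mx; rewrite -ler_sqr ?nnegrE ?enorm_ge0 ?(ltW rho_gt0) //.
by rewrite dist_centre rho2 lerD2r ler_pM2r ?invr_gt0 // cost_lower_bound.
Qed.

Lemma atom_bound i : eta * enorm (P i) <= 3 / 2.
Proof.
have := ler_enormD (P i - c) c; rewrite subrK atom_on_circle enormZ dir_unit mulr1.
rewrite gtr0_norm ?invr_gt0 ?mulr_gt0 // => h.
have : eta * enorm (P i) <= eta * (rho + (2 * eta)^-1) by rewrite ler_pM2l.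
have -> : eta * (rho + (2 * eta)^-1) = (om + 1) / 2 by rewrite /rho; field; rewrite gt_eqF.
have h2 := om2; lra.
Qed.

Lemma ball_bound i x : enorm (x - P i) < 2 * r -> enorm x <= M.
Proof.
move=> hx; rewrite -(ler_pM2l eta0).
have := ler_enormD (x - P i) (P i); rewrite subrK => h.
have : eta * enorm x <= eta * (enorm (x - P i) + enorm (P i)) by rewrite ler_pM2l.
have : eta * enorm (x - P i) < eta * (2 * r) by rewrite ltr_pM2l.
have := atom_bound i; have h1 := MM; have h2 := etar; lra.
Qed.

Lemma atom_nearest i : nearest (closure A) (P i) c.
Proof.
split=> //; first by rewrite -subr_eq0 -enorm_eq0 atom_on_circle gt_eqF ?rho_gt0.
exists (2 * r); first by rewrite mulr_gt0.
by move=> x Ax /ball_bound xM; rewrite atom_on_circle; exact: phase_off_disc.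
Qed.

Lemma atom_kappa i : is_regular A (P i) ->
  kappa_plus r A (P i) = curvature A (P i) / 2 + (2 * r)^-1.
Proof.
move=> rg; have [||_ ->//] := kappa_plus_contact (c := c) r0 rg (@PA i).
  by rewrite atom_on_circle rho_ge.
by move=> x Ax /ball_bound xM; rewrite atom_on_circle; exact: phase_off_disc.
Qed.

Lemma atom_normal i : is_regular A (P i) ->
  om *: normal A (P i) = n - (2 * eta) *: P i.
Proof.
have om_gt0 : 0 < om by have h := om0; lra.
move=> rg; have -> := nearest_normal (b := true) rg (atom_nearest i).
rewrite atom_on_circle scalerA /bsign.
have -> : om * (1 / rho) = 2 * eta by rewrite /rho; field; rewrite !gt_eqF.
by rewrite scalerBr /c /disc_centre scalerA divff ?scale1r // gt_eqF // mulr_gt0.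
Qed.

Lemma exterior_nearest : nearest (closure (~` B)) w z.
Proof.
split=> //; first by rewrite -subr_eq0 -enorm_eq0 gap_vector_norm gt_eqF.
exists (M' - enorm w); first by rewrite subr_gt0.
move=> y yB hy; have yM : enorm y <= M'.
  have := ler_enormD (y - w) w; rewrite subrK; lra.
have := min lamw (fun i => conj (@PA i) (PM i)) yB yM.
rewrite /quad_energy -/z -/S lerD2r ler_pdivlMr ?mulr_gt0 // => h.
rewrite gap_vector_norm -ler_sqr ?nnegrE ?enorm_ge0 ?(ltW d0) //.
by apply: le_trans (_ : d ^+ 2 <= d / 2 * (2 * d)) h; rewrite le_eqVlt; apply/orP; left; apply/eqP; field.
Qed.

Lemma exterior_normal : is_regular B w -> normal B w = n.
Proof.
move=> rg; have -> := nearest_normal (b := false) rg exterior_nearest.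
by rewrite gap_vector_norm /bsign mulN1r scaleNr -scalerN opprB dirE scalerA mulVf ?scale1r ?gt_eqF.
Qed.

(** Without penalty all the normals [nu i] are equal to [n]. *)
Lemma atoms_mean_defect (nu : 'I_3 -> plane R) :
  (forall i, om *: nu i = n - (2 * eta) *: P i) ->
  om * enorm (n - bary lam nu) <= `|om - 1| + 2 * eta * enorm z.
Proof.
have om_gt0 : 0 < om by have h := om0; lra.
move=> hnu.
have -> : om * enorm (n - bary lam nu) = enorm ((om - 1) *: n + (2 * eta) *: z).
  rewrite -[X in X * _](gtr0_norm om_gt0) -enormZ.
  congr enorm; rewrite scalerBr /bary scaler_sumr.
  have -> : \sum_i om *: (lam i *: nu i) = n - (2 * eta) *: z.
    under eq_bigr do rewrite scalerA mulrC -scalerA hnu scalerBr scalerA mulrC -scalerA.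
    by rewrite sumrB -scaler_suml lamw.2 scale1r -scaler_sumr.
  by rewrite opprB scalerBl scale1r addrA addrAC.
apply: le_trans (ler_enormD _ _) _.
by rewrite !enormZ dir_unit mulr1 [`|2 * eta|]gtr0_norm // mulr_gt0.
Qed.

(** Move every atom and [w] along their boundaries, all by the distance [s] along
    the respective tangent lines: the first-order term vanishes, hence the
    second-order term is nonnegative. *)
Lemma space_inequality (nu : 'I_3 -> plane R) (q : 'I_3 -> R -> R) (qw : R -> R)
    (k : 'I_3 -> R) (kw : R) :
  (forall i, enorm (nu i) = 1) ->
  (forall i, om *: nu i = n - (2 * eta) *: P i) ->
  (forall i, q i s @[s --> 0^'+] --> k i) -> qw s @[s --> 0^'+] --> kw ->
  (\forall s \near 0^'+, d / 2 + eta * S <= quad_energy lam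
    (fun i => P i + (s *: perp (nu i) + (s ^+ 2 * q i s) *: nu i))
    (w + (s *: perp n + (s ^+ 2 * qw s) *: n))) ->
  0 <= kw - om * (\sum_i lam i * k i) + enorm (n - bary lam nu) ^+ 2 / (2 * d) + eta.
Proof.
move=> nu1 nuE hq hqw hmin.
have s0 : (fun s : R => s) @ 0^'+ --> (0 : R) by exact: cvg_at_right_filter.
pose V s := (perp n - bary lam (fun i => perp (nu i))) +
   s *: (qw s *: n - \sum_i (lam i * q i s) *: nu i).
have Vl : V s @[s --> 0^'+] --> (perp n - bary lam (fun i => perp (nu i))) +
    0 *: (kw *: n - \sum_i (lam i * k i) *: nu i).
  apply: cvgD; first exact: cvg_cst.
  apply: cvgZ => //; apply: cvgB; first exact: cvgZr_tmp.
  by apply: cvg_sum => i; apply: cvgZr_tmp; apply: cvgM => //; exact: cvg_cst.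
have eV : enorm (V s) @[s --> 0^'+] --> enorm (n - bary lam nu).
  have -> : enorm (n - bary lam nu) = enorm ((perp n - bary lam (fun i => perp (nu i))) +
    0 *: (kw *: n - \sum_i (lam i * k i) *: nu i)).
    rewrite scale0r addr0 -(enorm_perp (n - _)) perpD perpN /bary perp_sum.
    by congr (enorm (_ - _)); apply: eq_bigr => i _; rewrite perpZ.
  by apply: (cvg_comp _ _ Vl); exact: enorm_continuous.
pose m s := \sum_i lam i * (1 + s ^+ 2 * q i s ^+ 2).
have ml : m s @[s --> 0^'+] --> (1 : R).
  have -> : (1 : R) = \sum_i lam i * (1 + 0 ^+ 2 * k i ^+ 2).
    transitivity (\sum_i lam i); first by rewrite lamw.2.
    by apply: eq_bigr => i _; ring.
  apply: cvg_sum => i; apply: cvgM; first exact: cvg_cst.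
  apply: cvgD; first exact: cvg_cst.
  by apply: cvgM; rewrite ?expr2; apply: cvgM.
have lim : (fun s => qw s - om * (\sum_i lam i * q i s) + enorm (V s) ^+ 2 / (2 * d) + eta * m s)
   @ 0^'+ --> kw - om * (\sum_i lam i * k i) + enorm (n - bary lam nu) ^+ 2 / (2 * d) + eta * 1.
  apply: cvgD; last by apply: cvgM => //; exact: cvg_cst.
  apply: cvgD; last by apply: cvgM; [rewrite expr2; apply: cvgM|exact: cvg_cst].
  apply: cvgB => //; apply: cvgM; first exact: cvg_cst.
  by apply: cvg_sum => i; apply: cvgM => //; exact: cvg_cst.
rewrite -[X in _ + X]mulr1; apply: (cvgr_to_ge lim).
near=> s; have sp : 0 < s by near: s; exact: nbhs_right_gt.
have : d / 2 + eta * S <= quad_energy lam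
    (fun i => P i + (s *: perp (nu i) + (s ^+ 2 * q i s) *: nu i))
    (w + (s *: perp n + (s ^+ 2 * qw s) *: n)) by near: s.
rewrite quad_energy_move.
have -> : dot n (s *: perp n + (s ^+ 2 * qw s) *: n) = s ^+ 2 * qw s.
  by rewrite dotDr !dotZr dot_perpr (unit_dot dir_unit); ring.
have -> : \sum_i lam i * dot (n - (2 * eta) *: P i) (s *: perp (nu i) + (s ^+ 2 * q i s) *: nu i)
    = s ^+ 2 * (om * \sum_i lam i * q i s).
  rewrite !mulr_sumr; apply: eq_bigr => i _.
  rewrite -nuE dotZl dotDr !dotZr dot_perpr (unit_dot (nu1 i)). ring.
have -> : s *: perp n + (s ^+ 2 * qw s) *: n -
    bary lam (fun i => s *: perp (nu i) + (s ^+ 2 * q i s) *: nu i) = s *: V s.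
  have -> : bary lam (fun i => s *: perp (nu i) + (s ^+ 2 * q i s) *: nu i) =
      s *: bary lam (fun i => perp (nu i)) + s ^+ 2 *: \sum_i (lam i * q i s) *: nu i.
    rewrite /bary !scaler_sumr -big_split /=; apply: eq_bigr => i _.
    by rewrite scalerDr !scalerA; congr (_ *: _ + _ *: _); ring.
  rewrite /V; move: (bary lam _) (\sum_i _) (perp n) => X Y N.
  by apply: planeP; rewrite !mxE; ring.
rewrite enormZ exprMn gtr0_norm //.
have -> : moment lam (fun i => s *: perp (nu i) + (s ^+ 2 * q i s) *: nu i) = s ^+ 2 * m s.
  rewrite /moment /m mulr_sumr; apply: eq_bigr => i _.
  by rewrite -enorm2 frame_norm //; ring.
move=> h; have s20 : 0 < s ^+ 2 by rewrite exprn_gt0.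
rewrite -(pmulr_rge0 _ s20).
have -> : s ^+ 2 * (qw s - om * (\sum_i lam i * q i s) + enorm (V s) ^+ 2 / (2 * d) + eta * m s) =
  (s ^+ 2 * qw s - s ^+ 2 * (om * \sum_i lam i * q i s)) + s ^+ 2 * enorm (V s) ^+ 2 / (2 * d) +
  eta * (s ^+ 2 * m s) by ring.
lra.
Unshelve. all: by end_near.
Qed.

(** Follow every atom and [w] backwards in time along their normals. *)
Lemma time_inequality (gam : R) (nu : 'I_3 -> plane R) (q : 'I_3 -> R -> R) (qw : R -> R)
    (k : 'I_3 -> R) (kw : R) :
  (forall i, enorm (nu i) = 1) ->
  (forall i, om *: nu i = n - (2 * eta) *: P i) ->
  (forall i, q i s @[s --> 0^'+] --> k i) -> qw s @[s --> 0^'+] --> kw ->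
  (\forall s \near 0^'+, d / 2 + eta * S + gam * s <= quad_energy lam
    (fun i => P i + (s * q i s) *: nu i) (w + (s * qw s) *: n)) ->
  gam <= kw - om * (\sum_i lam i * k i).
Proof.
move=> nu1 nuE hq hqw hmin.
have s0 : (fun s : R => s) @ 0^'+ --> (0 : R) by exact: cvg_at_right_filter.
pose V s := qw s *: n - \sum_i (lam i * q i s) *: nu i.
have Vl : V s @[s --> 0^'+] --> kw *: n - \sum_i (lam i * k i) *: nu i.
  apply: cvgB; first exact: cvgZr_tmp.
  by apply: cvg_sum => i; apply: cvgZr_tmp; apply: cvgM => //; exact: cvg_cst.
set Vk := (X in _ --> X) in Vl.
have eV : enorm (V s) @[s --> 0^'+] --> enorm Vk.
  by apply: (cvg_comp _ _ Vl); exact: enorm_continuous.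
pose m s := \sum_i lam i * q i s ^+ 2.
have ml : m s @[s --> 0^'+] --> \sum_i lam i * k i ^+ 2.
  apply: cvg_sum => i; apply: cvgM; first exact: cvg_cst.
  by rewrite expr2; apply: cvgM.
have lim : (fun s => qw s - om * (\sum_i lam i * q i s) +
      s * (enorm (V s) ^+ 2 / (2 * d) + eta * m s))
   @ 0^'+ --> kw - om * (\sum_i lam i * k i) +
      0 * (enorm Vk ^+ 2 / (2 * d) + eta * \sum_i lam i * k i ^+ 2).
  apply: cvgD.
    apply: cvgB => //; apply: cvgM; first exact: cvg_cst.
    by apply: cvg_sum => i; apply: cvgM => //; exact: cvg_cst.
  apply: cvgM => //; apply: cvgD; last by apply: cvgM => //; exact: cvg_cst.
  by apply: cvgM; [rewrite expr2; apply: cvgM|exact: cvg_cst].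
rewrite -[leRHS]addr0 -[X in _ + X](mul0r (enorm Vk ^+ 2 / (2 * d) + eta * \sum_i lam i * k i ^+ 2)).
apply: (cvgr_to_ge lim).
near=> s; have sp : 0 < s by near: s; exact: nbhs_right_gt.
have : d / 2 + eta * S + gam * s <= quad_energy lam
    (fun i => P i + (s * q i s) *: nu i) (w + (s * qw s) *: n) by near: s.
rewrite quad_energy_move dotZr (unit_dot dir_unit).
have -> : \sum_i lam i * dot (n - (2 * eta) *: P i) ((s * q i s) *: nu i)
    = s * (om * \sum_i lam i * q i s).
  rewrite !mulr_sumr; apply: eq_bigr => i _.
  by rewrite -nuE dotZl !dotZr (unit_dot (nu1 i)); ring.
have -> : (s * qw s) *: n - bary lam (fun i => (s * q i s) *: nu i) = s *: V s.
  rewrite /V scalerBr scalerA /bary scaler_sumr; congr (_ - _).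
  by apply: eq_bigr => i _; rewrite !scalerA; congr (_ *: _); ring.
rewrite enormZ exprMn gtr0_norm //.
have -> : moment lam (fun i => (s * q i s) *: nu i) = s ^+ 2 * m s.
  rewrite /moment /m mulr_sumr; apply: eq_bigr => i _.
  by rewrite dotZl dotZr (unit_dot (nu1 i)); ring.
move=> h; rewrite -(ler_pM2l sp).
have -> : s * (qw s - om * (\sum_i lam i * q i s) +
    s * (enorm (V s) ^+ 2 / (2 * d) + eta * m s)) =
  (s * qw s - s * (om * \sum_i lam i * q i s)) + s ^+ 2 * enorm (V s) ^+ 2 / (2 * d) +
  eta * (s ^+ 2 * m s) by ring.
lra.
Unshelve. all: by end_near.
Qed.

End Stationary.

(** * No minimal configuration at a positive time *)

Section StationaryFlow.
Context {R : realType}.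
Variables (r : R) (T : \bar R) (E : R -> set (plane R)).
Hypotheses (r_gt0 : 0 < r) (smoothE : smooth_evolution T E) (flowE : curvature_flow r T E).
Hypothesis km0 : forall t x, lifespan T t -> kappa_minus r (E t) x = 0.
Implicit Types (v x y z p c nu : plane R) (M a s q : R).

(** The variance of the atoms is nonnegative. *)
Lemma jensen n (lam : 'I_n -> R) (P : 'I_n -> plane R) : weights lam ->
  enorm (bary lam P) ^+ 2 <= moment lam P.
Proof.
move=> [l0 l1]; set z := bary lam P; rewrite -subr_ge0.
have -> : moment lam P - enorm z ^+ 2 = \sum_i lam i * enorm (P i - z) ^+ 2.
  have -> : \sum_i lam i * enorm (P i - z) ^+ 2 =
      moment lam P - 2 * dot z z + (\sum_i lam i) * enorm z ^+ 2.
    have -> : dot z z = \sum_i lam i * dot (P i) z.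
      by rewrite {1}/z /bary dot_suml; apply: eq_bigr => i _; rewrite dotZl.
    rewrite /moment mulr_sumr mulr_suml -sumrB -big_split /=; apply: eq_bigr => i _.
    by rewrite enorm2B -enorm2; ring.
  by rewrite l1 enorm2; ring.
by apply: sumr_ge0 => i _; rewrite mulr_ge0 ?l0 ?sqr_ge0.
Qed.

Lemma bary_bound n (lam : 'I_n -> R) (P : 'I_n -> plane R) M : weights lam ->
  (forall i, enorm (P i) <= M) -> enorm (bary lam P) <= M.
Proof.
move=> [l0 l1] hP; apply: le_trans (_ : \sum_i lam i * M <= _); last first.
  by rewrite -mulr_suml l1 mul1r.
rewrite /bary; elim/big_ind2: _ => //; first by rewrite enorm0.
  by move=> x a y b h1 h2; apply: le_trans (ler_enormD _ _) _; rewrite lerD.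
by move=> i _; rewrite enormZ ger0_norm // ler_wpM2l.
Qed.

(** The arithmetic of the contradiction: all errors are multiples of [h], where
    [eta] is at most [h], while [gam] is fixed. Here [kw] is the curvature at [w],
    [- K] the mean of the halved curvatures at the atoms, [D] the defect of the
    normals, and [Z] the norm of the barycentre. *)
Lemma velocity_contradiction (h g gam d om eta D Z kw K : R) :
  0 < h -> h <= 1 -> 0 < g -> 0 < r -> g / 2 <= d -> 1 / 2 <= om ->
  `|om - 1| <= 8 * (h * (1 + g)) -> om * D <= `|om - 1| + 2 * eta * Z ->
  eta * Z <= h * (1 + g) -> 0 <= D -> eta <= h ->
  0 <= - (kw / 2) - om * K + D ^+ 2 / (2 * d) + eta ->
  gam <= kw / 2 + (2 * r)^-1 - om * (- K + (2 * r)^-1) ->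
  h * (400 * (1 + g) ^+ 2 / g + 1 + 4 * (1 + g) / r) < gam -> False.
Proof.
move=> h0 h1 g0 rp dg omh om1 defect hz D0 etah space_est time_est hgam.
set G := 1 + g in om1 hz hgam.
have hG0 : 0 <= h * G by rewrite mulr_ge0 ?(ltW h0) // /G; lra.
clearbody G.
have D20 : D <= 20 * (h * G).
  have : 1 / 2 * D <= om * D by rewrite ler_wpM2r.
  lra.
have DD : D ^+ 2 / (2 * d) <= h * (400 * G ^+ 2 / g).
  apply: le_trans (_ : D ^+ 2 / g <= _).
    by rewrite ler_wpM2l ?sqr_ge0 // lef_pV2 ?posrE; lra.
  have -> : h * (400 * G ^+ 2 / g) = h * (400 * G ^+ 2) / g by rewrite !mulrA.
  rewrite ler_wpM2r ?invr_ge0 ?(ltW g0) //.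
  apply: le_trans (_ : (20 * (h * G)) ^+ 2 <= _).
    by rewrite ler_sqr ?nnegrE // mulr_ge0.
  have -> : (20 * (h * G)) ^+ 2 = h * (h * (400 * G ^+ 2)) by ring.
  have G2 : 0 <= 400 * G ^+ 2 by have := sqr_ge0 G; lra.
  by rewrite ler_pM2l // ler_piMl.
have omr : (1 - om) * (2 * r)^-1 <= h * (4 * G / r).
  have -> : h * (4 * G / r) = 8 * (h * G) * (2 * r)^-1 by field; rewrite gt_eqF.
  rewrite ler_wpM2r ?invr_ge0 ?mulr_ge0 // ?(ltW rp) //.
  by move: om1; rewrite ler_norml => /andP[]; lra.
rewrite mulrDr mulrN in time_est; rewrite !mulrDr mulr1 in hgam.
rewrite mulrBl mul1r in omr; lra.
Qed.

(** The bounds [h ^+ 2 * S < g] on the penalty and [Z ^+ 2 <= S] only say that the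
    barycentre, at distance [Z] from the origin, is [O(1 / h)]. This suffices for
    [om], the ratio of the radius of the supporting circle to [1 / (2 * h ^+ 2)],
    to be [1 + O(h)]. *)
Lemma circle_radius (h g S Z b : R) :
  0 < h -> h <= 1 -> 0 < g -> 0 <= S -> h ^+ 2 * S < g -> Z ^+ 2 <= S -> 0 <= Z ->
  `|b| <= Z -> h * (16 * (1 + g)) <= 1 ->
  h * Z <= 1 + g /\ exists om, [/\ om ^+ 2 = 1 + 4 * h ^+ 2 * (h ^+ 2 * S - b),
    1 / 2 <= om, om <= 2 & `|om - 1| <= 8 * (h * (1 + g))].
Proof.
move=> h0 h1 g0 S0 Sg ZS Z0 bZ hG.
have hz : h * Z <= 1 + g.
  rewrite -ler_sqr ?nnegrE ?mulr_ge0 ?(ltW h0) //; last lra.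
  rewrite exprMn; apply: le_trans (_ : h ^+ 2 * S <= _).
    by rewrite ler_pM2l ?exprn_gt0.
  by apply: le_trans (ltW Sg) _; rewrite expr2; nra.
split=> //.
have hGl : 16 * (h * (1 + g)) <= 1 by lra.
have hb : `|h ^+ 2 * b| <= h * (1 + g).
  rewrite normrM gtr0_norm ?exprn_gt0 // expr2 -mulrA ler_pM2l //.
  by apply: le_trans hz; rewrite ler_pM2l.
have hS0 : 0 <= h ^+ 2 * (h ^+ 2 * S).
  by apply: mulr_ge0; [exact: sqr_ge0|apply: mulr_ge0 => //; exact: sqr_ge0].
have hS : h ^+ 2 * (h ^+ 2 * S) <= h * (1 + g).
  apply: le_trans (_ : h ^+ 2 * (1 + g) <= _).
    by rewrite ler_pM2l ?exprn_gt0 //; lra.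
  rewrite ler_wpM2r //; first lra.
  by rewrite expr2 ger_pMl.
move: hb; rewrite ler_norml => /andP[b1 b2].
pose X := 1 + 4 * h ^+ 2 * (h ^+ 2 * S - b).
have XE : X = 1 + 4 * (h ^+ 2 * (h ^+ 2 * S)) - 4 * (h ^+ 2 * b) by rewrite /X; ring.
have [x1 x2] : 1 - 8 * (h * (1 + g)) <= X /\ X <= 1 + 8 * (h * (1 + g)).
  by rewrite XE; split; lra.
exists (Num.sqrt X); rewrite -/X; have sX : Num.sqrt X ^+ 2 = X by rewrite sqr_sqrtr //; lra.
have := sqrtr_ge0 X; set om := Num.sqrt X in sX * => om_ge0; clearbody X.
have omh : 1 / 2 <= om by rewrite -ler_sqr ?nnegrE ?divr_ge0 // sX; lra.
split=> //; first by rewrite -ler_sqr ?nnegrE // sX; lra.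
have e : om ^+ 2 - 1 = (om - 1) * (om + 1) by ring.
by rewrite ler_norml; apply/andP; split; nra.
Qed.

Lemma time_step_bound x v M a : enorm v = 1 -> `|a| < M - enorm x ->
  enorm (x + a *: v) <= M.
Proof.
by move=> v1 h; apply: le_trans (ler_enormD _ _) _; rewrite enormZ v1 mulr1; lra.
Qed.

Lemma space_step_bound x v M s q : enorm v = 1 -> 0 < s -> s < 1 ->
  s < (M - enorm x) / 2 -> `|s * q| < (M - enorm x) / 2 ->
  enorm (x + (s *: perp v + (s ^+ 2 * q) *: v)) <= M.
Proof.
move=> v1 s0 s1 sa sqa; apply: le_trans (ler_enormD _ _) _.
have : enorm (s *: perp v + (s ^+ 2 * q) *: v) <= M - enorm x; last lra.
apply: le_trans (ler_enormD _ _) _.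
rewrite !enormZ enorm_perp v1 !mulr1 gtr0_norm // expr2 -mulrA normrM gtr0_norm //.
have := ler_piMl (normr_ge0 (s * q)) (ltW s1); lra.
Qed.

Lemma earlier_time (t1 t2 t0 u : R) : t0 <= t2 -> 0 < u -> u < t0 - t1 ->
  t1 <= t0 - u <= t2.
Proof. by move=> h1 h2 h3; apply/andP; split; lra. Qed.

(** At a minimal configuration, [time_inequality] says that [w] moves inwards
    faster than the atoms, by at least [gam], and [space_inequality] that the
    curvature at [w] is at most the mean of those at the atoms. Since the exterior
    [r]-balls at the atoms are free, the two are incompatible. The penalty factor
    [eta] is written [h ^+ 2] because the errors are of order [h]. *)
Lemma no_stationary (eps t1 t2 t0 h g gam : R) lam (P : 'I_3 -> plane R) w :
  0 < eps -> 0 <= t1 -> t1 < t0 -> t0 <= t2 -> lifespan T (t2 + eps) ->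
  0 < g -> 0 < h -> h <= 1 -> 0 < gam ->
  g / 2 <= enorm (w - bary lam P) -> enorm (w - bary lam P) < g ->
  h ^+ 2 * moment lam P < g ->
  weights lam -> (forall i, exists2 j, 0 < lam j & P i = P j) ->
  config (fun t => closure (E (t + eps))) (fun t => closure (~` E t)) t1 t2
    (2 / h ^+ 2) (2 / h ^+ 2 + g) t0 lam P w ->
  (forall t' lam' P' w', config (fun t => closure (E (t + eps))) (fun t => closure (~` E t)) t1 t2
    (2 / h ^+ 2) (2 / h ^+ 2 + g) t' lam' P' w' ->
    enorm (w - bary lam P) / 2 + h ^+ 2 * moment lam P + gam * t0 <=
    quad_energy (h ^+ 2) (enorm (w - bary lam P)) lam' P' w' + gam * t') ->
  h * (4 * r) <= 1 -> h * (16 * (1 + g)) <= 1 ->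
  h * (400 * (1 + g) ^+ 2 / g + 1 + 4 * (1 + g) / r) < gam -> False.
Proof.
move=> eps0 t10 t1t0 t0t2 lt g0 h0 h1 gam0 dg dlt Sg lamw apos cfg hmin hr hG hgam.
have [ht _ PAM [wB wM']] := cfg.
set z := bary lam P in dg dlt hmin; set S := moment lam P in Sg hmin.
set d := enorm (w - z) in dg dlt hmin; set eta := h ^+ 2 in cfg hmin Sg PAM wM'.
have d0 : 0 < d by lra.
have eta0 : 0 < eta by rewrite exprn_gt0.
have etah : eta <= h by rewrite /eta expr2 ger_pMl.
pose A := E (t0 + eps); pose B := E t0; pose n := d^-1 *: (w - z).
have lA : lifespan T (t0 + eps) by apply: lifespan_le lt; lra.
have lB : lifespan T t0 by apply: lifespan_le lA; lra.
have n1 : enorm n = 1 by rewrite /n enormZ -/d gtr0_norm ?invr_gt0 // mulVf // gt_eqF.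
have nE : w - bary lam P = d *: n by rewrite /n scalerA divff ?scale1r // gt_eqF.
have PA i : closure A (P i) by have [] := PAM i.
have PM i : enorm (P i) <= 2 / eta by have [] := PAM i.
have S0 : 0 <= S by apply: sumr_ge0 => i _; rewrite mulr_ge0 ?lamw.1 ?dot_ge0.
pose G := 1 + g.
have nz : `|dot n z| <= enorm z.
  rewrite ler_norml lerNl -dotNl.
  have := ler_dot n z; have := ler_dot (- n) z; rewrite enormN n1 mul1r => -> ->.
  by [].
have [hz [om [omE omh om2 om1]]] :=
  circle_radius h0 h1 g0 S0 Sg (jensen P lamw) (enorm_ge0 z) nz hG.
rewrite -/eta in omE.
have etar : eta * (4 * r) <= 1.
  by apply: le_trans hr; rewrite ler_wpM2r // mulr_ge0 // ltW.
have MM : 2 <= eta * (2 / eta) by rewrite mulrCA divff ?mulr1 // gt_eqF.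
have wM : enorm w < 2 / eta + g.
  have := ler_enormD (w - z) z; rewrite subrK -/d.
  by have := bary_bound lamw PM; rewrite -/z; lra.
have cmin lam' P' w' : weights lam' ->
    (forall i, closure A (P' i) /\ enorm (P' i) <= 2 / eta) ->
    closure (~` B) w' -> enorm w' <= 2 / eta + g ->
    d / 2 + eta * moment lam P <= quad_energy eta d lam' P' w'.
  move=> lw' hP' hw' wm'.
  by have := hmin t0 lam' P' w' (And4 ht lw' hP' (conj hw' wm')); rewrite -/S; lra.
have touch_i := atom_nearest r_gt0 eta0 d0 n1 nE lamw apos PA PM wB cmin wM omh om2 omE etar MM.
have Pbd i : boundary A (P i) := nearest_boundary (b := true) (touch_i i).
have Prg i : is_regular A (P i) := evolution_regular smoothE lA (Pbd i).
pose nu i := normal A (P i).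
have nu1 i : enorm (nu i) = 1 := normal_unit (Prg i).
have nuE i : om *: nu i = n - (2 * eta) *: P i :=
  atom_normal r_gt0 eta0 d0 n1 nE lamw apos PA PM wB cmin wM omh om2 omE etar MM (Prg i).
have kA i : kappa r A (P i) = curvature A (P i) / 2 + (2 * r)^-1.
  rewrite (kappaE km0) //.
  exact: (atom_kappa r_gt0 eta0 d0 n1 nE lamw apos PA PM wB cmin wM omh om2 omE etar MM (Prg i)).
have kA0 i : 0 <= kappa r A (P i).
  by rewrite (kappaE km0) //; exact: (kappa_plus_ge0 r_gt0 (Prg i) (PA i)).
have Pb := atom_bound eta0 d0 n1 nE lamw apos PA PM wB cmin wM omh om2 omE.
have touch_w := exterior_nearest d0 n1 nE lamw PA PM wB cmin wM.
have wbd : boundary B w := nearest_boundary (b := false) touch_w.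
have wrg : is_regular B w := evolution_regular smoothE lB wbd.
have wn : normal B w = n := exterior_normal d0 n1 nE lamw PA PM wB cmin wM wrg.
have Plt i : enorm (P i) < 2 / eta.
  by rewrite ltr_pdivlMr // mulrC; apply: le_lt_trans (Pb i) _; lra.
have small (q : R -> R) (a l : R) : 0 < a -> q u @[u --> 0^'+] --> l ->
    \forall u \near 0^'+, `|u * q u| < a.
  move=> a0 ql; have uq0 : (fun u => u * q u) @ 0^'+ --> (0 : R).
    rewrite [X in _ --> X](_ : _ = 0 * l); last by rewrite mul0r.
    by apply: cvgM ql; exact: cvg_at_right_filter.
  exact: (cvgr0_norm_lt _ uq0).
have wlt : 0 < 2 / eta + g - enorm w by rewrite subr_gt0.
have t00 : 0 < t0 := le_lt_trans t10 t1t0.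
have tA0 : 0 < t0 + eps by rewrite addr_gt0.
have time_est : gam <= kappa r B w - om * (\sum_i lam i * kappa r A (P i)).
  have /choice[q hq] : forall i, exists q : R -> R, q u @[u --> 0^'+] --> kappa r A (P i) /\
      \forall u \near 0^'+, boundary (E (t0 + eps - u)) (P i + (u * q u) *: nu i).
    by move=> i; have [q q1 q2] := time_curve smoothE flowE tA0 lA (Pbd i); exists q.
  have [qw qw1 qw2] := time_curve smoothE flowE t00 lB wbd; rewrite -/B wn in qw1 qw2.
  apply: (time_inequality d0 n1 nE nu1 nuE (fun i => (hq i).1) qw1).
  (* the displaced configuration is admissible for small u *)
  have ball_i : \forall u \near 0^'+, forall i, enorm (P i + (u * q i u) *: nu i) <= 2 / eta.
    apply: filter_forall => i; have a0 : 0 < 2 / eta - enorm (P i) by rewrite subr_gt0.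
    apply: filterS (small _ _ _ a0 (hq i).1) => u hu.
    exact: time_step_bound.
  have ball_w : \forall u \near 0^'+, enorm (w + (u * qw u) *: n) <= 2 / eta + g.
    apply: filterS (small _ _ _ wlt qw1) => u hu.
    exact: time_step_bound.
  have bd_i : \forall u \near 0^'+, forall i,
      boundary (E (t0 + eps - u)) (P i + (u * q i u) *: nu i).
    by apply: filter_forall => i; exact: (hq i).2.
  near=> u; have u0 : 0 < u by near: u; exact: nbhs_right_gt.
  have ut : u < t0 - t1 by near: u; apply: nbhs_right_lt; rewrite subr_gt0.
  have c1 : boundary (E (t0 - u)) (w + (u * qw u) *: n) by near: u.
  have c2 : enorm (w + (u * qw u) *: n) <= 2 / eta + g by near: u.
  have c3 : forall i, enorm (P i + (u * q i u) *: nu i) <= 2 / eta by near: u.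
  have c4 : forall i, boundary (E (t0 + eps - u)) (P i + (u * q i u) *: nu i) by near: u.
  have := hmin (t0 - u) lam (fun i => P i + (u * q i u) *: nu i) (w + (u * qw u) *: n).
  rewrite -/S mulrBr addrA lerBrDr addrAC lerD2r => hm; apply: hm; split=> //.
  - exact: earlier_time.
  - move=> i; split=> //; have := c4 i; rewrite boundaryE (_ : t0 + eps - u = t0 - u + eps).
      by case.
    by ring.
  - by split=> //; move: c1; rewrite boundaryE => -[].
have space_est : 0 <= - (curvature B w / 2) - om * (\sum_i lam i * - (curvature A (P i) / 2)) +
    enorm (n - bary lam nu) ^+ 2 / (2 * d) + eta.
  have /choice[q hq] : forall i, exists q : R -> R, q s @[s --> 0^'+] --> - (curvature A (P i) / 2) /\
      \forall s \near 0^'+, boundary A (P i + s *: perp (nu i) + (s ^+ 2 * q s) *: nu i).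
    by move=> i; have [q q1 q2] := space_curve (Prg i); exists q.
  have [qw qw1 qw2] := space_curve wrg; rewrite wn in qw2.
  apply: (space_inequality d0 n1 nE lamw nu1 nuE (fun i => (hq i).1) qw1).
  have a0 i : 0 < (2 / eta - enorm (P i)) / 2 by rewrite divr_gt0 // subr_gt0.
  have aw0 : 0 < (2 / eta + g - enorm w) / 2 by rewrite divr_gt0.
  have sq_i : \forall s \near 0^'+, forall i, `|s * q i s| < (2 / eta - enorm (P i)) / 2.
    by apply: filter_forall => i; exact: small (a0 i) (hq i).1.
  have sm_i : \forall s \near 0^'+, forall i, s < (2 / eta - enorm (P i)) / 2.
    by apply: filter_forall => i; exact: nbhs_right_lt.
  have sq_w := small _ _ _ aw0 qw1.
  have bd_i : \forall s \near 0^'+, forall i,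
      boundary A (P i + s *: perp (nu i) + (s ^+ 2 * q i s) *: nu i).
    by apply: filter_forall => i; exact: (hq i).2.
  near=> s; have s0 : 0 < s by near: s; exact: nbhs_right_gt.
  have s1 : s < 1 by near: s; exact: nbhs_right_lt.
  have sw : s < (2 / eta + g - enorm w) / 2 by near: s; exact: nbhs_right_lt.
  have c1 : boundary B (w + s *: perp n + (s ^+ 2 * qw s) *: n) by near: s.
  have c2 : `|s * qw s| < (2 / eta + g - enorm w) / 2 by near: s.
  have c3 : forall i, `|s * q i s| < (2 / eta - enorm (P i)) / 2 by near: s.
  have c4 : forall i, s < (2 / eta - enorm (P i)) / 2 by near: s.
  have c5 : forall i, boundary A (P i + s *: perp (nu i) + (s ^+ 2 * q i s) *: nu i) by near: s.
  apply: cmin => //.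
  - move=> i; split; first by have := c5 i; rewrite boundaryE addrA => -[].
    exact: space_step_bound (nu1 i) s0 s1 (c4 i) (c3 i).
  - by move: c1; rewrite boundaryE addrA => -[].
  exact: space_step_bound n1 s0 s1 sw c2.
have defect := atoms_mean_defect eta0 n1 lamw omh nuE.
have sumk0 : 0 <= \sum_i lam i * kappa r A (P i).
  by apply: sumr_ge0 => i _; rewrite mulr_ge0 ?lamw.1.
have sumk : \sum_i lam i * kappa r A (P i) =
    - (\sum_i lam i * - (curvature A (P i) / 2)) + (2 * r)^-1.
  have -> : (2 * r)^-1 = \sum_i lam i * (2 * r)^-1 by rewrite -mulr_suml lamw.2 mul1r.
  rewrite -sumrN -big_split /=.
  by apply: eq_bigr => i _; rewrite kA; ring.
have om_gt0 : 0 < om by apply: lt_le_trans omh; rewrite divr_gt0.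
move: time_est; rewrite (kappaE km0) // /kappa_plus; case: asboolP => _; last first.
  have hh := mulr_ge0 (ltW om_gt0) sumk0.
  by move=> te; have := lt_le_trans gam0 te; rewrite sub0r oppr_gt0 ltNge hh.
rewrite sumk => te.
apply: (velocity_contradiction h0 h1 g0 r_gt0 dg omh om1 defect _ (enorm_ge0 _) etah space_est te hgam).
by rewrite /eta expr2 -mulrA ler_pM2l.
Unshelve. all: by end_near.
Qed.

End StationaryFlow.

(** * The gap between the later convex hull and the exterior *)

Section Gap.
Context {R : realType}.
Variables (r : R) (T : \bar R) (E : R -> set (plane R)).
Hypotheses (r_gt0 : 0 < r) (smoothE : smooth_evolution T E) (flowE : curvature_flow r T E).
Hypothesis km0 : forall t x, lifespan T t -> kappa_minus r (E t) x = 0.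
Implicit Types (v x y z p c nu : plane R).

(** A lower bound on the distance between the convex hull of the closure of
    [E (t + eps)] and the complement of [E t]; by [caratheodory] three points
    give the whole convex hull. *)
Definition gap (eps t g : R) := forall (lam : 'I_3 -> R) (P : 'I_3 -> plane R) w,
  weights lam -> (forall i, closure (E (t + eps)) (P i)) -> closure (~` E t) w ->
  g <= enorm (w - bary lam P).

Lemma small_param (a b c : R) (e : R) : 0 < e -> 0 <= c ->
  exists h, [/\ 0 < h, h <= 1, h * a <= 1, h * b <= 1 & h * c < e].
Proof.
move=> e0 c0; pose X := 1 + `|a| + `|b| + c / e.
have ce : 0 <= c / e by rewrite divr_ge0 // ltW.
have a0 := normr_ge0 a; have b0 := normr_ge0 b.
have X1 : 1 <= X by rewrite /X; lra.
have X0 : 0 < X by lra.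
have iX : 0 < X^-1 by rewrite invr_gt0.
have XX : X^-1 * X = 1 by rewrite mulVf // gt_eqF.
exists X^-1; split=> //.
- by rewrite invf_le1.
- by rewrite -XX ler_pM2l // /X; have := ler_norm a; lra.
- by rewrite -XX ler_pM2l // /X; have := ler_norm b; lra.
rewrite mulrC ltr_pdivrMr // mulrC -ltr_pdivrMr // /X; lra.
Qed.

Lemma closed_shifted_phase (eps t1 t2 : R) : 0 <= eps -> 0 <= t1 -> lifespan T (t2 + eps) ->
  closed [set q : R * plane R | t1 <= q.1 <= t2 /\ closure (E (q.1 + eps)) q.2].
Proof.
move=> e0 t10 lt.
have t1e : 0 <= t1 + eps by lra.
have := closed_phase (T := T) (E := E) (b := true) smoothE t1e lt.
move=> cl; have -> : [set q : R * plane R | t1 <= q.1 <= t2 /\ closure (E (q.1 + eps)) q.2] =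
  (fun q : R * plane R => (q.1 + eps, q.2)) @^-1`
    [set q : R * plane R | t1 + eps <= q.1 <= t2 + eps /\ phase E true q.1 q.2].
  by apply/seteqP; split => q /=; rewrite !lerD2r.
apply: preimage_closed => // q _; apply: pair_continuous => {}q.
  by apply: cvgD; [exact: cvg_fst|exact: cvg_cst].
exact: cvg_snd.
Qed.

(** A configuration violating the conclusion at time [t2] would, for small [gam]
    and [h], give a minimiser of energy less than [g], hence at a time later than
    [t1]. The lower bound [g / 2] keeps the distance away from 0, where it is not
    differentiable. *)
Lemma gap_keeps (eps t1 t2 g : R) : 0 < eps -> 0 <= t1 -> t1 <= t2 ->
  lifespan T (t2 + eps) -> 0 < g -> gap eps t1 g ->
  (forall t, t1 <= t <= t2 -> gap eps t (g / 2)) -> gap eps t2 g.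
Proof.
move=> eps0 t10 t12 lt g0 G1 Gh lam0 P0 w0 lw0 hP0 hw0.
rewrite leNgt; apply/negP => hlt.
set z0 := bary lam0 P0 in hlt.
pose del := (g - enorm (w0 - z0)) / 3; have del0 : 0 < del by rewrite divr_gt0 // subr_gt0.
pose gam := del / (t2 - t1 + 1).
have tt : 0 < t2 - t1 + 1 by lra.
have gam0 : 0 < gam by rewrite divr_gt0.
have gamt : gam * (t2 - t1) + gam = del by rewrite /gam; field; rewrite gt_eqF.
have S00 : 0 <= moment lam0 P0.
  by apply: sumr_ge0 => i _; rewrite mulr_ge0 ?lw0.1 ?dot_ge0.
pose N := \sum_i enorm (P0 i) + enorm w0.
have N0 : 0 <= \sum_i enorm (P0 i) by apply: sumr_ge0 => i _; exact: enorm_ge0.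
have Nw := enorm_ge0 w0.
pose C := 400 * (1 + g) ^+ 2 / g + 1 + 4 * (1 + g) / r.
have C0 : 0 <= C.
  have h1 : 0 <= 400 * (1 + g) ^+ 2 / g.
    by apply: divr_ge0; [have := sqr_ge0 (1 + g); lra|exact: ltW].
  have h2 : 0 <= 4 * (1 + g) / r by rewrite divr_ge0 ?(ltW r_gt0) //; lra.
  by rewrite /C; lra.
have m0 : 0 < Num.min gam del by rewrite lt_min gam0.
have [h [h0 h1 ha hb hc]] := small_param (4 * r + 16 * (1 + g)) N m0 (addr_ge0 C0 S00).
have rp := r_gt0.
have h4r : h * (4 * r) <= 1.
  by apply: le_trans ha; rewrite ler_pM2l //; lra.
have h16 : h * (16 * (1 + g)) <= 1.
  by apply: le_trans ha; rewrite ler_pM2l //; lra.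
have hC : h * C < gam.
  apply: le_lt_trans (_ : h * (C + moment lam0 P0) < _); first by rewrite ler_pM2l // lerDl.
  by apply: lt_le_trans hc _; rewrite ge_min lexx.
have hS : h ^+ 2 * moment lam0 P0 < del.
  apply: le_lt_trans (_ : h * (C + moment lam0 P0) < _).
    rewrite expr2 -mulrA ler_pM2l //; apply: le_trans (ler_piMl S00 h1) _.
    by rewrite lerDr.
  by apply: lt_le_trans hc _; rewrite ge_min lexx orbT.
have h20 : 0 < h ^+ 2 by rewrite exprn_gt0.
have bnd (a : R) : 0 <= a -> a <= N -> a <= 2 / h ^+ 2.
  move=> a0 aN; rewrite ler_pdivlMr // expr2 mulrCA.
  apply: le_trans (_ : h * (a * h) <= _) => //.
  apply: le_trans (_ : 1 * (a * h) <= _).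
    by rewrite ler_wpM2r // mulr_ge0 // ltW.
  by have := ler_wpM2l (ltW h0) aN; lra.
pose F t := closure (E (t + eps)); pose W t := closure (~` E t).
have lt2 : lifespan T t2 by apply: lifespan_le lt; lra.
have cF : closed [set q : R * plane R | t1 <= q.1 <= t2 /\ F q.1 q.2].
  by apply: closed_shifted_phase lt => //; exact: ltW.
have cW : closed [set q : R * plane R | t1 <= q.1 <= t2 /\ W q.1 q.2].
  exact: (closed_phase (T := T) (E := E) (b := false) smoothE t10 lt2).
have c0 : config F W t1 t2 (2 / h ^+ 2) (2 / h ^+ 2 + g) t2 lam0 P0 w0.
  split=> //; first by rewrite t12 lexx.
    move=> i; split; first exact: hP0.
    apply: bnd; first exact: enorm_ge0.
    rewrite /N (bigD1 i) //= -addrA lerDl addr_ge0 //.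
    by apply: sumr_ge0 => j _; exact: enorm_ge0.
  split=> //; have := bnd (enorm w0) Nw; rewrite /N lerDr => /(_ N0); lra.
have [t0 [lam [P [w [cfg emin]]]]] := minimiser_exists (h ^+ 2) gam cF cW c0.
have [/andP[ht1 ht2] lw hP [hw wM]] := cfg.
have := emin _ _ _ _ c0; rewrite /energy -/z0 => e0.
set d := enorm (w - bary lam P) in e0.
have Sp : 0 <= h ^+ 2 * moment lam P.
  by rewrite mulr_ge0 ?(ltW h20) //; apply: sumr_ge0 => i _; rewrite mulr_ge0 ?lw.1 ?dot_ge0.
have gt : gam * t1 <= gam * t0 by rewrite ler_pM2l.
have dg : d + h ^+ 2 * moment lam P < g by rewrite mulrBr in gamt; rewrite /del in gamt hS *; lra.
have t10' : t1 < t0.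
  rewrite lt_neqAle ht1 andbT; apply/eqP => et.
  have := G1 lam P w lw; rewrite et => /(_ (fun i => (hP i).1) hw).
  by rewrite -/d; lra.
have dh : g / 2 <= d by apply: (Gh t0) => //; [rewrite ht1|move=> i; exact: (hP i).1].
have [j0 lj0] := weights_pos lw.
(* atoms of weight zero are free to be anywhere: move them to a genuine one *)
pose Q i := if 0 < lam i then P i else P j0.
have Qb : bary lam Q = bary lam P.
  apply: eq_bigr => i _; rewrite /Q; case: ltP => // li.
  by rewrite (_ : lam i = 0) ?scale0r //; apply/eqP; rewrite eq_le li lw.1.
have Qm : moment lam Q = moment lam P.
  apply: eq_bigr => i _; rewrite /Q; case: ltP => // li.
  by rewrite (_ : lam i = 0) ?mul0r //; apply/eqP; rewrite eq_le li lw.1.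
apply: (no_stationary (t1 := t1) (t2 := t2) (t0 := t0) (h := h) (g := g) (gam := gam)
  (lam := lam) (P := Q) (w := w) r_gt0 smoothE flowE km0 eps0) => //; rewrite ?Qb ?Qm -?/d //.
- by lra.
- by lra.
- move=> i; exists (if 0 < lam i then i else j0); first by case: ifP.
  by rewrite /Q; case: ifP => [->|_] //; rewrite lj0.
- split=> //; first by rewrite ht1.
  by move=> i; rewrite /Q; case: ifP => _; exact: hP.
move=> t' lam' P' w' cfg'; have := emin _ _ _ _ cfg'; rewrite /energy -/d /quad_energy.
set x := enorm (w' - bary lam' P').
have d0 : 0 < d by lra.
have : x <= d / 2 + x ^+ 2 / (2 * d).
  rewrite -subr_ge0; have -> : d / 2 + x ^+ 2 / (2 * d) - x = (x - d) ^+ 2 / (2 * d).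
    by field; rewrite gt_eqF.
  by rewrite divr_ge0 ?sqr_ge0 //; lra.
lra.
Qed.

(** Translating all atoms by [w' - z] keeps them in the convex set [E 0]. *)
Lemma gap_initial (eps : R) : 0 < eps -> lifespan T eps -> convex (E 0) ->
  gap eps 0 (eps / (16 * r)).
Proof.
move=> eps0 le cE lam P w lw hP /closure_enormP cw; rewrite leNgt; apply/negP => hlt.
have [|w' nw' hw'] := cw (eps / (16 * r) - enorm (w - bary lam P)); first by rewrite subr_gt0.
apply: nw'; pose v := w' - bary lam P.
have hv : enorm v < eps / (16 * r).
  by apply: le_lt_trans (ler_enorm_dist _ _ w) _; lra.
have -> : w' = bary lam (fun i => P i + v).
  rewrite /bary; under eq_bigr do rewrite scalerDr.
  by rewrite big_split /= -scaler_suml lw.2 scale1r -/(bary lam P) /v addrC subrK.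
apply: convex_comb3 => //; [exact: lw.1|exact: lw.2|] => i.
apply: (initial_gap r_gt0 smoothE flowE km0 eps0 le cE (p := P i)).
  by have := hP i; rewrite add0r.
by rewrite addrAC subrr add0r.
Qed.

(** Steps of fixed length [tau]: during one step inner discs lose at most half of
    their radius, which is the rough bound needed to restore the sharp one. *)
Lemma gap_all (eps g : R) : 0 < eps -> 0 < g -> gap eps 0 g ->
  forall t, 0 <= t -> lifespan T (t + eps) -> gap eps t g.
Proof.
move=> eps0 g0 G0.
pose K := g^-1 + r^-1; have K0 : 0 < K by rewrite addr_gt0 ?invr_gt0.
pose tau := g / 4 / K; have tau0 : 0 < tau by rewrite !divr_gt0.
have main k : forall t, 0 <= t -> t <= k%:R * tau -> lifespan T (t + eps) -> gap eps t g.
  elim: k => [|k IH] t t0 tk lt.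
    by have -> : t = 0 by apply/eqP; rewrite eq_le t0 andbT; rewrite mul0r in tk.
  have [tk'|tk'] := leP t (k%:R * tau); first exact: IH.
  set t1 := k%:R * tau in IH tk'.
  have t10 : 0 <= t1 by rewrite mulr_ge0 // ltW.
  have tt : t - t1 <= tau.
    by rewrite -natr1 mulrDl mul1r -/t1 in tk; lra.
  have G1 : gap eps t1 g by apply: IH => //; apply: lifespan_le lt; lra.
  apply: (gap_keeps eps0 t10 (ltW tk') lt g0 G1) => s /andP[s1 s2] lam P w lw hP hw.
  have ls : lifespan T (s + eps) by apply: lifespan_le lt; lra.
  apply: (inner_disc_persists r_gt0 smoothE flowE km0 g0 t10 s1 _ _ _ hw).
  - by apply: lifespan_le ls; lra.
  - have : K * (s - t1) <= K * tau by rewrite ler_pM2l //; lra.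
    by have -> : K * tau = g / 4 by rewrite /tau mulrC divfK // gt_eqF.
  move=> w' hw'; apply: G1 => // i.
  by apply: (closure_decreasing r_gt0 smoothE flowE km0 _ _ ls) => //; lra.
move=> t t0 lt; pose k := Num.bound (t / tau).
apply: (main k) => //; rewrite -ler_pdivrMr //; apply: ltW.
by apply: archi_boundP; rewrite divr_ge0 // ltW.
Qed.

(** By the gap, convex combinations of points of [E t] belong to [E (t - eps)] for
    every small [eps]; without nucleation they cannot be exterior at time [t]. *)
Lemma convex_combinations_in_closure t p q s : 0 < t -> lifespan T t ->
  convex (E 0) -> E t p -> E t q -> 0 <= s <= 1 ->
  closure (E t) (s *: p + (1 - s) *: q).
Proof.
move=> t0 lt cE Ep Eq /andP[s0 s1]; apply: contrapT => nz; set z := _ + _ in nz.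
have [e e0 he] := no_phase (b := true) smoothE lt nz.
pose eps := Num.min e t / 2.
have m0 : 0 < Num.min e t by rewrite lt_min e0.
have [m1 m2] : Num.min e t <= e /\ Num.min e t <= t by rewrite !ge_min !lexx orbT.
have eps0 : 0 < eps by rewrite divr_gt0.
have epsE : eps < e /\ eps < t by rewrite /eps; split; lra.
have le : lifespan T eps by apply: lifespan_le lt; lra.
have lte : lifespan T (t - eps) by apply: lifespan_le lt; lra.
have g0 : 0 < eps / (16 * r) by rewrite divr_gt0 // mulr_gt0.
have lt' : lifespan T (t - eps + eps) by rewrite subrK.
have tge : 0 <= t - eps by lra.
have G := gap_all eps0 g0 (gap_initial eps0 le cE) tge lt'.
have nE : ~ E (t - eps) z.
  move=> Ez; apply: (he (t - eps) z lte); last exact: subset_closure.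
    by rewrite addrAC subrr add0r normrN gtr0_norm //; lra.
  by rewrite subrr enorm0.
pose lam (i : 'I_3) : R := if (i == 0 :> nat)%N then s else if (i == 1 :> nat)%N then 1 - s else 0.
pose P (i : 'I_3) : plane R := if (i == 0 :> nat)%N then p else q.
have zE : bary lam P = z.
  by rewrite /bary !big_ord_recl big_ord0 /lam /P /= scale0r !addr0.
have := G lam P z; rewrite zE subrr enorm0 => h.
suff : eps / (16 * r) <= 0 by lra.
apply: h; last exact: subset_closure.
  split; last by rewrite !big_ord_recl big_ord0 /lam /=; ring.
  by move=> i; rewrite /lam; case: ifP => // _; case: ifP => // _; lra.
by move=> i; rewrite subrK /P; case: ifP => _; exact: subset_closure.
Qed.

End Gap.

(** * From the closure to the set itself *)

Section ConvexClosure.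
Context {R : realType}.
Implicit Types (v w x y p c nu : plane R) (A : set (plane R)).

(** Near [x] the boundary is exactly the graph, which belongs to the set in the
    case of a large subgraph and to its complement in the case of a strict one. *)
Lemma boundary_membership A x : is_regular A x ->
  exists2 e, 0 < e & (forall y, boundary A y -> enorm (y - x) < e -> ~ A y) \/
                     (forall y, boundary A y -> enorm (y - x) < e -> A y).
Proof.
move=> [nu [f [n1 hC f0 f10 [d d0 H]]]].
have [/= d1 d10 hd1] := hC.
pose e := Num.min d d1; have e0 : 0 < e by rewrite lt_min d0.
have [ed ed1] : e <= d /\ e <= d1 by rewrite !ge_min !lexx orbT.
clearbody e.
pose sc y := dot (y - x) (perp nu); pose hc y := dot (y - x) nu.
have ycoord y : y = x + sc y *: perp nu + hc y *: nu.
  by rewrite -addrA -frame_decomp // addrC subrK.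
have bc v y z : enorm v = 1 -> `|dot (y - x) v - dot (z - x) v| <= enorm (y - z).
  move=> v1; have := ler_dot (y - z) v; have := ler_dot (- (y - z)) v.
  rewrite enormN v1 mulr1 dotNl !dotBl => h2 h3; rewrite ler_norml; apply/andP; split; lra.
have bc0 v y : enorm v = 1 -> `|dot (y - x) v| <= enorm (y - x).
  by move=> v1; have := bc v y x v1; rewrite subrr dot0l subr0.
have p1 : enorm (perp nu) = 1 by rewrite enorm_perp.
have side (y : plane R) : enorm (y - x) < e ->
    (hc y < f (sc y) -> A y) /\ (f (sc y) < hc y -> ~ A y).
  move=> ye; have yd := lt_le_trans ye ed.
  have h1 : `|sc y| < d by apply: le_lt_trans (bc0 _ _ p1) yd.
  have h2 : `|hc y| < d by apply: le_lt_trans (bc0 _ _ n1) yd.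
  by have := local_subgraph_side H h1 h2; rewrite -ycoord.
(* boundary points near x lie exactly on the graph *)
have on_graph y : boundary A y -> enorm (y - x) < e -> hc y = f (sc y).
  rewrite boundaryE => -[cA cnA] ye.
  have cf : {for sc y, continuous f}.
    apply/differentiable_continuous/derivable1_diffP.
    have [|df _ _] := hd1 (sc y); last exact: df.
    rewrite /ball_ /= sub0r normrN; apply: le_lt_trans (bc0 _ _ p1) _.
    exact: lt_le_trans ye ed1.
  apply: contrapT => /eqP ne; pose a := `|hc y - f (sc y)|.
  have a0 : 0 < a by rewrite normr_gt0 subr_eq0.
  have /cvgrPdist_lt/(_ (a / 2)) := cf; rewrite divr_gt0 // => /(_ isT) /nbhs_ballP[d2 /= d20 hd2].
  pose m := Num.min (e - enorm (y - x)) (Num.min d2 (a / 2)).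
  have m0 : 0 < m by rewrite !lt_min subr_gt0 ye d20 divr_gt0.
  have cls z : enorm (z - y) < m -> enorm (z - x) < e /\
      `|hc y - f (sc y) - (hc z - f (sc z))| < a.
    rewrite !lt_min => /andP[z1 /andP[z2 z3]]; split.
      by apply: le_lt_trans (ler_enorm_dist _ _ y) _; lra.
    have := hd2 (sc z); rewrite /ball /= => /(_ (le_lt_trans (bc _ _ _ p1) _)) hz.
    have {}hz : `|f (sc y) - f (sc z)| < a / 2 by apply: hz; rewrite enormC.
    have hh := bc nu y z n1; rewrite -/(hc y) -/(hc z) (enormC y) in hh.
    have -> : hc y - f (sc y) - (hc z - f (sc z)) = (hc y - hc z) - (f (sc y) - f (sc z)) by ring.
    by apply: le_lt_trans (ler_normB _ _) _; lra.
  have [lt|gt] := ltP (hc y) (f (sc y)).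
    have /closure_enormP/(_ m m0) [z nAz /cls[ze hz]] := cnA; apply: nAz.
    apply: (side z ze).1; move: hz; rewrite /a [X in _ < X]ltr0_norm ?subr_lt0 // ltr_norml => /andP[]; lra.
  have {}gt : f (sc y) < hc y by rewrite lt_neqAle eq_sym ne.
  have /closure_enormP/(_ m m0) [z Az /cls[ze hz]] := cA.
  apply: (side z ze).2 Az; move: hz; rewrite /a [X in _ < X]gtr0_norm ?subr_gt0 // ltr_norml => /andP[]; lra.
have cd y : enorm (y - x) < e -> `|sc y| < d /\ `|hc y| < d.
  move=> ye; have yd := lt_le_trans ye ed.
  by split; [exact: le_lt_trans (bc0 _ _ p1) yd|exact: le_lt_trans (bc0 _ _ n1) yd].
exists e => //; case: H => H; [left|right] => y yb ye; have hy := on_graph y yb ye;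
  have [h1 h2] := cd y ye.
  by rewrite [y]ycoord => /(H _ _ h1 h2); rewrite hy ltxx.
by rewrite [y]ycoord; apply/(H _ _ h1 h2); rewrite hy.
Qed.

(** A point [z] of a segment [p, q] that is not in [A] lies on the boundary. By the
    supporting line at [z] the whole segment does, and along a boundary segment
    membership is locally constant, hence constant. *)
Lemma convex_of_closure A : (forall x, boundary A x -> is_regular A x) ->
  (forall p q s, A p -> A q -> 0 <= s <= 1 -> closure A (s *: p + (1 - s) *: q)) ->
  convex A.
Proof.
move=> reg hA; apply/convexP => p q s Ap Aq s0 s1; apply: contrapT => nz.
set z := _ + _ in nz.
have cz : closure A z by apply: hA => //; rewrite s0.
have zb : boundary A z by rewrite boundaryE; split=> //; exact: subset_closure.
have rz := reg z zb; set nu := normal A z in rz *.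
have n1 : enorm (normal A z) = 1 := normal_unit rz.
have sp : dot (p - z) (normal A z) <= 0 by exact: supporting_halfplane rz hA Ap.
have sq : dot (q - z) (normal A z) <= 0 by exact: supporting_halfplane rz hA Aq.
pose l (a : R) := q + a *: (p - q).
have lz : l s = z by rewrite /l /z; apply: planeP; rewrite !mxE; ring.
have s_gt0 : 0 < s.
  rewrite lt_neqAle s0 andbT; apply/eqP => e; apply: nz.
  by rewrite /z -e scale0r add0r subr0 scale1r.
have s_lt1 : s < 1.
  rewrite lt_neqAle s1 andbT; apply/eqP => e; apply: nz.
  by rewrite /z e subrr scale0r addr0 scale1r.
have dpq : s * dot (p - z) (normal A z) + (1 - s) * dot (q - z) (normal A z) = 0.
  rewrite -!dotZl -dotDl (_ : _ + _ = 0) ?dot0l //.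
  by rewrite /z; apply: planeP; rewrite !mxE; ring.
have dp0 : dot (p - z) (normal A z) = 0.
  have h1 : 0 <= s * - dot (p - z) (normal A z) by rewrite mulr_ge0 // oppr_ge0.
  have h2 : 0 <= (1 - s) * - dot (q - z) (normal A z) by rewrite mulr_ge0 ?oppr_ge0 // subr_ge0.
  have : s * dot (p - z) (normal A z) = 0 by rewrite !mulrN in h1 h2; lra.
  by move/eqP; rewrite mulf_eq0 gt_eqF //= => /eqP.
have dq0 : dot (q - z) (normal A z) = 0.
  move: dpq; rewrite dp0 mulr0 add0r => /eqP; rewrite mulf_eq0 subr_eq0 gt_eqF //=.
  by move/eqP.
(* the whole segment runs in the boundary, inside the supporting line at z *)
have lb a : 0 <= a <= 1 -> boundary A (l a).
  move=> ha; rewrite boundaryE; split.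
    have -> : l a = a *: p + (1 - a) *: q by rewrite /l; apply: planeP; rewrite !mxE; ring.
    exact: hA.
  apply/closure_enormP => e e0; exists (l a + (e / 2) *: normal A z).
    move=> /(supporting_halfplane rz hA).
    have -> : l a + (e / 2) *: normal A z - z =
        a *: (p - z) + (1 - a) *: (q - z) + (e / 2) *: normal A z.
      by rewrite /l; apply: planeP; rewrite !mxE; ring.
    rewrite !dotDl !dotZl dp0 dq0 (unit_dot n1); lra.
  by rewrite addrAC subrr add0r enormZ n1 mulr1 gtr0_norm //; lra.
have lip a b : enorm (l a - l b) = `|a - b| * enorm (p - q).
  by rewrite /l opprD addrACA subrr add0r -scalerBl enormZ.
have loc a : 0 <= a <= 1 -> exists2 d, 0 < d &
   (forall b, 0 <= b <= 1 -> `|b - a| < d -> ~ A (l b)) \/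
   (forall b, 0 <= b <= 1 -> `|b - a| < d -> A (l b)).
  move=> ha; have [e e0 he] := boundary_membership (reg _ (lb a ha)).
  have N0 : 0 < enorm (p - q) + 1 by have := enorm_ge0 (p - q); lra.
  exists (e / (enorm (p - q) + 1)); first by rewrite divr_gt0.
  have cls b : `|b - a| < e / (enorm (p - q) + 1) -> enorm (l b - l a) < e.
    rewrite ltr_pdivlMr // lip mulrDr mulr1; have := normr_ge0 (b - a); lra.
  by case: he => he; [left|right] => b hb /cls; apply: he; exact: lb.
pose I01 := `[0, 1]%classic : set R.
pose U := [set a : R | 0 <= a <= 1 -> A (l a)].
pose V := [set a : R | 0 <= a <= 1 -> ~ A (l a)].
have intU a : 0 <= a <= 1 -> A (l a) -> interior U a.
  move=> ha Aa; have [d d0 [h|h]] := loc a ha.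
    by have := h a ha; rewrite subrr normr0 => /(_ d0).
  by apply/nbhs_ballP; exists d => // b; rewrite /ball /= distrC => hb hb'; exact: h.
have intV a : 0 <= a <= 1 -> ~ A (l a) -> interior V a.
  move=> ha Aa; have [d d0 [h|h]] := loc a ha; last first.
    by have := h a ha; rewrite subrr normr0 => /(_ d0).
  by apply/nbhs_ballP; exists d => // b; rewrite /ball /= distrC => hb hb'; exact: h.
have I01P a : I01 a <-> 0 <= a <= 1 by rewrite /I01 /= in_itv.
have e : I01 `&` interior U = I01.
  apply: (@segment_connected R 0 1).
  - exists 0; split; first by apply/I01P; rewrite lexx ler01.
    apply: intU; first by rewrite lexx ler01.
    by rewrite /l scale0r addr0.
  - by exists (interior U) => //; exact: open_interior.
  - exists (~` interior V); first by apply: open_closedC; exact: open_interior.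
    apply/seteqP; split => a [/I01P ha hU]; split; rewrite ?I01P //.
      by move=> /interior_subset/(_ ha); apply; exact: interior_subset hU ha.
    apply: intU => //; apply: contrapT => nA; apply: hU; exact: intV.
have : I01 s by apply/I01P; rewrite s0.
rewrite -e => -[/I01P hs /interior_subset/(_ hs)]; by rewrite lz.
Qed.

End ConvexClosure.

(** * Conclusion *)

Section Thinness.
Context {R : realType}.
Implicit Types (x v : plane R) (A : set (plane R)).

Lemma rigid_motion_coord (M : plane R -> plane R) : rigid_motion M ->
  exists v a, enorm v = 1 /\ forall x, M x 0 1 = dot x v + a.
Proof.
move=> [A [b [hA hM]]]; exists (\row_j A j 1), (b 0 1); split.
  have /matrixP/(_ 1 1) := mulmx1C hA; rewrite !mxE /= => h.
  rewrite /enorm /dot -[RHS]sqrtr1; congr Num.sqrt; rewrite -[RHS]h.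
  by apply: eq_bigr => i _; rewrite !mxE.
move=> x; rewrite hM !mxE; congr (_ + _).
by apply: eq_bigr => i _; rewrite !mxE.
Qed.

End Thinness.

Theorem theorem1p5 (R : realType) (r : R) (E : set (plane R))
    (Et : R -> set (plane R)) (T : \bar R) :
  0 < r -> r <= 1 ->
  Et 0 = E ->
  smooth_evolution T Et ->
  curvature_flow r T Et ->
  r_thin r E -> convex E ->
  forall t : R, 0 <= t -> (t%:E < T)%E -> r_thin r (Et t) /\ convex (Et t).
Proof.
move=> r0 _ E0 smoothE flowE [M [hM [rho [/andP[rho0 rhor] hE]]]] cE.
rewrite -{}E0 in hE cE.
have [v [a [v1 Ma]]] := rigid_motion_coord hM.
have strip0 x : Et 0 x -> - rho < dot x v + a < rho.
  by move=> Ex; have := hE (M x); rewrite /= Ma; apply; exists x.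
have strip t x : lifespan T t -> Et t x -> - rho <= dot x v + a <= rho.
  move=> lt /(@subset_closure _ (Et t)) cx; apply/andP; split.
    have h0 y : Et 0 y -> dot y (- v) <= rho + a.
      by move=> /strip0/andP[h1 _]; rewrite dotNr; lra.
    have := halfplane_preserved r0 smoothE flowE (v := - v) _ h0 lt cx.
    by rewrite enormN dotNr => /(_ v1); lra.
  have h0 y : Et 0 y -> dot y v <= rho - a by move=> /strip0/andP[_ h1]; lra.
  have := halfplane_preserved r0 smoothE flowE v1 h0 lt cx; lra.
have km0 t x : lifespan T t -> kappa_minus r (Et t) x = 0.
  move=> lt; apply: (kappa_minus_thin r0 (v := v) (a1 := - rho - a) (a2 := rho - a)) => //.
    lra.
  by move=> y /(strip t y lt)/andP[h1 h2]; apply/andP; split; lra.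
move=> t t0 tT; have lt : lifespan T t by [].
split.
  exists M; split=> //; exists ((rho + r) / 2); split; first by apply/andP; split; lra.
  move=> _ [x Ex <-] /=; rewrite Ma.
  by have /andP[h1 h2] := strip t x lt Ex; apply/andP; split; lra.
move: t0; rewrite le_eqVlt => /predU1P[<- //|t0].
apply: convex_of_closure.
  by move=> x bx; have := evolution_regular smoothE lt bx; exact.
by move=> p q s Ep Eq; exact: (convex_combinations_in_closure r0 smoothE flowE km0 t0 lt cE Ep Eq).
Qed.
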